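(* Let $\rho$ be a homogeneous jump kernel. For every initial condition $u_0\in L^1(\mathbb{R}^N)\cap L^\infty(\mathbb{R}^N)$, the problem $$\partial_t u+\mathcal{L}_u u=0\ \text{ on } [0,\infty)\times\mathbb{R}^N,\qquad u(0)=u_0\ \text{ on }\mathbb{R}^N,$$ has a very weak solution $u$ such that $$u\in L^\infty\big([0,\infty),L^1(\mathbb{R}^N)\cap L^\infty(\mathbb{R}^N)\big)\cap C\big([0,\infty),L^1(\mathbb{R}^N)\big).$$ This solution has the following properties: (i) $\int_{\mathbb{R}^N}u(t,x)\,dx=\int_{\mathbb{R}^N}u_0(x)\,dx$ for all $t\ge 0$; (ii) $\|u(t)\|_p\le\|u_0\|_p$ for all $p\in[1,\infty]$ and $t\ge 0$; (iii) if $u_0(x)\ge 0$ for almost every $x\in\mathbb{R}^N$, then $u(t,x)\ge 0$ for almost every $x\in\mathbb{R}^N$ and $t\ge 0$.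
   Context: Homogeneous jump kernel: a function $\rho:(\mathbb{R}\times\mathbb{R})\times(\mathbb{R}^N\times\mathbb{R}^N)\to\mathbb{R}$, written $\rho(a,b;x,y)$, such that for all $a,b,c,d\in\mathbb{R}$ and almost every $(x,y)\in\mathbb{R}^N\times\mathbb{R}^N$: (A1) $\rho$ is a non-negative Borel function; (A2) $\rho(a,b;x,y)=\rho(b,a;y,x)$; (A3) $(a-b)\rho(a,b;x,y)\ge(c-d)\rho(c,d;x,y)$ whenever $a\ge c\ge d\ge b$; (A4) $\rho(a,b;x,y)=\rho(a,b;|x-y|)$, i.e. $\rho$ depends on $x,y$ only through $|x-y|$; (A5) for every $R>0$ there is a function $m_R:[0,\infty)\to[0,\infty)$ such that $\sup_{-R\le a,b\le R}\rho(a,b;x,y)\le m_R(|x-y|)$ and $\int_{\mathbb{R}^N}(1\wedge|y|)\,m_R(|y|)\,dy=K_R<\infty$; (A6) $\rho$ is continuous with respect to the first two variables, and for every $\varepsilon>0$ and every $R>\varepsilon$ there is a constant $C_{R,\varepsilon}$ such that $|\rho(a,b;x,y)-\rho(c,d;x,y)|\le C_{R,\varepsilon}(|a-c|+|b-d|)\,m_R(|x-y|)$ for all $a,b,c,d\in[-R,R]$ with $|a-b|\ge\varepsilon$ and $|c-d|\ge\varepsilon$. Operator: $(\mathcal{L}_v u)(x)=\int_{\mathbb{R}^N}[u(x)-u(y)]\,\rho(v(x),v(y);x,y)\,dy$; for functions of $(t,x)$ it acts in $x$ for each fixed $t$, i.e. $(\mathcal{L}_u\psi)(t,x)=(\mathcal{L}_{u(t)}\psi(t))(x)$.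 Very weak solution: $u\in L^\infty([0,\infty)\times\mathbb{R}^N)$ is a very weak solution of the problem with initial condition $u_0$ if $\int_0^\infty\int_{\mathbb{R}^N}u(t,x)\,[(\partial_t-\mathcal{L}_u)\psi](t,x)\,dx\,dt=0$ for every $\psi\in C_c^\infty((0,\infty)\times\mathbb{R}^N)$ and $\lim_{t\to0}u(t,\cdot)=u_0$ in $L^1_{\mathrm{loc}}(\mathbb{R}^N)$. *)

(* Defs.v *)
From HB Require Import structures.
From mathcomp Require Import all_boot all_order all_algebra.
From mathcomp Require Import all_classical all_reals all_analysis.

Set Implicit Arguments.
Unset Strict Implicit.
Unset Printing Implicit Defensive.
Import Order.TTheory GRing.Theory Num.Theory.
Import numFieldNormedType.Exports.
Local Open Scope classical_set_scope.
Local Open Scope ring_scope.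

(* R^N is 'rV[R]_N, with the sigma-algebra generated by the coordinates (that
   is, the Borel sigma-algebra); the library only has it for n.-tuple. *)
Section measurable_rV.
Context {R : realType} (n : nat).

Let coor (i : 'I_n) (x : 'rV[R]_n) : R := x ord0 i.

Let rV_set0 : g_sigma_preimage coor set0.
Proof. exact: sigma_algebra0. Qed.

Let rV_setC A : g_sigma_preimage coor A -> g_sigma_preimage coor (~` A).
Proof. exact: sigma_algebraC. Qed.

Let rV_bigcup (F : _^nat) : (forall i, g_sigma_preimage coor (F i)) ->
  g_sigma_preimage coor (\bigcup_i (F i)).
Proof. exact: sigma_algebra_bigcup. Qed.

HB.instance Definition _ := @isMeasurable.Build
  (measure_tuple_display default_measure_display)
  'rV[R]_n (g_sigma_preimage coor) rV_set0 rV_setC rV_bigcup.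

Lemma measurable_coord (i : 'I_n) :
  measurable_fun [set: 'rV[R]_n] (fun x => x ord0 i).
Proof.
move=> _ Y mY; rewrite setTI; apply: sub_sigma_algebra => /=.
rewrite -bigcup_seq/=; exists i => /=; first by rewrite mem_index_enum.
by exists Y => //; rewrite setTI.
Qed.

Lemma measurable_fun_rV d (T : measurableType d) (f : T -> 'rV[R]_n) :
  (forall i, measurable_fun setT (fun t => f t ord0 i)) -> measurable_fun setT f.
Proof.
move=> mf; have : g_sigma_preimage (fun i => coor i \o f) `<=` measurable.
  apply: smallest_sub; first exact: sigma_algebra_measurable.
  rewrite -bigcup_seq; apply: bigcup_sub => i _ B [A mA <-].
  exact: mf.
by rewrite g_sigma_preimage_comp => h _ A mA; apply: h; exists A.
Qed.

End measurable_rV.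

(* Lebesgue measure on R^N: the image of the product of the Lebesgue measure of
   R with that of R^(N-1) under (a, v) |-> (a, v_1, ..., v_(N-1)). *)
Section lebesgue_rV.
Context {R : realType}.

Definition consrV n (p : measurableTypeR R * 'rV[R]_n) : 'rV[R]_n.+1 :=
  \row_i oapp (p.2 ord0) p.1 (unlift ord0 i).

Lemma measurable_consrV n : measurable_fun setT (@consrV n).
Proof.
apply: measurable_fun_rV => i; under eq_fun do rewrite mxE.
case: (unlift ord0 i) => [j|] /=; last exact: measurable_fst.
apply: (@measurableT_comp _ _ _ _ _ _ (fun x : 'rV[R]_n => x ord0 j)) => //.
exact: measurable_coord.
Qed.


Definition unconsrV n (x : 'rV[R]_n.+1) : measurableTypeR R * 'rV[R]_n :=
  (x ord0 ord0, \row_i x ord0 (lift ord0 i)).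

Lemma measurable_unconsrV n : measurable_fun setT (@unconsrV n).
Proof.
apply: measurable_fun_pair; first exact: measurable_coord.
apply: measurable_fun_rV => i.
under eq_fun do rewrite mxE.
exact: measurable_coord.
Qed.

Lemma consrVK n : cancel (@consrV n) (@unconsrV n).
Proof.
move=> [a v]; congr pair; first by rewrite mxE unlift_none.
by apply/rowP => i; rewrite !mxE liftK.
Qed.

Section lebesgue_rVS.
Variables (n : nat) (mu : {sigma_finite_measure set 'rV[R]_n -> \bar R}).

Definition lebesgue_rVS : set 'rV[R]_n.+1 -> \bar R :=
  pushforward (@lebesgue_measure R \x mu)%E (@consrV n).

Let lebesgue_rVS0 : lebesgue_rVS set0 = 0%E.
Proof. by apply: measure0; exact: measurable_consrV. Qed.

Let lebesgue_rVS_ge0 A : (0 <= lebesgue_rVS A)%E.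
Proof. by apply: measure_ge0; exact: measurable_consrV. Qed.

Let lebesgue_rVS_sigma_additive : semi_sigma_additive lebesgue_rVS.
Proof.
by apply: measure_semi_sigma_additive; exact: measurable_consrV.
Qed.

HB.instance Definition _ := isMeasure.Build _ _ _ lebesgue_rVS
  lebesgue_rVS0 lebesgue_rVS_ge0 lebesgue_rVS_sigma_additive.

Let lebesgue_rVS_sigma_finite : sigma_finite setT lebesgue_rVS.
Proof.
have /sigma_finiteP[F [FT ndF Foo]] := sigma_finiteT (@lebesgue_measure R).
have /sigma_finiteP[G [GT ndG Goo]] := sigma_finiteT mu.
exists (fun k => @unconsrV n @^-1` (F k `*` G k)).
  apply/esym; rewrite -subTset => x _.
  have [i _ Fi] : (\bigcup_i F i) (unconsrV x).1 by rewrite -FT.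
  have [j _ Gj] : (\bigcup_i G i) (unconsrV x).2 by rewrite -GT.
  exists (maxn i j) => //; split.
  - by move: Fi; exact/subsetPset/ndF/leq_maxl.
  - by move: Gj; exact/subsetPset/ndG/leq_maxr.
move=> k; have [mF Fk] := Foo k; have [mG Gk] := Goo k; split.
  rewrite -[X in measurable X]setTI; apply: measurable_unconsrV => //.
  exact: measurableX.
rewrite /lebesgue_rVS /pushforward -comp_preimage.
rewrite (_ : _ \o _ = id); last by apply/funext => p; exact: consrVK.
by rewrite preimage_id product_measure1E// lte_mul_pinfty// ge0_fin_numE.
Qed.

HB.instance Definition _ := Measure_isSigmaFinite.Build _ _ _ lebesgue_rVS
  lebesgue_rVS_sigma_finite.

End lebesgue_rVS.

Fixpoint lebesgue_rV n : {sigma_finite_measure set 'rV[R]_n -> \bar R} :=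
  match n with
  | 0 => @dirac _ 'rV[R]_0 0 R
  | m.+1 => lebesgue_rVS (lebesgue_rV m)
  end.

Lemma lebesgue_rV_box n (A : 'I_n -> set R) : (forall i, measurable (A i)) ->
  lebesgue_rV n [set x | forall i, A i (x ord0 i)] =
  (\prod_(i < n) lebesgue_measure (A i))%E.
Proof.
elim: n A => [|n IHn] A mA /=.
  by rewrite big_ord0 diracE mem_set// => -[].
rewrite big_ord_recl -IHn; last by move=> i; exact: mA.
set B := [set x : 'rV[R]_n | forall i, A (lift ord0 i) (x ord0 i)].
have mB : measurable B.
  rewrite (_ : B = \bigcap_(i : 'I_n)
    ((fun x : 'rV[R]_n => x ord0 i) @^-1` A (lift ord0 i))).
    apply: fin_bigcap_measurable => // i _.
    by rewrite -[X in measurable X]setTI; exact: measurable_coord.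
  by apply/seteqP; split => x h i; [move=> _|]; exact: h.
rewrite /lebesgue_rVS /pushforward -product_measure1E//; last exact: (mA ord0).
congr product_measure1; apply/seteqP; split => -[a v] /=.
  move=> h; split; first by have := h ord0; rewrite mxE unlift_none.
  by move=> i; have := h (lift ord0 i); rewrite mxE liftK.
move=> [Aa Av] i; rewrite mxE.
by case: unliftP => [j ->|->] /=.
Qed.

End lebesgue_rV.

Section nonlocal_problem.
Context {R : realType} {N : nat}.
Implicit Types (rho : R -> R -> 'rV[R]_N -> 'rV[R]_N -> R).

Local Notation leb := (@lebesgue_measure R).
Local Notation Rge0 := (`[0%R, +oo[%classic : set R).
Local Notation lebN := (@lebesgue_rV R N).

(* The norm `|x| of the library on 'rV[R]_N is the sup norm. *)
Definition enorm (x : 'rV[R]_N) : R := Num.sqrt (\sum_i x ord0 i ^+ 2).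

(* In jump_kernel_bounds, m r is m_R for R = r: one family serves for the
   majorant and for the local Lipschitz estimate. Its measurability is what
   gives a meaning to the integral of (1 /\ |y|) m_R(|y|). *)
Record homogeneous_jump_kernel rho : Prop := {
  jump_kernel_measurable :
    measurable_fun setT (fun p : (R * R) * ('rV[R]_N * 'rV[R]_N) =>
      rho p.1.1 p.1.2 p.2.1 p.2.2);
  jump_kernel_ge0 : forall a b : R,
    {ae (lebN \x lebN)%E, forall p, 0 <= rho a b p.1 p.2};
  jump_kernel_sym : forall a b : R,
    {ae (lebN \x lebN)%E, forall p, rho a b p.1 p.2 = rho b a p.2 p.1};
  jump_kernel_monotone : forall a b c d : R, b <= d -> d <= c -> c <= a ->
    {ae (lebN \x lebN)%E, forall p,
      (c - d) * rho c d p.1 p.2 <= (a - b) * rho a b p.1 p.2};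
  jump_kernel_homogeneous : exists rho0 : R -> R -> R -> R, forall a b : R,
    {ae (lebN \x lebN)%E, forall p,
      rho a b p.1 p.2 = rho0 a b (enorm (p.1 - p.2))};
  jump_kernel_continuous :
    {ae (lebN \x lebN)%E, forall p,
      continuous (fun ab : R * R => rho ab.1 ab.2 p.1 p.2)};
  jump_kernel_bounds : exists m : R -> R -> R,
    (forall r : R, 0 < r -> [/\
      forall s : R, 0 <= s -> 0 <= m r s,
      measurable_fun Rge0 (m r),
      {ae (lebN \x lebN)%E, forall p,
        (ereal_sup [set (rho a b p.1 p.2)%:E |
            a in `[(- r)%R, r]%classic & b in `[(- r)%R, r]%classic]
          <= (m r (enorm (p.1 - p.2)))%:E)%E} &
      (\int[lebN]_y (Num.min 1 (enorm y) * m r (enorm y))%:E < +oo)%E]) /\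
    (forall eps r : R, 0 < eps -> eps < r -> exists C : R, forall a b c d : R,
      a \in `[- r, r] -> b \in `[- r, r] ->
      c \in `[- r, r] -> d \in `[- r, r] ->
      eps <= `|a - b| -> eps <= `|c - d| ->
      {ae (lebN \x lebN)%E, forall p,
        `|rho a b p.1 p.2 - rho c d p.1 p.2| <=
          C * (`|a - c| + `|b - d|) * m r (enorm (p.1 - p.2))})
}.

Definition nonlocal_op rho (v u : 'rV[R]_N -> R) (x : 'rV[R]_N) : R :=
  \int[lebN]_y ((u x - u y) * rho (v x) (v y) x y).

(* In finite dimension, the existence and continuity of the directional
   derivatives of order up to k is k-fold continuous differentiability. *)
Fixpoint Ck {V : normedModType R} (k : nat) (f : V -> R) : Prop :=
  continuous f /\
  if k is k'.+1 then forall v, (forall x, derivable f x v) /\ Ck k' ('D_v f)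
  else True.

(* C_c^oo(]0, +oo[ x R^N), whose elements are extended by 0. *)
Definition test_function (psi : R * 'rV[R]_N -> R) : Prop :=
  [/\ forall k, Ck k psi,
      compact (closure [set p | psi p != 0]) &
      closure [set p | psi p != 0] `<=` [set p | 0 < p.1]].

(* [(d_t - L_u) psi](t, x), the derivative of psi in time being a partial one. *)
Definition adjoint_op rho (u : R -> 'rV[R]_N -> R) (psi : R * 'rV[R]_N -> R)
    (t : R) (x : 'rV[R]_N) : R :=
  derive1 (fun s => psi (s, x)) t - nonlocal_op rho (u t) (fun y => psi (t, y)) x.

(* Integrals are total functions here, so the first two clauses on psi state
   that those defining L_u psi and the weak formulation converge. *)
Definition very_weak_solution rho (u0 : 'rV[R]_N -> R)
    (u : R -> 'rV[R]_N -> R) : Prop :=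
  [/\ measurable_fun (Rge0 `*` setT)
        (fun p : measurableTypeR R * 'rV[R]_N => u p.1 p.2),
      exists M : R, {ae (leb \x lebN)%E, forall p,
        0 <= p.1 -> `|u p.1 p.2| <= M},
      forall psi, test_function psi -> [/\
        {ae (leb \x lebN)%E, forall p, 0 <= p.1 ->
          lebN.-integrable setT (fun y =>
            ((psi p - psi (p.1, y)) * rho (u p.1 p.2) (u p.1 y) p.2 y)%:E)},
        (leb \x lebN)%E.-integrable (Rge0 `*` setT)
          (fun p => (u p.1 p.2 * adjoint_op rho u psi p.1 p.2)%:E) &
        (\int[leb]_(t in Rge0) \int[lebN]_x
          (u t x * adjoint_op rho u psi t x)%:E = 0)%E] &
      forall K : set 'rV[R]_N, compact K ->
        (\int[lebN]_(x in K) `|u t x - u0 x|%:E)%E @[t --> 0^'+] --> 0%E].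

Definition essentially_bounded_L1_Linfty (u : R -> 'rV[R]_N -> R) : Prop :=
  exists M : R, {ae leb, forall t : R, 0 <= t ->
    [/\ u t \in Lfun lebN 1%E, u t \in Lfun lebN +oo%E &
        ('N[lebN]_1[EFin \o u t] + 'N[lebN]_+oo[EFin \o u t] <= M%:E)%E]}.

Definition L1_continuous (u : R -> 'rV[R]_N -> R) : Prop :=
  forall t : R, 0 <= t -> u t \in Lfun lebN 1%E /\
    ('N[lebN]_1[EFin \o (u s \- u t)%R])%E
      @[s --> within Rge0 (nbhs t)] --> 0%E.

End nonlocal_problem.

(* Main.v *)
Require Import Defs.
From HB Require Import structures.
From mathcomp Require Import all_boot all_order all_algebra.
From mathcomp Require Import all_classical all_reals all_analysis.
From mathcomp Require Import measurable_realfun ess_sup_inf.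
From mathcomp Require Import ring lra.

Set Implicit Arguments.
Unset Strict Implicit.
Unset Printing Implicit Defensive.
Import Order.TTheory GRing.Theory Num.Theory.
Import numFieldNormedType.Exports.
Local Open Scope classical_set_scope.
Local Open Scope ring_scope.

(** The solution is the limit in L^1 of explicit Euler schemes for regularised
    kernels; a contraction property makes these schemes Cauchy sequences, and
    replaces the compactness arguments of the usual theory.

    The kernel enters through the flux (a - b) rho(a, b; x, y), which by symmetry
    and monotonicity is nondecreasing in a and nonincreasing in b. Rational
    values of (a, b) being countably many, one slice of the kernel represents
    it almost everywhere by a profile J(a, b, x - y) that satisfies all the
    assumptions at every displacement ([jump_profile_exists]).

    At level e = 1/(n + 1), displacements below e are cut off and the factor
    a - b of the flux is replaced by its soft threshold at e
    ([cut_kernel_step]). The flux then is Lipschitz with an integrable slope,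
    so that an Euler step with a small step size h preserves order; it also
    preserves mass, and these two facts make it a contraction of L^1
    ([euler_contraction]). As a convex combination of values of u, the result
    of a step obeys Jensen's inequality ([euler_jensen]): this gives all the L^p
    bounds and controls the mass far away. As steps commute with translations,
    contraction shows that the modulus of translation never increases.

    For a datum whose translates move at a linear rate in L^1, the nonlocal
    terms at two levels are therefore uniformly close along the schemes
    ([defect_small]): near z = 0 by the modulus, elsewhere because the mass is
    tight and differences below the level carry little of it. By contraction
    the errors of the steps only add up, and the schemes converge uniformly on
    bounded time intervals ([flow_cauchy]). Such data are dense in L^1
    ([bv_closure_summable]); a diagonal choice of data and levels gives
    approximations whose successive distances are geometric
    ([approximate_flows]), hence a limit that is continuous in time with values
    in L^1 and inherits mass and L^p bounds ([evolution_exists]). Positivity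
    follows: for a nonnegative datum, mass and L^1 norm of the solution agree.

    For the weak formulation, a scheme is summed against a test function; the
    sum telescopes, and half of the nonlocal term comes from each order of the
    two points, which leaves the product of the flux and of a difference of
    values of the test function, of order 1 /\ |x - y|. This is dominated by an
    integrable function, so that dominated convergence applies in space at each
    time and then in time ([weak_density_integral]). Undoing the symmetrisation
    gives the required identity ([pairing_operator]). *)

(** * Real-valued integrals *)

Section real_integrals.
Context d (T : measurableType d) (R : realType).
Variable mu : {measure set T -> \bar R}.
Implicit Types f g : T -> R.

Definition summable_fun f := mu.-integrable setT (EFin \o f).

Lemma summable_measurable f : summable_fun f -> measurable_fun setT f.
Proof. by case/integrableP => /measurable_EFinP. Qed.

Lemma summableD f g : summable_fun f -> summable_fun g ->
  summable_fun (fun x => f x + g x).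
Proof. by move=> sf sg; apply: (integrableD measurableT sf sg). Qed.

Lemma summableN f : summable_fun f -> summable_fun (fun x => - f x).
Proof. by move=> sf; apply: (integrableN sf). Qed.

Lemma summableB f g : summable_fun f -> summable_fun g ->
  summable_fun (fun x => f x - g x).
Proof. by move=> sf sg; apply: summableD => //; apply: summableN. Qed.

Lemma summableZ (c : R) f : summable_fun f -> summable_fun (fun x => c * f x).
Proof. by move=> sf; apply: (integrableZl measurableT c sf). Qed.

Lemma summable_norm f : summable_fun f -> summable_fun (fun x => `|f x|).
Proof. by move=> sf; have := integrable_norm sf. Qed.

Lemma summable_le f g : measurable_fun setT f -> (forall x, `|f x| <= g x) ->
  summable_fun g -> summable_fun f.
Proof.
move=> mf fg sg; apply: le_integrable sg => //; first exact/measurable_EFinP.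
by move=> x _ /=; rewrite lee_fin (le_trans (fg x))// ler_norm.
Qed.

Lemma summable0 : summable_fun (fun _ => 0).
Proof. exact: integrable0. Qed.

Lemma summable_sum I (r : seq I) (F : I -> T -> R) :
  (forall i, summable_fun (F i)) ->
  summable_fun (fun x => \sum_(i <- r) F i x).
Proof.
move=> sF; elim: r => [|i r IH].
  by under eq_fun do rewrite big_nil; exact: summable0.
by under eq_fun do rewrite big_cons; exact: summableD.
Qed.

Lemma EFin_Rint f : summable_fun f ->
  (\int[mu]_x f x)%:E = (\int[mu]_x (f x)%:E)%E.
Proof. by move=> sf; rewrite /Rintegral fineK//; exact: integrable_fin_num. Qed.

Lemma RintD f g : summable_fun f -> summable_fun g ->
  \int[mu]_x (f x + g x) = \int[mu]_x f x + \int[mu]_x g x.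
Proof. by move=> sf sg; rewrite RintegralD. Qed.

Lemma RintB f g : summable_fun f -> summable_fun g ->
  \int[mu]_x (f x - g x) = \int[mu]_x f x - \int[mu]_x g x.
Proof. by move=> sf sg; rewrite RintegralB. Qed.

Lemma RintZ (c : R) f : summable_fun f ->
  \int[mu]_x (c * f x) = c * \int[mu]_x f x.
Proof. by move=> sf; rewrite RintegralZl. Qed.

Lemma Rint0 : \int[mu]_x (0 : R) = 0.
Proof. by rewrite /Rintegral integral0. Qed.

Lemma Rint_sum I (r : seq I) (F : I -> T -> R) :
  (forall i, summable_fun (F i)) ->
  \int[mu]_x (\sum_(i <- r) F i x) = \sum_(i <- r) \int[mu]_x F i x.
Proof.
move=> sF; elim: r => [|i r IH].
  by rewrite big_nil -[RHS]Rint0; apply: eq_Rintegral => x _; rewrite big_nil.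
rewrite big_cons -IH -RintD//; last exact: summable_sum.
by apply: eq_Rintegral => x _; rewrite big_cons.
Qed.

Lemma Rint_le f g : summable_fun f -> summable_fun g ->
  (forall x, f x <= g x) -> \int[mu]_x f x <= \int[mu]_x g x.
Proof. by move=> sf sg fg; apply: le_Rintegral. Qed.

Lemma Rint_ge0 f : (forall x, 0 <= f x) -> 0 <= \int[mu]_x f x.
Proof. by move=> f0; apply: Rintegral_ge0 => x _. Qed.

Lemma Rint_norm f : summable_fun f ->
  `|\int[mu]_x f x| <= \int[mu]_x `|f x|.
Proof. by move=> sf; apply: le_normr_Rintegral. Qed.

Lemma eq_Rint f g : (forall x, f x = g x) ->
  \int[mu]_x f x = \int[mu]_x g x.
Proof. by move=> fg; apply: eq_Rintegral => x _. Qed.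

Lemma Rint_eq0 f : (forall x, f x = 0) -> \int[mu]_x f x = 0.
Proof. by move=> f0; rewrite (eq_Rint f0) Rint0. Qed.

Lemma Rint_aeeq f g : measurable_fun setT f -> measurable_fun setT g ->
  {ae mu, forall x, f x = g x} -> \int[mu]_x f x = \int[mu]_x g x.
Proof.
move=> mf mg fg; rewrite /Rintegral; congr fine.
apply: ae_eq_integral => //; [exact/measurable_EFinP..|].
by apply: filterS fg => x /= -> _.
Qed.

Lemma summable_aeeq f g : measurable_fun setT f -> measurable_fun setT g ->
  {ae mu, forall x, f x = g x} -> summable_fun f -> summable_fun g.
Proof.
move=> mf mg fg /integrableP[_ foo]; apply/integrableP; split.
  exact/measurable_EFinP.
rewrite (le_lt_trans _ foo)//= le_eqVlt; apply/orP; left; apply/eqP.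
apply: ae_eq_integral => //.
- exact/measurable_EFinP/measurableT_comp.
- exact/measurable_EFinP/measurableT_comp.
- by apply: filterS fg => x /= -> _.
Qed.

Lemma summable_le_lty f : measurable_fun setT f ->
  (\int[mu]_x `|f x|%:E < +oo)%E -> summable_fun f.
Proof. by move=> mf foo; apply/integrableP; split => //; exact/measurable_EFinP. Qed.

Lemma summable_lty f : summable_fun f -> (\int[mu]_x `|f x|%:E < +oo)%E.
Proof. by move=> /integrableP[]. Qed.

Lemma Rint_cvg (f_ : nat -> T -> R) f g :
  (forall n, measurable_fun setT (f_ n)) -> measurable_fun setT f ->
  {ae mu, forall x, f_ n x @[n --> \oo] --> f x} ->
  summable_fun g -> (forall n x, `|f_ n x| <= g x) ->
  summable_fun f /\ (\int[mu]_x f_ n x) @[n --> \oo] --> \int[mu]_x f x.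
Proof.
move=> mf_ mf cf sg fg.
have [] := @dominated_convergence _ _ _ mu setT measurableT
  (fun n => EFin \o f_ n) (EFin \o f) (EFin \o g).
- by move=> n; exact/measurable_EFinP.
- exact/measurable_EFinP.
- by apply: filterS cf => x cfx _; apply: cvg_EFin => //=; exact: nearW.
- exact: sg.
- by apply: aeW => x n _ /=; rewrite lee_fin.
move=> sf _ cvgf; split => //.
have sf_ n : summable_fun (f_ n) by apply: summable_le sg.
have : (\int[mu]_x f_ n x)%:E @[n --> \oo] --> (\int[mu]_x f x)%:E.
  rewrite EFin_Rint//; apply: cvg_trans cvgf.
  by apply: near_eq_cvg; near=> n; rewrite /= EFin_Rint.
by move/fine_cvg.
Unshelve. all: by end_near. Qed.

End real_integrals.

Section product_integrals.
Context d1 d2 (T1 : measurableType d1) (T2 : measurableType d2) (R : realType).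
Variable m1 : {sigma_finite_measure set T1 -> \bar R}.
Variable m2 : {sigma_finite_measure set T2 -> \bar R}.
Implicit Type f : T1 * T2 -> R.
Local Notation m12 := (m1 \x m2)%E.

Lemma summable_slices f : summable_fun m12 f ->
  {ae m1, forall x, summable_fun m2 (fun y => f (x, y))}.
Proof. by move=> sf; exact: (ae_integrable1 sf). Qed.

Lemma measurable_slice f x : measurable_fun setT f ->
  measurable_fun setT (fun y => f (x, y)).
Proof. by move=> mf; apply: measurableT_comp mf _; exact: measurable_pair1. Qed.

(** The integral is a difference of two integrals of nonnegative functions, even
    where it diverges, and these are measurable in the parameter by Tonelli. *)
Lemma measurable_Rint_param f : measurable_fun setT f ->
  measurable_fun setT (fun x => \int[m2]_y f (x, y)).
Proof.
move=> mf; apply: measurableT_comp; first exact: fine_measurable.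
rewrite (_ : (fun x => _) = (fun x => (\int[m2]_y (EFin \o f)^\+ (x, y) -
  \int[m2]_y (EFin \o f)^\- (x, y))%E)); last first.
  by apply/funext => x; rewrite [LHS]integralE; congr (_ - _)%E;
    apply: eq_integral => y _; rewrite ?(funeposE, funenegE).
have mEf : measurable_fun setT (EFin \o f) by exact/measurable_EFinP.
by apply: emeasurable_funB;
  apply: (measurable_fun_fubini_tonelli_F (m2 := m2)) => //;
  [exact: measurable_funepos|exact: measurable_funeneg].
Qed.

Lemma summable_Rint_param f : summable_fun m12 f ->
  summable_fun m1 (fun x => \int[m2]_y f (x, y)) /\
  \int[m12]_p f p = \int[m1]_x \int[m2]_y f (x, y).
Proof.
move=> sf; have mf := summable_measurable sf.
have aeE : {ae m1, forall x,
    (\int[m2]_y f (x, y))%:E = (\int[m2]_y (f (x, y))%:E)%E}.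
  by apply: filterS (summable_slices sf) => x; exact: EFin_Rint.
have mR := measurable_Rint_param mf.
have sF := integrable_fubini_F sf.
have eI : (\int[m1]_x (\int[m2]_y f (x, y))%:E =
           \int[m1]_x \int[m2]_y (f (x, y))%:E)%E.
  apply: ae_eq_integral => //; first exact/measurable_EFinP.
    by case/integrableP: sF.
  by apply: filterS aeE => x /= -> _.
split.
  apply/integrableP; split; first exact/measurable_EFinP.
  have /integrableP[msF soo] := sF.
  rewrite (le_lt_trans _ soo)// le_eqVlt; apply/orP; left; apply/eqP.
  apply: ae_eq_integral => //.
  - by apply: measurableT_comp => //; exact/measurable_EFinP.
  - exact: measurableT_comp.
  - by apply: filterS aeE => x /= aex _; rewrite /fubini_F /= -aex.
by rewrite /Rintegral -(integral12_prod_meas1 sf) eI.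
Qed.

(** Tonelli's criterion. *)
Lemma summable_iterated f (g : T1 -> R) : measurable_fun setT f ->
  (forall x, 0 <= g x) ->
  {ae m1, forall x, (\int[m2]_y `|f (x, y)|%:E <= (g x)%:E)%E} ->
  summable_fun m1 g -> summable_fun m12 f.
Proof.
move=> mf g0 fg sg; apply/integrable12ltyP; first exact/measurable_EFinP.
have /integrableP[mg goo] := sg.
rewrite (le_lt_trans _ goo)//; apply: ae_ge0_le_integral => //.
- by move=> x _; exact: integral_ge0.
- apply: (measurable_fun_fubini_tonelli_F (m2 := m2) (abse \o (EFin \o f))) => //.
  by apply: measurableT_comp => //; exact/measurable_EFinP.
  by move=> p /=.
- exact: measurableT_comp.
- by apply: filterS fg => x /= h _; rewrite (le_trans h)// lee_fin ler_norm.
Qed.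

End product_integrals.

(** * Measure-preserving maps *)

Section measure_preserving.
Context d1 d2 (X : measurableType d1) (Y : measurableType d2) (R : realType).
Variables (mu : {measure set X -> \bar R}) (nu : {measure set Y -> \bar R}).
Variable phi : X -> Y.

Definition preserves := measurable_fun setT phi /\
  forall A, measurable A -> mu (phi @^-1` A) = nu A.

Hypothesis pphi : preserves.
Let mphi : measurable_fun setT phi := pphi.1.

Lemma preserves_ge0_integral (f : Y -> \bar R) : measurable_fun setT f ->
  (forall y, 0 <= f y)%E -> (\int[mu]_x f (phi x) = \int[nu]_y f y)%E.
Proof.
move=> mf f0.
transitivity (\int[pushforward mu phi]_y f y)%E.
  by rewrite (ge0_integral_pushforward mphi)// preimage_setT.
by apply: eq_measure_integral => A mA _; exact: pphi.2.
Qed.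

Lemma preserves_ae (P : Y -> Prop) :
  {ae nu, forall y, P y} -> {ae mu, forall x, P (phi x)}.
Proof.
move=> [A [mA A0 PA]]; exists (phi @^-1` A); split.
- by rewrite -[X in measurable X]setTI; exact: mphi.
- by rewrite pphi.2.
- by move=> x /= nP; apply: PA.
Qed.

Lemma preserves_summable (f : Y -> R) :
  summable_fun nu f -> summable_fun mu (f \o phi).
Proof.
move=> sf; have mf := summable_measurable sf.
apply: summable_le_lty; first exact: measurableT_comp.
rewrite (preserves_ge0_integral (f := fun y => `|f y|%:E)).
- exact: summable_lty.
- exact/measurable_EFinP/measurableT_comp.
- by [].
Qed.

Lemma preserves_Rint (f : Y -> R) : summable_fun nu f ->
  \int[mu]_x f (phi x) = \int[nu]_y f y.
Proof.
move=> sf; rewrite /Rintegral; congr fine.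
transitivity (\int[pushforward mu phi]_y (f y)%:E)%E.
  rewrite (integral_pushforward mphi)//.
    by case/integrableP: sf.
  exact: preserves_summable.
by apply: eq_measure_integral => A mA _; exact: pphi.2.
Qed.

End measure_preserving.

(** * Lebesgue measure and Borel sets of R^N *)

Section euclidean_borel.
Context {R : realType} {N : nat}.
Local Notation V := 'rV[R]_N.

Lemma measurable_forall_coord (A : 'I_N -> set R) :
  (forall i, measurable (A i)) ->
  measurable [set x : V | forall i, A i (x ord0 i)].
Proof.
move=> mA; rewrite (_ : [set _ | _] =
    \bigcap_(i : 'I_N) ((fun x : V => x ord0 i) @^-1` A i)).
  apply: fin_bigcap_measurable => // i _.
  by rewrite -[X in measurable X]setTI; exact: measurable_coord.
by apply/seteqP; split => x h i; [move=> _|]; exact: h.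
Qed.

Lemma bigcup_countT_measurable d (T : measurableType d) (I : countType)
    (F : I -> set T) :
  (forall i, measurable (F i)) -> measurable (\bigcup_i F i).
Proof.
move=> mF; rewrite (_ : \bigcup_i _ =
    \bigcup_n (if @unpickle I n is Some i then F i else set0)).
  by apply: bigcupT_measurable => n; case: unpickle.
apply/seteqP; split => [x [i _ Fix]|x [n _]].
  by exists (pickle i) => //; rewrite pickleK.
by case: unpickle => [i|//] Fix; exists i.
Qed.

Lemma le_coord_norm (x : V) i : `|x ord0 i| <= `|x|.
Proof.
rewrite [leRHS]/Num.norm /= mx_normrE; apply/bigmax_geP; right => /=.
by exists (ord0, i).
Qed.

(** The half-open cubes of side 1/k with vertices in the lattice of mesh 1/k. *)
Definition cell (k : nat) (z : int * {ffun 'I_N -> int}) : set (R * V) :=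
  [set p : R * V | z.1%:~R <= p.1 * k%:R < (z.1 + 1)%:~R /\
     forall i, (z.2 i)%:~R <= p.2 ord0 i * k%:R < (z.2 i + 1)%:~R].

Lemma measurable_cell k z :
  measurable (cell k z : set (measurableTypeR R * V)).
Proof.
pose A (z : int) : set R := [set t : R | z%:~R <= t * k%:R < (z + 1)%:~R].
have mA t : measurable (A t).
  rewrite (_ : A t = ( *%R^~ k%:R) @^-1` `[t%:~R, (t + 1)%:~R[%classic).
    rewrite -[X in measurable X]setTI.
    exact: (@mulrr_measurable R setT k%:R measurableT _ (measurable_itv _)).
  by apply/seteqP; split => x /=; rewrite in_itv.
rewrite (_ : cell k z =
    A z.1 `*` [set x : V | forall i, A (z.2 i) (x ord0 i)]) //.
apply: measurableX; first exact: mA.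
exact: (@measurable_forall_coord (fun i => A (z.2 i)) (fun i => mA _)).
Qed.

Lemma cell_diameter k z (p q : R * V) (e : R) : (k.+1%:R)^-1 < e ->
  cell k.+1 z p -> cell k.+1 z q -> ball p e q.
Proof.
move=> ke [p1 p2] [q1 q2].
have aux (s t : R) (n : int) : n%:~R <= s * k.+1%:R < (n + 1)%:~R ->
    n%:~R <= t * k.+1%:R < (n + 1)%:~R -> `|s - t| < e.
  rewrite rmorphD/= => /andP[s1 s2] /andP[t1 t2].
  apply: lt_trans ke; rewrite -[ltRHS]mul1r ltr_pdivlMr ?ltr0n//.
  have -> : `|s - t| * k.+1%:R = `|s * k.+1%:R - t * k.+1%:R|.
    by rewrite -mulrBl normrM (@ger0_norm _ k.+1%:R).
  rewrite ltr_norml.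
  by apply/andP; split; lra.
split; first exact: (aux _ _ z.1).
split; first by apply: lt_trans ke; rewrite invr_gt0 ltr0n.
move=> i j; rewrite (ord1 i); exact: (aux _ _ (z.2 j)).
Qed.

Lemma cell_cover k (p : R * V) : exists z, cell k z p.
Proof.
exists (Num.floor (p.1 * k%:R), [ffun i => Num.floor (p.2 ord0 i * k%:R)]).
by split => [|i]; rewrite /= ?ffunE floor_le floorD1_gt.
Qed.

(** The cells of all meshes are countably many, and an open set is the union of
    those that it contains: hence open sets are in the sigma-algebra generated
    by the coordinates. *)
Lemma open_measurable_prod (O : set (R * V)) : open O ->
  measurable (O : set (measurableTypeR R * V)).
Proof.
move=> oO; rewrite (_ : O = \bigcup_(kz : nat * (int * {ffun 'I_N -> int}))
    (if `[< cell kz.1.+1 kz.2 `<=` O >] then cell kz.1.+1 kz.2 else set0)).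
  apply: bigcup_countT_measurable => kz.
  by case: ifPn => // _; exact: measurable_cell.
apply/seteqP; split => [p Op|p [kz _]]; last first.
  by case: ifPn => // /asboolP; exact.
have /nbhs_ballP[e /= e0 peO] : nbhs p O by exact: open_nbhs_nbhs.
have [k ke] : exists k : nat, k.+1%:R^-1 < e.
  exists (Num.truncn (e^-1)).
  rewrite invf_plt ?posrE ?ltr0n//.
  exact: truncnS_gt.
have [z zp] := cell_cover k.+1 p.
exists (k, z) => //=; case: ifPn => // /asboolPn []; move=> q zq.
apply: peO; exact: cell_diameter zp zq.
Qed.

Lemma open_measurable_rV (O : set V) : open O -> measurable O.
Proof.
move=> oO.
have /open_measurable_prod mO : open (@snd R V @^-1` O).
  by move: oO; apply: (@open_comp _ _ (@snd R V)) => p _; exact: cvg_snd.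
rewrite (_ : O = (fun x : V => ((0 : R), x)) @^-1` (snd @^-1` O)) //.
rewrite -[X in measurable X]setTI.
have mp : measurable_fun [set: V] (fun x : V => ((0 : measurableTypeR R), x)).
  exact: pair1_measurable.
exact: mp.
Qed.

Lemma closed_measurable_rV (F : set V) : closed F -> measurable F.
Proof.
by move=> cF; rewrite -(setCK F); apply: measurableC;
  apply: open_measurable_rV; exact: closed_openC.
Qed.

Lemma continuous_measurable_prod (f : R * V -> R) : continuous f ->
  measurable_fun setT (f : measurableTypeR R * V -> R).
Proof.
move=> cf; apply: (measurability _ (RGenOpens.measurableE R)).
move=> _ [_ [a [b ->] <-]]; rewrite setTI.
apply: open_measurable_prod; by apply: open_comp => // ? _; exact: cf.
Qed.

Lemma continuous_measurable_rV (f : V -> R) : continuous f ->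
  measurable_fun setT f.
Proof.
move=> cf; apply: (measurability _ (RGenOpens.measurableE R)).
move=> _ [_ [a [b ->] <-]]; rewrite setTI.
apply: open_measurable_rV; by apply: open_comp => // ? _; exact: cf.
Qed.

Lemma measurable_norm_rV : measurable_fun [set: V] (fun x : V => `|x|).
Proof. by apply: continuous_measurable_rV => x; exact: norm_continuous. Qed.

Lemma measurable_enorm : measurable_fun [set: V] (@enorm R N).
Proof.
have mS : measurable_fun [set: V] (fun x : V => \sum_i x ord0 i ^+ 2).
  by apply: measurable_sum => i; apply: measurable_funX; exact: measurable_coord.
exact: (measurableT_comp (continuous_measurable_fun (@sqrt_continuous R)) mS).
Qed.

Lemma measurable_addrV d (T : measurableType d) (f g : T -> V) :
  measurable_fun setT f -> measurable_fun setT g ->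
  measurable_fun setT (fun t => f t + g t).
Proof.
move=> mf mg; apply: measurable_fun_rV => i.
under eq_fun do rewrite mxE; apply: measurable_funD.
  by apply: (measurableT_comp (measurable_coord i) mf).
by apply: (measurableT_comp (measurable_coord i) mg).
Qed.

Lemma measurable_opprV d (T : measurableType d) (f : T -> V) :
  measurable_fun setT f -> measurable_fun setT (fun t => - f t).
Proof.
move=> mf; apply: measurable_fun_rV => i.
under eq_fun do rewrite mxE; apply: measurable_funN.
by apply: (measurableT_comp (measurable_coord i) mf).
Qed.

Lemma measurable_subrV d (T : measurableType d) (f g : T -> V) :
  measurable_fun setT f -> measurable_fun setT g ->
  measurable_fun setT (fun t => f t - g t).
Proof. by move=> mf mg; apply: measurable_addrV => //; exact: measurable_opprV. Qed.

End euclidean_borel.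

Section boxes.
Context {R : realType} {N : nat}.
Local Notation V := 'rV[R]_N.
Local Notation lam := (@lebesgue_rV R N).

Definition box (a b : 'I_N -> R) : set V :=
  [set x | forall i, x ord0 i \in `]a i, b i]].

Definition boxes : set (set V) := [set B | exists a b, B = box a b].

Definition cube (k : nat) : set V := box (fun=> - k%:R) (fun=> k%:R).

Lemma measurable_box a b : measurable (box a b).
Proof.
by apply: (measurable_forall_coord (A := fun i => `]a i, b i]%classic)).
Qed.

Lemma boxI a b a' b' : box a b `&` box a' b' =
  box (fun i => Num.max (a i) (a' i)) (fun i => Num.min (b i) (b' i)).
Proof.
apply/seteqP; split => x.
  move=> [h h'] i; move: (h i) (h' i); rewrite !in_itv/= gt_max le_min.
  by move=> /andP[-> ->] /andP[-> ->].
move=> h; split => i; move: (h i); rewrite !in_itv/= gt_max le_min.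
  by move=> /andP[/andP[-> _] /andP[-> _]].
by move=> /andP[/andP[_ ->] /andP[_ ->]].
Qed.

Lemma boxes_setI : setI_closed boxes.
Proof.
by move=> _ _ [a [b ->]] [a' [b' ->]]; rewrite boxI; do 2!eexists.
Qed.

Lemma cube_norm k (x : V) : `|x| < k%:R -> cube k x.
Proof.
move=> xk i; rewrite in_itv/=.
have : `|x ord0 i| < k%:R by apply: le_lt_trans xk; exact: le_coord_norm.
by rewrite ltr_norml => /andP[-> /ltW ->].
Qed.

Lemma bigcup_cube : \bigcup_k cube k = setT.
Proof.
apply/seteqP; split => // x _; exists (Num.truncn `|x|).+1 => //.
by apply: cube_norm; exact: truncnS_gt.
Qed.

Lemma boxes_generate : @measurable _ V = <<s boxes >>.
Proof.
apply/seteqP; split; last first.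
  apply: smallest_sub; first exact: sigma_algebra_measurable.
  by move=> _ [a [b ->]]; exact: measurable_box.
apply: smallest_sub; first exact: smallest_sigma_algebra.
rewrite -bigcup_seq; apply: bigcup_sub => i _ _ [A mA <-]; rewrite setTI.
have sB := @smallest_sigma_algebra _ setT boxes.
pose S : set (set R) := [set A | <<s boxes >> ((fun x : V => x ord0 i) @^-1` A)].
suff : <<s @ocitv R >> `<=` S by apply; exact: mA.
apply: smallest_sub.
  split; rewrite /S /=.
  - by rewrite preimage_set0; case: sB.
  - move=> B SB; rewrite setTD preimage_setC -setTD.
    by case: sB => _ + _; apply.
  - by move=> F SF; rewrite preimage_bigcup; case: sB => _ _; apply.
move=> _ [[a b] _ <-]; rewrite /S /=.
(* A slab is the union of the boxes whose other sides fill the line. *)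
rewrite (_ : _ @^-1` _ = \bigcup_k box
    (fun j => if j == i then a else - k%:R)
    (fun j => if j == i then b else k%:R)).
  case: sB => _ _; apply => k; apply: sub_sigma_algebra.
  by do 2!eexists.
apply/seteqP; split => [x xab|x [k _ /(_ i)]]; last by rewrite eqxx.
have [k _ xk] : (\bigcup_k cube k) x by rewrite bigcup_cube.
by exists k => // j; case: eqP => [->//|_]; exact: xk.
Qed.

(** Whether the sides contain their endpoints does not matter: this is what
    lets a reflection, which exchanges the two ends, act on boxes. *)
Lemma lebesgue_box_sides (s t : bool) (a b : 'I_N -> R) :
  lam [set x : V | forall i, x ord0 i \in Interval (BSide s (a i)) (BSide t (b i))] =
  (\prod_i Num.max 0 (b i - a i))%:E.
Proof.
rewrite (lebesgue_rV_box
  (A := fun i => [set` Interval (BSide s (a i)) (BSide t (b i))])) //.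
rewrite -prodEFin; apply: eq_bigr => i _.
rewrite lebesgue_measure_itv/= lte_fin; case: ltP => ab.
  by rewrite max_r// subr_ge0 ltW.
by rewrite max_l// subr_le0.
Qed.

Lemma lebesgue_box a b : lam (box a b) = (\prod_i Num.max 0 (b i - a i))%:E.
Proof. exact: (lebesgue_box_sides false false). Qed.

Lemma lebesgue_box_lty a b : (lam (box a b) < +oo)%E.
Proof. by rewrite lebesgue_box ltry. Qed.

(** Boxes form a pi-system that generates the sigma-algebra and exhausts the
    space by sets of finite measure. *)
Lemma preserves_boxes (phi : V -> V) : measurable_fun setT phi ->
  (forall a b, lam (phi @^-1` box a b) = lam (box a b)) -> preserves lam lam phi.
Proof.
move=> mphi phiB; split => // A mA; apply/esym.
have /= := @measure_unique _ R V boxes cube boxes_generate boxes_setI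
  (fun k => ex_intro _ _ (ex_intro _ _ erefl)) bigcup_cube lam
  (pushforward lam phi).
apply => // [B [a [b ->]]|k]; last exact: lebesgue_box_lty.
by rewrite /pushforward phiB.
Qed.

Lemma shift_preserves (c : V) : preserves lam lam (fun x => x + c).
Proof.
apply: preserves_boxes; first exact: measurable_addrV.
move=> a b; rewrite lebesgue_box (_ : _ @^-1` _ =
  box (fun i => a i - c ord0 i) (fun i => b i - c ord0 i)).
  rewrite lebesgue_box; congr EFin; apply: eq_bigr => i _; congr Num.max; lra.
by apply/seteqP; split => x /= h i; move: (h i); rewrite !mxE !in_itv/=;
  rewrite ltrBlDr lerBrDr.
Qed.

Lemma reflect_preserves (c : V) : preserves lam lam (fun x => c - x).
Proof.
apply: preserves_boxes; first exact: measurable_subrV.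
move=> a b; rewrite lebesgue_box.
rewrite (_ : _ @^-1` _ = [set x : V | forall i, x ord0 i \in
  Interval (BSide true (c ord0 i - b i)) (BSide true (c ord0 i - a i))]).
  rewrite lebesgue_box_sides.
  congr EFin; apply: eq_bigr => i _; congr Num.max; lra.
by apply/seteqP; split => x /= h i; move: (h i); rewrite !mxE !in_itv/=;
  move=> /andP[h1 h2]; apply/andP; split; lra.
Qed.

Lemma lebesgue_rV_gt0 : (0 < lam setT)%E.
Proof.
rewrite (@lt_le_trans _ _ (lam (cube 1)))//; last first.
  by apply: le_measure => //; rewrite inE//; exact: measurable_box.
rewrite lebesgue_box lte_fin; apply: prodr_gt0 => i _.
by rewrite lt_max; apply/orP; right; lra.
Qed.

Local Notation lam2 := (lam \x lam)%E.

Lemma preserves_of_integral (phi : V * V -> V * V) : measurable_fun setT phi ->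
  (forall f : V * V -> \bar R, measurable_fun setT f -> (forall p, 0 <= f p)%E ->
    (\int[lam2]_p f (phi p) = \int[lam2]_p f p)%E) -> preserves lam2 lam2 phi.
Proof.
move=> mphi If; split=> // A mA.
have mphiA : measurable (phi @^-1` A).
  by rewrite -[X in measurable X]setTI; exact: mphi.
have E B : measurable B -> (lam2 B = \int[lam2]_p (\1_B p)%:E)%E.
  by move=> mB; rewrite integral_indic// setIT.
apply: (etrans (E _ mphiA)); apply/esym; apply: (etrans (E _ mA)).
rewrite -(If (fun p => (\1_A p)%:E))//.
by apply/measurable_EFinP; exact: measurable_indic.
Qed.

Lemma swap_preserves : preserves lam2 lam2 (fun p => (p.2, p.1)).
Proof.
have ms : measurable_fun setT (fun p : V * V => (p.2, p.1)).
  by apply: measurable_fun_pair; [exact: measurable_snd|exact: measurable_fst].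
apply: preserves_of_integral => // f mf f0.
rewrite (fubini_tonelli1 (fun p => f (p.2, p.1)))//; last first.
  exact: measurableT_comp mf ms.
by rewrite fubini_tonelli2.
Qed.

(** The change of variables (x, y) -> (x, x - y) turns a translation-invariant
    kernel into a function of one variable. *)
Lemma shear_preserves : preserves lam2 lam2 (fun p => (p.1, p.1 - p.2)).
Proof.
have ms : measurable_fun setT (fun p : V * V => (p.1, p.1 - p.2)).
  apply: measurable_fun_pair; first exact: measurable_fst.
  by apply: measurable_subrV; [exact: measurable_fst|exact: measurable_snd].
apply: preserves_of_integral => // f mf f0.
rewrite (fubini_tonelli1 (fun p : V * V => f (p.1, p.1 - p.2)))//; last first.
  exact: measurableT_comp mf ms.
rewrite fubini_tonelli1//; apply: eq_integral => x _ /=.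
rewrite /fubini_F/=.
apply: (preserves_ge0_integral (reflect_preserves x) (f := fun y => f (x, y))) => //.
exact: measurableT_comp mf (pair1_measurable x).
Qed.

End boxes.

(** * Density in L^1 of functions with an integrable translation modulus *)

Section translation_modulus.
Context {R : realType} {N : nat}.
Local Notation V := 'rV[R]_N.
Local Notation lam := (@lebesgue_rV R N).
Implicit Types u v : V -> R.

(** The weight against which the kernel is integrable. The sup norm is
    below the Euclidean one, so that integrability carries over. *)
Definition jump_weight (z : V) : R := Num.min 1 `|z|.
Local Notation q := jump_weight.

Definition modulus u (z : V) : R := \int[lam]_x `|u x - u (x - z)|.

Lemma jump_weight_ge0 z : 0 <= q z.
Proof. by rewrite le_min ler01 normr_ge0. Qed.

Lemma jump_weight_le1 z : q z <= 1.
Proof. by rewrite ge_min lexx. Qed.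

Lemma measurable_jump_weight : measurable_fun [set: V] q.
Proof. by apply: measurable_minr => //; exact: measurable_norm_rV. Qed.

Lemma summable_translate u z : summable_fun lam u ->
  summable_fun lam (fun x => u (x - z)).
Proof. by move=> su; exact: (preserves_summable (shift_preserves (- z)) su). Qed.

Lemma Rint_translate u z : summable_fun lam u ->
  \int[lam]_x u (x - z) = \int[lam]_x u x.
Proof. by move=> su; exact: (preserves_Rint (shift_preserves (- z)) su). Qed.

Lemma summable_modulus u z : summable_fun lam u ->
  summable_fun lam (fun x => `|u x - u (x - z)|).
Proof. by move=> su; apply/summable_norm/summableB => //; exact: summable_translate. Qed.

Lemma modulus_le_norm u z : summable_fun lam u ->
  modulus u z <= 2 * \int[lam]_x `|u x|.
Proof.
move=> su; have snu := summable_norm su.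
have snt := summable_translate z snu.
rewrite mulr_natl mulr2n -{2}(Rint_translate z snu) -RintD//.
apply: Rint_le; [exact: summable_modulus|exact: summableD|].
by move=> x; exact: ler_normB.
Qed.

(** As q * kap is integrable, these functions have a finite double integral of
    |u x - u y| kap (x - y). Near z = 0 the bound expresses bounded variation. *)
Definition bv_like u := summable_fun lam u /\
  exists2 C : R, 0 <= C & forall z, modulus u z <= C * q z.

Lemma bv_like0 : bv_like (fun=> 0).
Proof.
split; first exact: summable0.
exists 0 => // z; rewrite mul0r /modulus.
by under eq_Rint do rewrite subrr normr0; rewrite Rint0.
Qed.

Lemma bv_likeD u v : bv_like u -> bv_like v -> bv_like (fun x => u x + v x).
Proof.
move=> [su [C C0 uC]] [sv [D D0 vD]]; split; first exact: summableD.
exists (C + D); first exact: addr_ge0.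
move=> z; rewrite mulrDl; apply: le_trans (lerD (uC z) (vD z)).
rewrite /modulus -RintD; [|exact: summable_modulus..].
apply: Rint_le.
- by apply: summable_modulus; exact: summableD.
- by apply: summableD; exact: summable_modulus.
- by move=> x; rewrite opprD addrACA ler_normD.
Qed.

Lemma bv_like_lipschitz (F : R -> R) (K : R) u : measurable_fun setT F ->
  F 0 = 0 -> 0 <= K -> (forall a b, `|F a - F b| <= K * `|a - b|) ->
  bv_like u -> bv_like (F \o u).
Proof.
move=> mF F0 K0 FK [su [C C0 uC]].
have sF : summable_fun lam (F \o u).
  apply: (summable_le (g := fun x => K * `|u x|)).
  - exact: measurableT_comp (summable_measurable su).
  - by move=> x; have := FK (u x) 0; rewrite F0 !subr0.
  - by apply: summableZ; exact: summable_norm.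
split=> //; exists (K * C); first exact: mulr_ge0.
move=> z; rewrite -mulrA; apply: le_trans (ler_wpM2l K0 (uC z)).
rewrite /modulus -RintZ; last exact: summable_modulus.
apply: Rint_le; first exact: summable_modulus.
  by apply: summableZ; exact: summable_modulus.
by move=> x; exact: FK.
Qed.

Lemma prod_diff_le (I : Type) (r : seq I) (x y : I -> R) (K d : R) :
  1 <= K -> 0 <= d ->
  (forall i, [/\ 0 <= y i, y i <= x i, x i <= K & x i - y i <= d]) ->
  \prod_(i <- r) x i - \prod_(i <- r) y i <= (size r)%:R * K ^+ size r * d.
Proof.
move=> K1 d0 xy; have K0 : 0 <= K by lra.
elim: r => [|i r IH]; first by rewrite !big_nil subrr !mul0r.
rewrite !big_cons /=; have [y0 yx xK dd] := xy i.
set X := \prod_(j <- r) x j in IH *; set Y := \prod_(j <- r) y j in IH *.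
have X0 : 0 <= X by apply: prodr_ge0 => j _; have [] := xy j; lra.
have XK : X <= K ^+ size r.
  rewrite /X (_ : K ^+ size r = \prod_(j <- r) K).
    by apply: ler_prod => j _; have [] := xy j; lra.
  by rewrite big_const_seq count_predT iter_mulr mulr1.
have KS : 1 <= K ^+ size r by rewrite exprn_ege1.
have -> : x i * X - y i * Y = (x i - y i) * X + y i * (X - Y) by ring.
have h1 : (x i - y i) * X <= d * K ^+ size r.
  by apply: ler_pM => //; lra.
have IH' : X - Y <= (size r)%:R * K ^+ size r * d by [].
have B0 : 0 <= (size r)%:R * K ^+ size r * d.
  by rewrite !mulr_ge0// exprn_ge0.
have h2 : y i * (X - Y) <= K * ((size r)%:R * K ^+ size r * d).
  apply: (le_trans (ler_wpM2l y0 IH')); apply: ler_wpM2r => //; lra.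
apply: (le_trans (lerD h1 h2)).
rewrite exprS -natr1.
have : d * K ^+ size r <= K * (d * K ^+ size r).
  by rewrite ler_peMl// mulr_ge0//; lra.
lra.
Qed.

Lemma summable_indic (A : set V) : measurable A -> (lam A < +oo)%E ->
  summable_fun lam \1_A.
Proof.
move=> mA Aoo; apply: summable_le_lty; first exact: measurable_indic.
under eq_integral do rewrite ger0_norm//.
by rewrite integral_indic// setIT.
Qed.

Lemma summable_box a b : summable_fun lam \1_(@box R N a b).
Proof. by apply: summable_indic; [exact: measurable_box|exact: lebesgue_box_lty]. Qed.

Lemma Rint_box a b : \int[lam]_x \1_(@box R N a b) x = \prod_i Num.max 0 (b i - a i).
Proof.
rewrite /Rintegral integral_indic//; last exact: measurable_box.
by rewrite setIT; have /= -> := lebesgue_box a b.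
Qed.

(** Moving a box by z only changes the points within |z| of its boundary, that
    is, those of the box enlarged by |z| that are not in the shrunk one. *)
Lemma bv_like_box (a b : 'I_N -> R) : bv_like \1_(box a b).
Proof.
split; first exact: summable_box.
pose K := 1 + \sum_i Num.max 0 (b i - a i + 2).
have sum0 i : Num.max 0 (b i - a i + 2) <= \sum_i Num.max 0 (b i - a i + 2).
  by rewrite (bigD1 i)//= lerDl sumr_ge0// => j _; rewrite le_max lexx.
have K1 : 1 <= K by rewrite lerDl sumr_ge0// => j _; rewrite le_max lexx.
pose C := N%:R * K ^+ N * 4.
pose B := 2 * \int[lam]_x `|\1_(@box R N a b) x : R|.
have B0 : 0 <= B by rewrite mulr_ge0// Rint_ge0.
have C0 : 0 <= C by rewrite !mulr_ge0// exprn_ge0//; lra.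
exists (C + B); first exact: addr_ge0.
move=> z; have [z1|z1] := leP `|z| 1; last first.
  rewrite /q min_l; last exact: ltW.
  rewrite mulr1.
  by apply: (le_trans (modulus_le_norm _ (summable_box a b))); rewrite lerDr.
rewrite /q min_r// mulrDl.
apply: (@le_trans _ _ (C * `|z|)); last by rewrite lerDl mulr_ge0.
set s := `|z| in z1 *; have s0 : 0 <= s by exact: normr_ge0.
pose Bp := @box R N (fun i => a i - s) (fun i => b i + s).
pose Bm := @box R N (fun i => a i + s) (fun i => b i - s).
apply: (@le_trans _ _ (\int[lam]_x (\1_Bp x - \1_Bm x))).
  apply: Rint_le; first exact/summable_modulus/summable_box.
    by apply: summableB; exact: summable_box.
  move=> x; rewrite !indicE.
  have zi i : - s <= z ord0 i <= s by rewrite -ler_norml; exact: le_coord_norm.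
  have Bmp : Bm x -> Bp x.
    by move=> h i; move: (h i); rewrite !in_itv/=; lra.
  have [xm|xm] := pselect (Bm x).
    have xB : box a b x.
      by move=> i; move: (xm i); rewrite !in_itv/=; lra.
    have xzB : box a b (x - z).
      by move=> i; move: (xm i) (zi i); rewrite !in_itv/= !mxE; lra.
    by rewrite (mem_set xB) (mem_set xzB) (mem_set xm) (mem_set (Bmp xm)) !subrr normr0.
  rewrite (memNset xm) subr0.
  have [xp|xp] := pselect (Bp x).
    rewrite (mem_set xp); case: (_ \in _); case: (_ \in _) => /=;
    by rewrite ?subrr ?subr0 ?sub0r ?normrN ?normr0 ?normr1.
  rewrite (memNset xp) !memNset ?subrr ?normr0//.
  - by move=> h; apply: xp => i; move: (h i) (zi i); rewrite !in_itv/= !mxE; lra.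
  - by move=> h; apply: xp => i; move: (h i) (zi i); rewrite !in_itv/=; lra.
rewrite RintB; [|exact: summable_box..].
rewrite !Rint_box.
have -> : C * s = (size (index_enum 'I_N))%:R * K ^+ size (index_enum 'I_N) * (4 * s).
  have -> : size (index_enum 'I_N) = N.
    by rewrite -sum1_size big_const_ord iter_addn_0 mul1n.
  by rewrite /C; ring.
apply: prod_diff_le => //; first by rewrite mulr_ge0.
move=> i; split.
- by rewrite le_max lexx.
- by rewrite ge_max !le_max lexx/=; apply/orP; right; lra.
- apply: (@le_trans _ _ (Num.max 0 (b i - a i + 2))); last first.
    by rewrite (le_trans (sum0 i))// lerDr.
  have aux (y x t : R) : t <= 1 -> y + t - (x - t) <= y - x + 2 by move=> ?; lra.
  by rewrite ge_max !le_max lexx/=; apply/orP; right; exact: aux.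
- have aux (y x t : R) : 0 <= t -> Num.max 0 (y + t - (x - t)) -
      Num.max 0 (y - t - (x + t)) <= 4 * t.
    by move=> ?; rewrite /Num.max; case: ltP => ?; case: ltP => ?; lra.
  exact: aux.
Qed.

(** The closure in L^1 of the previous class, which turns out to be all of
    L^1. *)
Definition bv_closure u := summable_fun lam u /\
  forall e : R, 0 < e -> exists2 g, bv_like g & \int[lam]_x `|u x - g x| <= e.

Lemma bv_like_closure u : bv_like u -> bv_closure u.
Proof.
move=> bu; split; first by case: bu.
move=> e e0; exists u => //.
by under eq_Rint do rewrite subrr normr0; rewrite Rint0 ltW.
Qed.

Lemma bv_closureD u v : bv_closure u -> bv_closure v ->
  bv_closure (fun x => u x + v x).
Proof.
move=> [su bu] [sv bv]; split; first exact: summableD.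
move=> e e0; have e20 : 0 < e / 2 by lra.
have [g bg ug] := bu _ e20; have [h bh vh] := bv _ e20.
have [sg _] := bg; have [sh _] := bh.
exists (fun x => g x + h x); first exact: bv_likeD.
rewrite [e]splitr; apply: le_trans (lerD ug vh).
have s1 : summable_fun lam (fun x => `|u x - g x|) by exact/summable_norm/summableB.
have s2 : summable_fun lam (fun x => `|v x - h x|) by exact/summable_norm/summableB.
rewrite -RintD//; apply: Rint_le.
- by apply/summable_norm/summableB; exact: summableD.
- exact: summableD.
- by move=> x; rewrite opprD addrACA ler_normD.
Qed.

Lemma bv_likeZ c u : bv_like u -> bv_like (fun x => c * u x).
Proof.
apply: (@bv_like_lipschitz ( *%R c) `|c|) => //.
- by rewrite mulr0.
- by move=> a b; rewrite -mulrBr normrM.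
Qed.

Lemma bv_closureZ c u : bv_closure u -> bv_closure (fun x => c * u x).
Proof.
move=> [su bu]; split; first exact: summableZ.
move=> e e0; have c0 : 0 < `|c| + 1 by rewrite ltr_wpDl.
have [g bg ug] := bu (e / (`|c| + 1)) (divr_gt0 e0 c0).
have [sg _] := bg.
exists (fun x => c * g x); first exact: bv_likeZ.
have s1 : summable_fun lam (fun x => `|u x - g x|) by exact/summable_norm/summableB.
have -> : \int[lam]_x `|c * u x - c * g x| = `|c| * \int[lam]_x `|u x - g x|.
  by rewrite -RintZ//; apply: eq_Rint => x; rewrite -mulrBr normrM.
apply: (@le_trans _ _ ((`|c| + 1) * (e / (`|c| + 1)))).
  by apply: ler_pM => //; [exact: Rint_ge0|rewrite lerDl].
by rewrite mulrC divfK// gt_eqF.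
Qed.

Lemma bv_closure_lim u : summable_fun lam u ->
  (forall e : R, 0 < e -> exists2 g, bv_closure g & \int[lam]_x `|u x - g x| <= e) ->
  bv_closure u.
Proof.
move=> su h; split => // e e0; have e20 : 0 < e / 2 by lra.
have [v [sv bv] uv] := h _ e20; have [g bg vg] := bv _ e20.
have [sg _] := bg.
exists g => //; rewrite [e]splitr; apply: le_trans (lerD uv vg).
have s1 : summable_fun lam (fun x => `|u x - v x|) by exact/summable_norm/summableB.
have s2 : summable_fun lam (fun x => `|v x - g x|) by exact/summable_norm/summableB.
rewrite -RintD//; apply: Rint_le.
- exact/summable_norm/summableB.
- exact: summableD.
- by move=> x; exact: ler_distD.
Qed.

Lemma bv_closure_cvg u (g : nat -> V -> R) h : summable_fun lam h ->
  measurable_fun setT u -> (forall n, bv_closure (g n)) ->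
  (forall n x, `|g n x| <= h x) -> (forall x, g n x @[n --> \oo] --> u x) ->
  bv_closure u.
Proof.
move=> sh mu bg gh gu.
have mg n : measurable_fun setT (g n) by have [sg _] := bg n; exact: summable_measurable sg.
have uh x : `|u x| <= h x.
  have c : `|g n x| @[n --> \oo] --> `|u x| by exact: cvg_norm.
  rewrite -(cvg_lim (@Rhausdorff R) c); apply: limr_le; last exact: nearW.
  by apply/cvg_ex; exists `|u x|.
have su : summable_fun lam u by exact: summable_le sh.
apply: bv_closure_lim => // e e0.
have [_] : summable_fun lam (fun _ : V => 0 : R) /\
    (\int[lam]_x `|u x - g n x|) @[n --> \oo] --> \int[lam]_x (0 : R).
  apply: (Rint_cvg (g := fun x => 2 * h x)).
  - by move=> n; apply: measurableT_comp => //; exact: measurable_funB.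
  - exact: measurable_cst.
  - apply: aeW => x; rewrite -(normr0 R) -(subrr (u x)).
    by apply: cvg_norm; apply: cvgB (gu x); exact: cvg_cst.
  - exact: summableZ.
  - move=> n x; rewrite normr_id (le_trans (ler_normB _ _))//.
    by rewrite mulr_natl mulr2n lerD.
rewrite Rint0 => /cvgrPdist_le /(_ e e0) [n _ /(_ n (leqnn n))] h'.
exists (g n) => //; move: h'; rewrite sub0r normrN; apply: le_trans.
exact: ler_norm.
Qed.

Lemma bv_closure_sum (I : Type) (r : seq I) (F : I -> V -> R) :
  (forall i, bv_closure (F i)) -> bv_closure (fun x => \sum_(i <- r) F i x).
Proof.
move=> bF; elim: r => [|i r IH].
  under eq_fun do rewrite big_nil; apply: bv_like_closure; exact: bv_like0.
by under eq_fun do rewrite big_cons; exact: bv_closureD.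
Qed.

Lemma sum_indic_disjoint (F : nat -> set V) (n : nat) (x : V) :
  trivIset setT F ->
  \sum_(i < n) (\1_(F i) x : R) = (`[< exists2 i, (i < n)%N & F i x >])%:R.
Proof.
move=> tF; case: asboolP => [[j jn Fjx]|nF]; last first.
  apply: big1 => i _; rewrite indicE memNset// => Fix.
  by apply: nF; exists i.
rewrite (bigD1 (Ordinal jn))//= indicE mem_set// big1 ?addr0// => i ij.
rewrite indicE memNset// => Fix; move/eqP: ij; apply; apply: val_inj => /=.
by apply: (tF i j I I); exists x.
Qed.

(** A monotone class argument, started from boxes; the cube keeps the measures
    finite, as needed for complements and for dominated convergence. *)
Lemma bv_closure_indic (A : set V) (k : nat) : measurable A ->
  bv_closure (\1_(A `&` cube k)).
Proof.
move=> mA; move: (mA); rewrite boxes_generate => gA.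
move: k; move: A {mA} gA.
pose P (A : set V) := forall k, bv_closure (\1_(A `&` cube k) : V -> R).
apply: (dynkin_induction (P := P) boxes_generate boxes_setI).
- move=> k; rewrite setTI; apply: bv_like_closure; exact: bv_like_box.
- move=> _ [a [b ->]] k; rewrite boxI; apply: bv_like_closure; exact: bv_like_box.
- move=> S mS PS k.
  rewrite (_ : \1_(~` S `&` cube k) =
    (fun x => \1_(cube k) x + (-1) * \1_(S `&` cube k) x)); last first.
    apply/funext => x; rewrite !indicE !in_setI in_setC.
    by case: (_ \in S); case: (_ \in _) => /=; rewrite ?(mulr1, mulr0, addr0, subrr).
  apply: bv_closureD; last exact: bv_closureZ.
  by apply: bv_like_closure; exact: bv_like_box.
- move=> F mF tF PF k.
  apply: (@bv_closure_cvg _ (fun n x => \sum_(i < n) \1_(F i `&` cube k) x)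
    \1_(cube k)).
  + exact: summable_box.
  + apply: measurable_indic; apply: measurableI; last exact: measurable_box.
    exact: bigcupT_measurable.
  + by move=> n; apply: bv_closure_sum => i; exact: PF.
  + have tFk : trivIset setT (fun i => F i `&` cube k) by exact: trivIset_setIr.
    move=> n x; rewrite (@sum_indic_disjoint (fun i => F i `&` cube k)) //.
    rewrite indicE; case: asboolP => [[i _ [_ xk]]|_] /=.
      by rewrite mem_set// normr1.
    by rewrite normr0.
  + move=> x; apply: cvg_near_cst.
    have tFk : trivIset setT (fun i => F i `&` cube k) by exact: trivIset_setIr.
    have [[[j _ Fj] xk]|nx] := pselect ((\bigcup_i F i `&` cube k) x).
      exists j.+1 => // n /= jn; rewrite (@sum_indic_disjoint (fun i => F i `&` cube k))//.
      rewrite indicE mem_set; last by split => //; exists j.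
      by case: asboolP => // -[]; exists j.
    apply: nearW => n; rewrite (@sum_indic_disjoint (fun i => F i `&` cube k))// indicE memNset//.
    case: asboolP => // -[j _ [Fj xk]]; exfalso; apply: nx.
    by split => //; exists j.
Qed.

Import HBSimple.

(** Simple functions are dense; cut by a cube, they are finite combinations of
    the indicators just treated. *)
Lemma bv_closure_summable u : summable_fun lam u -> bv_closure u.
Proof.
move=> su; apply: bv_closure_lim => // e e0.
have [g [sg _ gu]] := approximation_sfun_integrable measurableT su.
have /fine_cvgP[_ /cvgrPdist_le /(_ e e0) [n _ /(_ n (leqnn n))]] := gu.
rewrite sub0r normrN => ge.
have sgn : summable_fun lam (g n) := sg n.
exists (g n : V -> R); last by apply: le_trans ge; exact: ler_norm.
have mgn := summable_measurable sgn.
apply: (@bv_closure_cvg _ (fun k x => g n x * \1_(cube k) x) (fun x => `|g n x|)).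
- exact: summable_norm.
- exact: mgn.
- move=> k; rewrite (_ : (fun x => _) = (fun x =>
    \sum_(y <- finmap.enum_fset (fset_set (range (g n)))) y * \1_(g n @^-1` [set y] `&` cube k) x)).
    apply: bv_closure_sum => y; apply: bv_closureZ; apply: bv_closure_indic.
    by rewrite -[X in measurable X]setTI; apply: mgn => //; exact: measurable_set1.
  apply/funext => x; rewrite {1}(fimfunE (g n) x) fsbig_finite//= mulr_suml.
  by apply: eq_bigr => y _; rewrite indicI /= mulrA.
- move=> k x; rewrite normrM indicE ler_piMr//.
  by case: (_ \in _); rewrite ?normr1 ?normr0.
- move=> x; apply: cvg_near_cst.
  have [k _ xk] : (\bigcup_k cube k) x by rewrite bigcup_cube.
  exists k => // l /= kl; rewrite indicE mem_set ?mulr1// => i.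
  have kl' : (k%:R <= l%:R :> R) by rewrite ler_nat.
  by move: (xk i); rewrite !in_itv/=; lra.
Qed.

End translation_modulus.

(** * From almost every pair of points to every displacement *)

Section almost_everywhere.
Context {R : realType}.

Lemma ae_forall_count d (T : measurableType d) (mu : {measure set T -> \bar R})
    (I : countType) (P : I -> T -> Prop) :
  (forall i, {ae mu, forall x, P i x}) -> {ae mu, forall x, forall i, P i x}.
Proof.
move=> aeP.
have : {ae mu, forall x, forall n : nat,
    if @unpickle I n is Some i then P i x else True}.
  by apply: ae_foralln => n; case: unpickle => // *; exact: aeW.
by apply: filterS => x h i; have := h (pickle i); rewrite pickleK.
Qed.

Lemma ae_exists d (T : measurableType d) (mu : {measure set T -> \bar R})
    (P : T -> Prop) : (0 < mu setT)%E -> {ae mu, forall x, P x} -> exists x, P x.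
Proof.
move=> mu0 [A [mA A0 PA]]; apply: contrapT => nP; move: mu0.
suff -> : [set: T] = A by rewrite A0 ltxx.
by apply/esym/seteqP; split => // x _; apply: PA => Px; apply: nP; exists x.
Qed.

Section product.
Context d1 d2 (T1 : measurableType d1) (T2 : measurableType d2).
Variable m1 : {sigma_finite_measure set T1 -> \bar R}.
Variable m2 : {sigma_finite_measure set T2 -> \bar R}.

Lemma ae_snd (P : T2 -> Prop) : {ae m2, forall y, P y} ->
  {ae (m1 \x m2)%E, forall p, P p.2}.
Proof.
move=> [A [mA A0 PA]]; exists (setT `*` A); split.
- exact: measurableX.
- by rewrite [LHS](product_measure1E m1 m2 measurableT mA) A0 mule0.
- by move=> p /= nP; split => //; exact: PA.
Qed.

Lemma ae_fst (P : T1 -> Prop) : {ae m1, forall x, P x} ->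
  {ae (m1 \x m2)%E, forall p, P p.1}.
Proof.
move=> [A [mA A0 PA]]; exists (A `*` setT); split.
- exact: measurableX.
- rewrite [LHS](product_measure1E m1 m2 mA measurableT).
  by transitivity (0 * m2 [set: T2])%E; [congr (_ * _)%E; exact: A0|exact: mul0e].
- by move=> p /= nP; split => //; exact: PA.
Qed.

Lemma ae_slices (P : T1 * T2 -> Prop) : {ae (m1 \x m2)%E, forall p, P p} ->
  {ae m1, forall x, {ae m2, forall y, P (x, y)}}.
Proof.
move=> [A [mA A0 PA]].
have A0' : (\int[m1]_x `|m2 (xsection A x)| = 0)%E.
  by rewrite -[RHS]A0; apply: eq_integral => x _; rewrite gee0_abs.
have mx : measurable_fun setT (fun x => m2 (xsection A x)).
  exact: measurable_fun_xsection.
have := (ae_eq_integral_abs m1 measurableT mx).1 A0'.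
apply: filterS => x /= /(_ I) Ax0; exists (xsection A x); split => //.
  exact: measurable_xsection.
by move=> y /= nP; rewrite /xsection/= inE; exact: PA.
Qed.

End product.

(** Approximation from a prescribed side is what preserves the order between the
    arguments of the kernel when they are replaced by rationals. *)
Lemma rat_above (x : R) : exists s : nat -> rat,
  forall k, x < ratr (s k) < x + k.+1%:R^-1.
Proof.
have [|s Hs] := @choice nat rat (fun k s => x < ratr s < x + k.+1%:R^-1);
  last by exists s.
move=> k.
have [|s] := @rat_in_itvoo R x (x + k.+1%:R^-1); first by rewrite ltrDl invr_gt0.
by rewrite in_itv/= => ?; exists s.
Qed.

Lemma rat_below (x : R) : exists s : nat -> rat,
  forall k, x - k.+1%:R^-1 < ratr (s k) < x.
Proof.
have [|s Hs] := @choice nat rat (fun k s => x - k.+1%:R^-1 < ratr s < x);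
  last by exists s.
move=> k.
have [|s] := @rat_in_itvoo R (x - k.+1%:R^-1) x.
  by rewrite ltrBlDr ltrDl invr_gt0.
by rewrite in_itv/= => ?; exists s.
Qed.

Lemma cvg_dist_inv (x : R) (s : nat -> R) :
  (forall k, `|x - s k| <= k.+1%:R^-1) -> s k @[k --> \oo] --> x.
Proof.
move=> sx; apply/cvgrPdist_le => e e0; near=> k.
rewrite (le_trans (sx k))// -[leRHS]invrK lef_pV2 ?posrE ?invr_gt0//.
rewrite (le_trans (ltW (truncnS_gt _)))// ler_nat ltnS.
by near: k; exact: nbhs_infty_ge.
Unshelve. all: by end_near. Qed.

Lemma rat_above_cvg (x : R) (s : nat -> rat) :
  (forall k, x < ratr (s k) < x + k.+1%:R^-1) ->
  (ratr (s k) : R) @[k --> \oo] --> x.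
Proof.
move=> sx; apply: cvg_dist_inv => k; have /andP[h1 h2] := sx k.
by move: (ratr (s k)) (k.+1%:R^-1 : R) h1 h2 => y c h1 h2;
  rewrite ler_norml; apply/andP; split; lra.
Qed.

Lemma rat_below_cvg (x : R) (s : nat -> rat) :
  (forall k, x - k.+1%:R^-1 < ratr (s k) < x) ->
  (ratr (s k) : R) @[k --> \oo] --> x.
Proof.
move=> sx; apply: cvg_dist_inv => k; have /andP[h1 h2] := sx k.
by move: (ratr (s k)) (k.+1%:R^-1 : R) h1 h2 => y c h1 h2;
  rewrite ler_norml; apply/andP; split; lra.
Qed.

Lemma cvg_along_pair (f : R * R -> R) (s t : nat -> R) (a b : R) :
  continuous f -> s k @[k --> \oo] --> a -> t k @[k --> \oo] --> b ->
  f (s k, t k) @[k --> \oo] --> f (a, b).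
Proof.
move=> cf sa tb.
apply: (@continuous2_cvg _ _ _ _ _ _ s t (fun x y => f (x, y)) a b _ sa tb).
rewrite (_ : (fun z => _) = f); first exact: cf.
by apply/funext => -[].
Qed.

End almost_everywhere.

Section jump_profile.
Context {R : realType} {N : nat}.
Local Notation V := 'rV[R]_N.
Local Notation lam := (@lebesgue_rV R N).
Local Notation lam2 := (lam \x lam)%E.
Local Notation q := (@jump_weight R N).

(** The kernel as a function of the displacement z = x - y alone, with the
    structural inequalities holding at every z. *)
Record jump_profile (M : R) (kap : V -> R) (J : R -> R -> V -> R) : Prop := {
  profile_measurable :
    measurable_fun setT (fun p : (R * R) * V => J p.1.1 p.1.2 p.2);
  profile_majorant_measurable : measurable_fun setT kap;
  profile_majorant_ge0 : forall z, 0 <= kap z;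
  profile_majorant_summable : summable_fun lam (fun z => q z * kap z);
  profile_ge0 : forall a b z, 0 <= J a b z;
  profile_sym : forall a b z, J a b z = J b a (- z);
  profile_mono : forall a b c d z, b <= d -> d <= c -> c <= a ->
    (c - d) * J c d z <= (a - b) * J a b z;
  profile_continuous : forall z, continuous (fun ab : R * R => J ab.1 ab.2 z);
  profile_le : forall a b z, `|a| <= M -> `|b| <= M -> J a b z <= kap z;
  profile_lipschitz : forall e : R, 0 < e -> exists2 C : R, 0 <= C &
    forall a b c d z, `|a| <= M -> `|b| <= M -> `|c| <= M -> `|d| <= M ->
      e <= `|a - b| -> e <= `|c - d| ->
      `|J a b z - J c d z| <= C * (`|a - c| + `|b - d|) * kap z
}.

Lemma ae_swap (P : V * V -> Prop) : {ae lam2, forall p, P p} ->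
  {ae lam2, forall p, P (p.2, p.1)}.
Proof. exact: (preserves_ae swap_preserves). Qed.

Lemma ae_displacement (P : V -> Prop) : {ae lam, forall z, P z} ->
  {ae lam2, forall p, P (p.1 - p.2)}.
Proof. by move=> /(ae_snd lam) /(preserves_ae shear_preserves). Qed.

Lemma le_norm_enorm (x : V) : `|x| <= enorm x.
Proof.
rewrite [leLHS]/Num.norm/= mx_normrE; apply: bigmax_le; first exact: sqrtr_ge0.
move=> [i j] _ /=; rewrite (ord1 i) -sqrtr_sqr /enorm ler_wsqrtr//.
by rewrite (bigD1 j)//= lerDl sumr_ge0// => k _; exact: sqr_ge0.
Qed.

Lemma enormN (x : V) : enorm (- x) = enorm x.
Proof.
by rewrite /enorm; congr Num.sqrt; apply: eq_bigr => i _; rewrite mxE sqrrN.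
Qed.

(** Properties that hold almost everywhere for each value of the arguments hold
    almost everywhere for all rational values at once, since these are countably
    many; continuity in these arguments then extends them to real values. *)
Section at_a_point.
Variables (f : R -> R -> R) (cf : continuous (fun ab : R * R => f ab.1 ab.2)).

Lemma real_ge0_of_rat : (forall a b : rat, 0 <= f (ratr a) (ratr b)) ->
  forall a b, 0 <= f a b.
Proof.
move=> fr a b; have [s sa] := rat_above a; have [t tb] := rat_above b.
have H := cvg_along_pair cf (rat_above_cvg sa) (rat_above_cvg tb).
apply: (@ler_cvg_to _ _ _ _ (fun=> 0) _ _ _ (cvg_cst 0) H).
by apply: nearW => k; exact: fr.
Qed.

(** The outer arguments are approximated from outside and the inner ones from
    inside, so that the rationals are nested like the reals. *)
Lemma real_mono_of_rat : (forall a b, 0 <= f a b) ->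
  (forall a b c d : rat, b <= d -> d <= c -> c <= a ->
    (ratr c - ratr d) * f (ratr c) (ratr d) <=
      (ratr a - ratr b) * f (ratr a) (ratr b)) ->
  forall a b c d, b <= d -> d <= c -> c <= a ->
    (c - d) * f c d <= (a - b) * f a b.
Proof.
move=> f0 fr a b c d bd dc ca.
move: dc; rewrite le_eqVlt => /orP[/eqP dc|dc].
  by rewrite dc subrr mul0r mulr_ge0//; lra.
have [sa Ha] := rat_above a; have [sb Hb] := rat_below b.
have [sc Hc] := rat_below c; have [sd Hd] := rat_above d.
have ca_ := rat_above_cvg Ha; have cb_ := rat_below_cvg Hb.
have cc_ := rat_below_cvg Hc; have cd_ := rat_above_cvg Hd.
have H1 : (ratr (sc k) - ratr (sd k)) * f (ratr (sc k)) (ratr (sd k))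
    @[k --> \oo] --> (c - d) * f c d.
  exact: cvgM (cvgB cc_ cd_) (cvg_along_pair cf cc_ cd_).
have H2 : (ratr (sa k) - ratr (sb k)) * f (ratr (sa k)) (ratr (sb k))
    @[k --> \oo] --> (a - b) * f a b.
  exact: cvgM (cvgB ca_ cb_) (cvg_along_pair cf ca_ cb_).
apply: (ler_cvg_to H1 H2).
have h1 : \forall k \near \oo, ratr (sd k) < (c + d) / 2.
  by apply: (cvgr_lt d) => //; lra.
have h2 : \forall k \near \oo, (c + d) / 2 < ratr (sc k).
  by apply: (cvgr_gt c) => //; lra.
near=> k.
have k1 : ratr (sd k) < (c + d) / 2 by near: k.
have k2 : (c + d) / 2 < ratr (sc k) by near: k.
have := Ha k; have := Hb k; have := Hc k; have := Hd k => Hd' Hc' Hb' Ha'.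
by apply: fr; rewrite -(@ler_rat R); lra.
Unshelve. all: by end_near. Qed.

(** The interval is larger and the separation smaller in the hypothesis, to
    leave room for the rational approximations. *)
Lemma real_lipschitz_of_rat (M C e kz : R) : 0 < e ->
  (forall a b c d : rat, (ratr a : R) \in `[- (M + 1), M + 1] ->
    (ratr b : R) \in `[- (M + 1), M + 1] ->
    (ratr c : R) \in `[- (M + 1), M + 1] ->
    (ratr d : R) \in `[- (M + 1), M + 1] ->
    e / 2 <= `|ratr a - ratr b| -> e / 2 <= `|ratr c - ratr d| ->
    `|f (ratr a) (ratr b) - f (ratr c) (ratr d)| <=
      C * (`|ratr a - ratr c| + `|ratr b - ratr d|) * kz) ->
  forall a b c d, `|a| <= M -> `|b| <= M -> `|c| <= M -> `|d| <= M ->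
    e <= `|a - b| -> e <= `|c - d| ->
    `|f a b - f c d| <= C * (`|a - c| + `|b - d|) * kz.
Proof.
move=> e0 fr a b c d aM bM cM dM eab ecd.
have [sa Ha] := rat_above a; have [sb Hb] := rat_above b.
have [sc Hc] := rat_above c; have [sd Hd] := rat_above d.
have ca_ := rat_above_cvg Ha; have cb_ := rat_above_cvg Hb.
have cc_ := rat_above_cvg Hc; have cd_ := rat_above_cvg Hd.
have R1 : `|f (ratr (sa k)) (ratr (sb k)) - f (ratr (sc k)) (ratr (sd k))|
    @[k --> \oo] --> `|f a b - f c d|.
  apply: cvg_norm; apply: cvgB.
    exact: (cvg_along_pair cf ca_ cb_).
  exact: (cvg_along_pair cf cc_ cd_).
have R2 : C * (`|ratr (sa k) - ratr (sc k)| + `|ratr (sb k) - ratr (sd k)|) * kz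
    @[k --> \oo] --> C * (`|a - c| + `|b - d|) * kz.
  apply: cvgM; last exact: cvg_cst.
  apply: cvgM; first exact: cvg_cst.
  by apply: cvgD; apply: cvg_norm; [exact: (cvgB ca_ cc_)|exact: (cvgB cb_ cd_)].
apply: (ler_cvg_to R1 R2).
have h1 : \forall k \near \oo, e / 2 < `|ratr (sa k) - ratr (sb k)| :> R.
  have R3 : `|ratr (sa k) - ratr (sb k) : R| @[k --> \oo] --> `|a - b|.
    by apply: cvg_norm; exact: (cvgB ca_ cb_).
  by apply: (cvgr_gt `|a - b| R3); lra.
have h2 : \forall k \near \oo, e / 2 < `|ratr (sc k) - ratr (sd k)| :> R.
  have R3 : `|ratr (sc k) - ratr (sd k) : R| @[k --> \oo] --> `|c - d|.
    by apply: cvg_norm; exact: (cvgB cc_ cd_).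
  by apply: (cvgr_gt `|c - d| R3); lra.
near=> k.
have k1 : (k.+1%:R^-1 <= 1 :> R) by rewrite invf_le1// ler1n.
have aux (x : R) (s : nat -> rat) : (forall k, x < ratr (s k) < x + k.+1%:R^-1) ->
    `|x| <= M -> (ratr (s k) : R) \in `[- (M + 1), M + 1].
  move=> /(_ k)/andP[h1' h2']; rewrite ler_norml => /andP[h3 h4]; rewrite in_itv/=.
  move: (ratr (s k)) (k.+1%:R^-1 : R) k1 h1' h2' => y c' k1 h1' h2'.
  by apply/andP; split; lra.
apply: fr; [exact: aux|exact: aux|exact: aux|exact: aux| |]; apply: ltW; near: k => //.
Unshelve. all: by end_near. Qed.

End at_a_point.

Variable rho : R -> R -> V -> V -> R.
Hypothesis hrho : homogeneous_jump_kernel rho.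

(** By homogeneity a single slice of the kernel, taken at a point whose
    almost every displacement is regular, represents it everywhere. *)
Lemma jump_profile_exists (M : R) : 0 <= M ->
  exists kap J, jump_profile M kap J /\
    {ae lam2, forall p, forall a b, rho a b p.1 p.2 = J a b (p.1 - p.2)}.
Proof.
(* The margin 1 leaves room for rational approximations. *)
move=> M0; pose r := M + 1; have r0 : 0 < r by rewrite ltr_wpDl.
have [rho0 hom] := jump_kernel_homogeneous hrho.
have [m [mbd mlip]] := jump_kernel_bounds hrho.
have [m_ge0 m_meas m_sup m_int] := mbd r r0.
pose kap (z : V) := m r (enorm z).
have en0 (z : V) : 0 <= enorm z by exact: sqrtr_ge0.
have kap0 z : 0 <= kap z by exact: m_ge0.
have kapN z : kap (- z) = kap z by rewrite /kap enormN.
have mkap : measurable_fun setT kap.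
  have sub : @enorm R N @` setT `<=` `[0%R, +oo[%classic.
    by move=> _ [z _ <-]; rewrite /= in_itv/= andbT.
  exact: (measurable_comp (measurable_itv _) sub m_meas measurable_enorm).
have skap : summable_fun lam (fun z => q z * kap z).
  have mq := @measurable_jump_weight R N.
  apply: (summable_le (g := fun z => Num.min 1 (enorm z) * kap z)).
  - exact: measurable_funM.
  - move=> z; rewrite ger0_norm; last by rewrite mulr_ge0 ?jump_weight_ge0.
    apply: ler_wpM2r => //; rewrite le_min jump_weight_le1/=.
    by rewrite ge_min le_norm_enorm orbT.
  - apply: summable_le_lty.
      apply: measurable_funM => //; apply: measurable_minr => //.
      exact: measurable_enorm.
    apply: le_lt_trans m_int; rewrite le_eqVlt; apply/orP; left; apply/eqP.
    apply: eq_integral => z _; rewrite ger0_norm// mulr_ge0//.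
    by rewrite le_min ler01 en0.
pose eps (n : nat) : R := n.+2%:R^-1.
have eps0 n : 0 < eps n by rewrite invr_gt0.
have epsr n : eps n < r.
  rewrite (@lt_le_trans _ _ 1)// ?lerDr//.
  by rewrite invf_lt1// ltr1n.
have [C HC] : exists C : nat -> R, forall n, forall a b c d : R,
      a \in `[- r, r] -> b \in `[- r, r] ->
      c \in `[- r, r] -> d \in `[- r, r] ->
      eps n <= `|a - b| -> eps n <= `|c - d| ->
      {ae lam2, forall p,
        `|rho a b p.1 p.2 - rho c d p.1 p.2| <=
          C n * (`|a - c| + `|b - d|) * kap (p.1 - p.2)}.
  have [|C HC] := (@choice nat R (fun n Cn => forall a b c d : R,
      a \in `[- r, r] -> b \in `[- r, r] ->
      c \in `[- r, r] -> d \in `[- r, r] ->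
      eps n <= `|a - b| -> eps n <= `|c - d| ->
      {ae lam2, forall p,
        `|rho a b p.1 p.2 - rho c d p.1 p.2| <=
          Cn * (`|a - c| + `|b - d|) * kap (p.1 - p.2)})); last by exists C.
  by move=> n; exact: mlip.
pose Phom (p : V * V) := forall ab : rat * rat,
  rho (ratr ab.1) (ratr ab.2) p.1 p.2 =
  rho0 (ratr ab.1) (ratr ab.2) (enorm (p.1 - p.2)).
pose Psym (p : V * V) := forall ab : rat * rat,
  rho (ratr ab.1) (ratr ab.2) p.1 p.2 = rho (ratr ab.2) (ratr ab.1) p.2 p.1.
pose Pge0 (p : V * V) := forall ab : rat * rat,
  0 <= rho (ratr ab.1) (ratr ab.2) p.1 p.2.
pose Pmono (p : V * V) := forall w : (rat * rat) * (rat * rat),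
  w.1.2 <= w.2.2 -> w.2.2 <= w.2.1 -> w.2.1 <= w.1.1 ->
  (ratr w.2.1 - ratr w.2.2) * rho (ratr w.2.1) (ratr w.2.2) p.1 p.2 <=
  (ratr w.1.1 - ratr w.1.2) * rho (ratr w.1.1) (ratr w.1.2) p.1 p.2.
pose Pcont (p : V * V) := continuous (fun ab : R * R => rho ab.1 ab.2 p.1 p.2).
pose Psup (p : V * V) := (ereal_sup [set (rho a b p.1 p.2)%:E |
            a in `[(- r)%R, r]%classic & b in `[(- r)%R, r]%classic]
          <= (m r (enorm (p.1 - p.2)))%:E)%E.
pose Plip (p : V * V) := forall w : nat * ((rat * rat) * (rat * rat)),
  (ratr w.2.1.1 : R) \in `[- r, r] -> (ratr w.2.1.2 : R) \in `[- r, r] ->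
  (ratr w.2.2.1 : R) \in `[- r, r] -> (ratr w.2.2.2 : R) \in `[- r, r] ->
  eps w.1 <= `|ratr w.2.1.1 - ratr w.2.1.2| ->
  eps w.1 <= `|ratr w.2.2.1 - ratr w.2.2.2| ->
  `|rho (ratr w.2.1.1) (ratr w.2.1.2) p.1 p.2 -
    rho (ratr w.2.2.1) (ratr w.2.2.2) p.1 p.2| <=
    C w.1 * (`|ratr w.2.1.1 - ratr w.2.2.1| + `|ratr w.2.1.2 - ratr w.2.2.2|)
      * kap (p.1 - p.2).
have ahom : {ae lam2, forall p, Phom p} by apply: ae_forall_count => ab; exact: hom.
have asym : {ae lam2, forall p, Psym p}.
  by apply: ae_forall_count => ab; exact: jump_kernel_sym.
have age0 : {ae lam2, forall p, Pge0 p}.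
  by apply: ae_forall_count => ab; exact: jump_kernel_ge0.
have amono : {ae lam2, forall p, Pmono p}.
  apply: ae_forall_count => w.
  have [[h1 h2 h3]|nh] := pselect [/\ w.1.2 <= w.2.2, w.2.2 <= w.2.1 & w.2.1 <= w.1.1].
    have := jump_kernel_monotone hrho (a := ratr w.1.1) (b := ratr w.1.2)
      (c := ratr w.2.1) (d := ratr w.2.2).
    rewrite !ler_rat => /(_ h1 h2 h3); apply: filterS => p Hp _ _ _; exact: Hp.
  by apply: aeW => p h1 h2 h3; exfalso; apply: nh.
have acont : {ae lam2, forall p, Pcont p} by exact: jump_kernel_continuous hrho.
have asup : {ae lam2, forall p, Psup p} by exact: m_sup.
have alip : {ae lam2, forall p, Plip p}.
  apply: ae_forall_count => w.
  have [[h1 h2 h3 [h4 h5 h6]]|nh] := pselect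
    [/\ (ratr w.2.1.1 : R) \in `[- r, r], (ratr w.2.1.2 : R) \in `[- r, r],
     (ratr w.2.2.1 : R) \in `[- r, r] &
     [/\ (ratr w.2.2.2 : R) \in `[- r, r],
     eps w.1 <= `|ratr w.2.1.1 - ratr w.2.1.2| &
     eps w.1 <= `|ratr w.2.2.1 - ratr w.2.2.2|]].
    have := HC w.1 _ _ _ _ h1 h2 h3 h4 h5 h6.
    by apply: filterS => p Hp _ _ _ _ _ _; exact: Hp.
  by apply: aeW => p h1 h2 h3 h4 h5 h6; exfalso; apply: nh.
pose P p := [/\ Phom p, Phom (p.2, p.1), Psym p & [/\ Pge0 p, Pmono p, Pcont p,
  Psup p & Plip p]].
have aP : {ae lam2, forall p, P p}.
  have ahom' := ae_swap ahom.
  apply: filterS (filterI ahom (filterI ahom' (filterI asym (filterI age0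
    (filterI amono (filterI acont (filterI asup alip))))))).
  by move=> p [? [? [? [? [? [? []]]]]]].
(* A point all of whose displacements, but those in the null set A, are
   regular. *)
have [x0 [A [mA A0 PA]]] : exists x0, {ae lam, forall z, P (x0, x0 - z)}.
  apply: (ae_exists lebesgue_rV_gt0).
  exact: (ae_slices (preserves_ae shear_preserves aP)).
(* The exceptional displacements, made symmetric so that cancelling the kernel
   there does not destroy its symmetry. *)
pose Z0 := A `|` (fun z : V => 0 - z) @^-1` A.
have mA' : measurable ((fun z : V => 0 - z) @^-1` A).
  rewrite -[X in measurable X]setTI.
  by apply: (reflect_preserves 0).1.
have mZ0 : measurable Z0 by exact: measurableU.
have lZ0 : lam Z0 = 0%E.
  apply: null_set_setU => //.
  by apply: (etrans ((reflect_preserves 0).2 A mA)).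
have Z0N z : ~ Z0 z -> ~ Z0 (- z).
  by move=> nz [h|h]; apply: nz; [right; rewrite /= sub0r|
    left; move: h; rewrite /= sub0r opprK].
have PZ z : ~ Z0 z -> P (x0, x0 - z).
  by move=> nz; apply: contrapT => nP; apply: nz; left; exact: PA.
pose J a b z := rho a b x0 (x0 - z) * \1_(~` Z0) z.
have JE a b z : ~ Z0 z -> J a b z = rho a b x0 (x0 - z).
  by move=> nz; rewrite /J indicE mem_set// mulr1.
have J0 a b z : Z0 z -> J a b z = 0.
  by move=> hz; rewrite /J indicE memNset ?mulr0//; apply.
have disp z : x0 - (x0 - z) = z by rewrite opprB addrC subrK.
have contJ z : continuous (fun ab : R * R => J ab.1 ab.2 z).
  have [hz|nz] := pselect (Z0 z).
    by rewrite (_ : (fun _ => _) = cst 0); [exact: cst_continuous|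
      apply/funext => ab; rewrite J0].
  rewrite (_ : (fun _ => _) = (fun ab => rho ab.1 ab.2 x0 (x0 - z))); last first.
    by apply/funext => ab; rewrite JE.
  by have [_ _ _ [_ _ + _ _]] := PZ _ nz.
have Jge0 a b z : 0 <= J a b z.
  have [hz|nz] := pselect (Z0 z); first by rewrite J0.
  have [_ _ _ [h _ _ _ _]] := PZ _ nz.
  apply: (real_ge0_of_rat (f := fun a b => J a b z)) => //= s t.
  by rewrite JE//; exact: (h (s, t)).
have ratJ z (s t : rat) : ~ Z0 z -> J (ratr s) (ratr t) z =
    rho0 (ratr s) (ratr t) (enorm z).
  move=> nz; rewrite JE//; have [h _ _ _] := PZ _ nz.
  by have := h (s, t); rewrite /= disp.
(* Both kernels are given by rho0 at rational arguments. *)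
exists kap, J; split; last first.
  have aZ : {ae lam, forall z, ~ Z0 z}.
    by exists Z0; split => // z /=; apply: contrapT.
  apply: filterS (filterI aP (ae_displacement aZ)) => p [Pp nz] a b.
  have [h _ _ [_ _ cp _ _]] := Pp.
  have [s Hs] := rat_above a; have [t Ht] := rat_above b.
  have c1 : rho (ratr (s k)) (ratr (t k)) p.1 p.2 @[k --> \oo] --> rho a b p.1 p.2.
    exact: (cvg_along_pair cp (rat_above_cvg Hs) (rat_above_cvg Ht)).
  have c2 : J (ratr (s k)) (ratr (t k)) (p.1 - p.2) @[k --> \oo] -->
      J a b (p.1 - p.2).
    exact: (cvg_along_pair (contJ _) (rat_above_cvg Hs) (rat_above_cvg Ht)).
  rewrite -(cvg_lim (@Rhausdorff R) c1) -(cvg_lim (@Rhausdorff R) c2).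
  have -> : (fun k => rho (ratr (s k)) (ratr (t k)) p.1 p.2) =
            (fun k => J (ratr (s k)) (ratr (t k)) (p.1 - p.2)).
    by apply/funext => k; rewrite ratJ//; exact: (h (s k, t k)).
  by [].
split => //.
- apply: measurable_funM.
    have mr := jump_kernel_measurable hrho.
    have mp : measurable_fun setT (fun p : (R * R) * V => (p.1, (x0, x0 - p.2))).
      apply: measurable_fun_pair; first exact: measurable_fst.
      apply: measurable_fun_pair; first exact: measurable_cst.
      by apply: measurable_subrV; [exact: measurable_cst|exact: measurable_snd].
    exact: (measurableT_comp mr mp).
  have mI : measurable_fun setT (\1_(~` Z0) : V -> R).
    by apply: measurable_indic; exact: measurableC.
  exact: (measurableT_comp mI measurable_snd).
- move=> a b z; have [hz|nz] := pselect (Z0 z).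
    rewrite !J0//; case: hz => h; [right|left].
      by rewrite /= sub0r opprK.
    by move: h; rewrite /= sub0r.
  have nz' := Z0N _ nz.
  have [s Hs] := rat_above a; have [t Ht] := rat_above b.
  have c1 : J (ratr (s k)) (ratr (t k)) z @[k --> \oo] --> J a b z.
    exact: (cvg_along_pair (contJ _) (rat_above_cvg Hs) (rat_above_cvg Ht)).
  have c2 : J (ratr (t k)) (ratr (s k)) (- z) @[k --> \oo] --> J b a (- z).
    exact: (cvg_along_pair (contJ _) (rat_above_cvg Ht) (rat_above_cvg Hs)).
  rewrite -(cvg_lim (@Rhausdorff R) c1) -(cvg_lim (@Rhausdorff R) c2).
  have -> // : (fun k => J (ratr (s k)) (ratr (t k)) z) =
               (fun k => J (ratr (t k)) (ratr (s k)) (- z)).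
  apply/funext => k; rewrite (ratJ (- z))// enormN JE//.
  have [_ h' hs _] := PZ _ nz.
  have /= -> := hs (s k, t k); have /= -> := h' (t k, s k).
  by congr rho0; rewrite -(enormN z); congr enorm; rewrite addrAC subrr sub0r.
- move=> a b c d z bd dc ca.
  have [hz|nz] := pselect (Z0 z); first by rewrite !J0// !mulr0.
  have [_ _ _ [_ h _ _ _]] := PZ _ nz.
  apply: (real_mono_of_rat (f := fun a b => J a b z)) => //= a' b' c' d' h1 h2 h3.
  by rewrite !JE//; exact: (h ((a', b'), (c', d'))).
- move=> a b z aM bM.
  have [hz|nz] := pselect (Z0 z); first by rewrite !J0.
  have [_ _ _ [_ _ _ h _]] := PZ _ nz.
  rewrite JE// -lee_fin; move: h; rewrite /Psup /= disp; apply: le_trans.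
  apply: ereal_sup_ubound; exists a.
    by rewrite /= in_itv/= -ler_norml (le_trans aM)// lerDl.
  by exists b => //; rewrite /= in_itv/= -ler_norml (le_trans bM)// lerDl.
- move=> e e0.
  have [n ne] : exists n, eps n <= e / 2.
    exists (Num.truncn ((e / 2)^-1)).
    rewrite -[leRHS]invrK lef_pV2 ?posrE ?invr_gt0 ?divr_gt0//.
    by rewrite (le_trans (ltW (truncnS_gt _)))// ler_nat.
  exists `|C n| => // a b c d z aM bM cM dM eab ecd.
  have [hz|nz] := pselect (Z0 z).
    by rewrite !J0// subrr normr0 mulr_ge0// mulr_ge0// addr_ge0.
  have [_ _ _ [_ _ _ _ h]] := PZ _ nz.
  apply: (@le_trans _ _ (C n * (`|a - c| + `|b - d|) * kap z)); last first.
    by rewrite ler_wpM2r// ler_wpM2r ?addr_ge0// ler_norm.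
  apply: (real_lipschitz_of_rat (M := M) (f := fun a b => J a b z) _ e0) eab ecd => //=.
  move=> a' b' c' d' ha hb hc hd hab hcd.
  rewrite !JE//; have := h (n, ((a', b'), (c', d'))); rewrite /= disp => h'.
  exact: (h' ha hb hc hd (le_trans ne hab) (le_trans ne hcd)).
Qed.

End jump_profile.

(** * One explicit Euler step with an integrable kernel *)

Section pair_integrals.
Context {R : realType} {N : nat}.
Local Notation V := 'rV[R]_N.
Local Notation lam := (@lebesgue_rV R N).
Local Notation lam2 := (lam \x lam)%E.

Lemma measurable_fst2 : measurable_fun setT (fun p : V * V => p.1).
Proof. exact: measurable_fst. Qed.

Lemma measurable_snd2 : measurable_fun setT (fun p : V * V => p.2).
Proof. exact: measurable_snd. Qed.

Lemma measurable_disp : measurable_fun setT (fun p : V * V => p.1 - p.2).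
Proof. by apply: measurable_subrV; [exact: measurable_fst|exact: measurable_snd]. Qed.

Lemma measurable_on_fst (g : V -> R) : measurable_fun setT g ->
  measurable_fun setT (fun p : V * V => g p.1).
Proof. by move=> mg; exact: (measurableT_comp mg measurable_fst2). Qed.

Lemma measurable_on_snd (g : V -> R) : measurable_fun setT g ->
  measurable_fun setT (fun p : V * V => g p.2).
Proof. by move=> mg; exact: (measurableT_comp mg measurable_snd2). Qed.

Lemma measurable_on_disp (w : V -> R) : measurable_fun setT w ->
  measurable_fun setT (fun p : V * V => w (p.1 - p.2)).
Proof. by move=> mw; exact: (measurableT_comp mw measurable_disp). Qed.

Lemma measurable_kernel_along (k : R -> R -> V -> R) d (T : measurableType d)
    (a b : T -> R) (z : T -> V) :
  measurable_fun setT (fun p : (R * R) * V => k p.1.1 p.1.2 p.2) ->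
  measurable_fun setT a -> measurable_fun setT b -> measurable_fun setT z ->
  measurable_fun setT (fun t => k (a t) (b t) (z t)).
Proof.
move=> mk ma mb mz.
have mt : measurable_fun setT (fun t => ((a t, b t), z t)).
  by apply: measurable_fun_pair => //; exact: measurable_fun_pair.
exact: (measurableT_comp mk mt).
Qed.
Lemma summable_reflect (w : V -> R) c : summable_fun lam w ->
  summable_fun lam (fun x => w (c - x)).
Proof. by move=> sw; exact: (preserves_summable (reflect_preserves c) sw). Qed.

Lemma Rint_reflect (w : V -> R) c : summable_fun lam w ->
  \int[lam]_x w (c - x) = \int[lam]_x w x.
Proof. by move=> sw; exact: (preserves_Rint (reflect_preserves c) sw). Qed.

Lemma pair_swap_summable (f : V * V -> R) : summable_fun lam2 f ->
  summable_fun lam2 (fun p => f (p.2, p.1)).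
Proof. exact: (preserves_summable swap_preserves). Qed.

Lemma pair_swap_Rint (f : V * V -> R) : summable_fun lam2 f ->
  \int[lam2]_p f (p.2, p.1) = \int[lam2]_p f p.
Proof. exact: (preserves_Rint swap_preserves). Qed.

(** Integration along the displacement first: the form in which the modulus of
    translation of a function meets the singular weight. *)
Lemma pair_integral_le (f : V * V -> R) (c : V -> R) :
  measurable_fun setT f -> (forall p, 0 <= f p) -> summable_fun lam c ->
  (forall z, 0 <= c z) ->
  (forall z, summable_fun lam (fun x => f (x, x - z))) ->
  (forall z, \int[lam]_x f (x, x - z) <= c z) ->
  summable_fun lam2 f /\ \int[lam2]_p f p <= \int[lam]_z c z.
Proof.
move=> mf f0 sc c0 sf fc.
have mEf : measurable_fun setT (EFin \o f) by exact/measurable_EFinP.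
have mh : measurable_fun setT (fun p : V * V => (f (p.1, p.1 - p.2))%:E).
  exact: (measurableT_comp mEf shear_preserves.1).
have leI : (\int[lam2]_p (f p)%:E <= \int[lam]_z (c z)%:E)%E.
  have f0' p : (0 <= (f p)%:E)%E by rewrite lee_fin.
  rewrite -(preserves_ge0_integral shear_preserves mEf f0').
  rewrite (fubini_tonelli2 (fun p : V * V => (f (p.1, p.1 - p.2))%:E) mh (fun p => f0' _)).
  apply: ge0_le_integral => //.
  - by move=> z _; apply: integral_ge0 => x _; rewrite lee_fin.
  - exact: (measurable_fun_fubini_tonelli_G (m1 := lam)
      (fun p : V * V => (f (p.1, p.1 - p.2))%:E) mh (fun p => f0 _)).
  - by case/integrableP: sc.
  - by move=> z _; rewrite /fubini_G /= -EFin_Rint// lee_fin.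
have sF : summable_fun lam2 f.
  apply: summable_le_lty => //.
  have -> : (\int[lam2]_p `|f p|%:E = \int[lam2]_p (f p)%:E)%E.
    by apply: eq_integral => p _; rewrite ger0_norm.
  by apply: (le_lt_trans leI); rewrite -(EFin_Rint sc); exact: ltry.
by split => //; rewrite -lee_fin (EFin_Rint sF) (EFin_Rint sc).
Qed.

Lemma summable_conv (g w : V -> R) : summable_fun lam g -> summable_fun lam w ->
  (forall x, 0 <= g x) -> (forall z, 0 <= w z) ->
  summable_fun lam2 (fun p => g p.1 * w (p.1 - p.2)) /\
  \int[lam2]_p (g p.1 * w (p.1 - p.2)) <= \int[lam]_z w z * \int[lam]_x g x.
Proof.
move=> sg sw g0 w0.
have E z (x : V) : g x * w (x - (x - z)) = w z * g x.
  by rewrite opprB addrC subrK mulrC.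
rewrite mulrC -(RintZ _ sw).
apply: pair_integral_le => //.
- apply: measurable_funM; first exact: (measurable_on_fst (summable_measurable sg)).
  exact: (measurable_on_disp (summable_measurable sw)).
- by move=> p; rewrite mulr_ge0.
- exact: summableZ.
- by move=> z; rewrite mulr_ge0// Rint_ge0.
- by move=> z; under eq_fun do rewrite /= E; exact: summableZ.
- by move=> z; under eq_Rint do rewrite /= E; rewrite RintZ// mulrC.
Qed.

Lemma summable_conv_snd (g w : V -> R) : summable_fun lam g -> summable_fun lam w ->
  (forall x, 0 <= g x) -> (forall z, 0 <= w z) ->
  summable_fun lam2 (fun p => g p.2 * w (p.1 - p.2)) /\
  \int[lam2]_p (g p.2 * w (p.1 - p.2)) <= \int[lam]_z w z * \int[lam]_x g x.
Proof.
move=> sg sw g0 w0.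
have sw' : summable_fun lam (fun z => w (- z)).
  by have := summable_reflect 0 sw; under eq_fun do rewrite sub0r.
have <- : \int[lam]_z w (- z) = \int[lam]_z w z.
  by rewrite -(Rint_reflect 0 sw); apply: eq_Rint => z; rewrite sub0r.
have [s le] := summable_conv sg sw' g0 (fun z => w0 (- z)).
have E : (fun p : V * V => g p.2 * w (p.1 - p.2)) =
    (fun p => (fun p : V * V => g p.1 * w (- (p.1 - p.2))) (p.2, p.1)).
  by apply/funext => p /=; rewrite opprB.
by rewrite E; split; [exact: (pair_swap_summable s)|rewrite (pair_swap_Rint s)].
Qed.

End pair_integrals.

Section euler_step.
Context {R : realType} {N : nat}.
Local Notation V := 'rV[R]_N.
Local Notation lam := (@lebesgue_rV R N).
Local Notation lam2 := (lam \x lam)%E.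
Variables (M : R) (w : V -> R) (k : R -> R -> V -> R).

(** Kernels for which the nonlocal operator is bounded and Lipschitz on L^1;
    the last clause says that (a - b) k a b z is nondecreasing in a, with
    slope at most w z. *)
Record step_kernel : Prop := {
  step_measurable :
    measurable_fun setT (fun p : (R * R) * V => k p.1.1 p.1.2 p.2);
  step_summable : summable_fun lam w;
  step_ge0 : forall a b z, 0 <= k a b z;
  step_sym : forall a b z, k a b z = k b a (- z);
  step_le : forall a b z, `|a| <= M -> `|b| <= M -> k a b z <= w z;
  step_slope : forall a a' b z, `|a| <= M -> `|a'| <= M -> `|b| <= M -> a' <= a ->
    (a' - b) * k a' b z <= (a - b) * k a b z <=
    (a' - b) * k a' b z + (a - a') * w z
}.

Definition state (u : V -> R) := summable_fun lam u /\ forall x, `|u x| <= M.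

Definition nonlocal (u : V -> R) (x : V) : R :=
  \int[lam]_y ((u x - u y) * k (u x) (u y) (x - y)).

Definition euler (h : R) (u : V -> R) (x : V) : R := u x - h * nonlocal u x.

(** The exchange between x and y of the quantity j(u). *)
Definition exchange (j : R -> R) (u : V -> R) (p : V * V) : R :=
  (j (u p.1) - j (u p.2)) * k (u p.1) (u p.2) (p.1 - p.2).

Hypothesis hk : step_kernel.
Hypothesis M0 : 0 <= M.

Lemma step_majorant_ge0 z : 0 <= w z.
Proof.
by apply: le_trans (step_le hk (a := 0) (b := 0) z _ _);
  [exact: step_ge0|rewrite normr0..].
Qed.

Lemma measurable_kernel_pair u : measurable_fun setT u ->
  measurable_fun setT (fun p : V * V => k (u p.1) (u p.2) (p.1 - p.2)).
Proof.
move=> mu; apply: (measurable_kernel_along (step_measurable hk)); last exact: measurable_disp.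
  exact: measurable_on_fst.
exact: measurable_on_snd.
Qed.

Lemma measurable_exchange j u : measurable_fun setT j -> measurable_fun setT u ->
  measurable_fun setT (exchange j u).
Proof.
move=> mj mu; apply: measurable_funM; last exact: measurable_kernel_pair.
have mju : measurable_fun setT (j \o u) by exact: measurableT_comp.
by apply: measurable_funB; [exact: (measurable_on_fst mju)|exact: (measurable_on_snd mju)].
Qed.

Lemma exchange_antisym j u x y : exchange j u (y, x) = - exchange j u (x, y).
Proof.
by rewrite /exchange /= (step_sym hk (u y)) opprB -mulNr opprB.
Qed.

Section exchange_integrals.
Variables (u : V -> R) (su : state u) (j : R -> R) (C : R).
Hypothesis mj : measurable_fun setT j.
Hypothesis C0 : 0 <= C.
Hypothesis jC : forall r, `|r| <= M -> `|j r| <= C * `|r|.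

Let mu : measurable_fun setT u := summable_measurable su.1.

Lemma exchange_le p : `|exchange j u p| <=
  C * (`|u p.1| * w (p.1 - p.2) + `|u p.2| * w (p.1 - p.2)).
Proof.
rewrite normrM -mulrDl mulrA [`|k _ _ _|]ger0_norm; last exact: step_ge0.
have h : `|j (u p.1) - j (u p.2)| <= C * (`|u p.1| + `|u p.2|).
  by rewrite (le_trans (ler_normB _ _))// mulrDr lerD// jC//; exact: su.2.
apply: ler_pM => //; first exact: step_ge0.
by apply: step_le => //; exact: su.2.
Qed.

Lemma exchange_summable : summable_fun lam2 (exchange j u).
Proof.
have w0 := step_majorant_ge0.
have snu := summable_norm su.1.
apply: (summable_le (g := fun p : V * V =>
  C * (`|u p.1| * w (p.1 - p.2) + `|u p.2| * w (p.1 - p.2)))).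
- exact: measurable_exchange.
- exact: exchange_le.
- apply: summableZ; apply: summableD.
    by have [] := summable_conv snu (step_summable hk) (fun=> normr_ge0 _) w0.
  by have [] := summable_conv_snd snu (step_summable hk) (fun=> normr_ge0 _) w0.
Qed.

(** Integration by parts: the exchange changes sign with the order of its two
    points, so that only differences of the test function remain. *)
Lemma exchange_test (phi : V -> R) (B : R) : measurable_fun setT phi ->
  (forall x, `|phi x| <= B) ->
  [/\ summable_fun lam (fun x => phi x * \int[lam]_y exchange j u (x, y)),
      summable_fun lam2 (fun p => exchange j u p * (phi p.1 - phi p.2)) &
      \int[lam]_x (phi x * \int[lam]_y exchange j u (x, y)) =
      2^-1 * \int[lam2]_p (exchange j u p * (phi p.1 - phi p.2))].
Proof.
move=> mphi pB.
have se := exchange_summable.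
have me := summable_measurable se.
have sp1 : summable_fun lam2 (fun p => phi p.1 * exchange j u p).
  apply: (summable_le (g := fun p : V * V => B * `|exchange j u p|)).
  - by apply: measurable_funM => //; exact: measurable_on_fst.
  - by move=> p; rewrite normrM ler_wpM2r.
  - by apply: summableZ; exact: summable_norm.
have [s1 e1] := summable_Rint_param sp1.
have E1 x : \int[lam]_y (phi x * exchange j u (x, y)) =
    phi x * \int[lam]_y exchange j u (x, y).
  apply: RintZ; have w0 := step_majorant_ge0.
  apply: (summable_le (g := fun y : V => (2 * (C * M)) * w (x - y))).
  - exact: (measurable_slice x me).
  - move=> y; apply: (le_trans (exchange_le (x, y))) => /=.
    have -> : C * (`|u x| * w (x - y) + `|u y| * w (x - y)) =
        C * (`|u x| + `|u y|) * w (x - y) by ring.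
    have -> : 2 * (C * M) = C * (M + M) by ring.
    by apply: ler_wpM2r => //; apply: ler_wpM2l => //; apply: lerD; exact: su.2.
  - by apply: summableZ; apply: summable_reflect; exact: (step_summable hk).
have s2 : summable_fun lam2 (fun p => exchange j u p * (phi p.1 - phi p.2)).
  apply: (summable_le (g := fun p : V * V => (2 * B) * `|exchange j u p|)).
  - apply: measurable_funM => //; apply: measurable_funB.
      exact: measurable_on_fst.
    exact: measurable_on_snd.
  - move=> p; rewrite normrM mulrC; apply: ler_wpM2r => //.
    by rewrite (le_trans (ler_normB _ _))// mulr_natl mulr2n lerD.
  - by apply: summableZ; exact: summable_norm.
have E2 : \int[lam2]_p (exchange j u p * (phi p.1 - phi p.2)) =
    2 * \int[lam2]_p (phi p.1 * exchange j u p).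
  have sp2 := pair_swap_summable sp1.
  rewrite mulr_natl mulr2n -{2}(pair_swap_Rint sp1) -RintD//.
  apply: eq_Rint => -[x y] /=; rewrite exchange_antisym; ring.
split => //.
- by move: s1; under eq_fun do rewrite /= E1.
- rewrite E2 mulrA mulVf ?mul1r ?pnatr_eq0// e1.
  by apply: eq_Rint => x; rewrite /= E1.
Qed.

End exchange_integrals.

Lemma measurable_idR : measurable_fun [set: R] (id : R -> R).
Proof. exact: measurable_id. Qed.

Let idC (r : R) : `|r| <= M -> `|r| <= 1 * `|r|.
Proof. by rewrite mul1r. Qed.

Section one_state.
Variables (u : V -> R) (su : state u).
Let mu : measurable_fun setT u := summable_measurable su.1.

Lemma summable_kernel_slice x :
  summable_fun lam (fun y => k (u x) (u y) (x - y)).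
Proof.
apply: (summable_le (g := fun y : V => w (x - y))).
- exact: (measurable_slice x (measurable_kernel_pair mu)).
- move=> y; rewrite ger0_norm; last exact: step_ge0.
  by apply: (step_le hk); exact: su.2.
- exact: summable_reflect (step_summable hk).
Qed.

Lemma kernel_slice_le x :
  \int[lam]_y k (u x) (u y) (x - y) <= \int[lam]_z w z.
Proof.
rewrite -(Rint_reflect x (step_summable hk)); apply: Rint_le.
- exact: summable_kernel_slice.
- exact: summable_reflect (step_summable hk).
- by move=> y; apply: (step_le hk); exact: su.2.
Qed.

Lemma summable_kernel_slice_bounded (g : V -> R) (B : R) x :
  measurable_fun setT g -> (forall y, `|g y| <= B) ->
  summable_fun lam (fun y => g y * k (u x) (u y) (x - y)).
Proof.
move=> mg gB; have sk := summable_kernel_slice x.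
apply: (summable_le (g := fun y : V => B * `|k (u x) (u y) (x - y)|)).
- by apply: measurable_funM => //; exact: summable_measurable sk.
- by move=> y; rewrite normrM ler_wpM2r.
- by apply: summableZ; exact: summable_norm.
Qed.

Lemma exchange_slice_summable x : summable_fun lam (fun y => exchange id u (x, y)).
Proof.
apply: (summable_kernel_slice_bounded (g := fun y : V => u x - u y) (B := 2 * M)).
  by apply: measurable_funB.
move=> y; rewrite (le_trans (ler_normB _ _))// mulr_natl mulr2n.
by rewrite lerD//; exact: su.2.
Qed.

Lemma nonlocal_summable : summable_fun lam (nonlocal u).
Proof.
by have [] := summable_Rint_param (exchange_summable su measurable_idR idC).
Qed.

Lemma euler_summable h : summable_fun lam (euler h u).
Proof.
by apply: summableB; [exact: su.1|apply: summableZ; exact: nonlocal_summable].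
Qed.

Lemma nonlocal_test (phi : V -> R) (B : R) : measurable_fun setT phi ->
  (forall x, `|phi x| <= B) ->
  \int[lam]_x (phi x * nonlocal u x) =
  2^-1 * \int[lam2]_p (exchange id u p * (phi p.1 - phi p.2)).
Proof.
by move=> mphi pB; have [_ _] := exchange_test su measurable_idR ler01 idC mphi pB.
Qed.

Lemma nonlocal_mass : \int[lam]_x nonlocal u x = 0.
Proof.
have := @nonlocal_test (fun=> 1) 1 (measurable_cst _) (fun _ => _).
rewrite normr1 => /(_ (fun=> lexx _)).
under eq_Rint do rewrite mul1r; move=> ->.
by under eq_Rint do rewrite subrr mulr0; rewrite Rint0 mulr0.
Qed.

Lemma euler_mass h : \int[lam]_x euler h u x = \int[lam]_x u x.
Proof.
have sn := nonlocal_summable.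
rewrite RintB; [|exact: su.1|exact: summableZ].
by rewrite RintZ// nonlocal_mass mulr0 subr0.
Qed.

Variable h : R.
Hypothesis h0 : 0 <= h.
Hypothesis hw : h * \int[lam]_z w z <= 1.

Lemma kernel_slice_cfl x : 0 <= h * \int[lam]_y k (u x) (u y) (x - y) <= 1.
Proof.
apply/andP; split.
  by rewrite mulr_ge0//; apply: Rint_ge0 => y; exact: step_ge0.
by apply: le_trans hw; apply: ler_wpM2l => //; exact: kernel_slice_le.
Qed.

(** Under the step restriction an Euler step averages the values of u, so that
    it obeys every convex inequality; [s] is a choice of subgradients of [j]. *)
Lemma euler_jensen (j s : R -> R) (B : R) x : measurable_fun setT j ->
  (forall r, `|r| <= M -> `|j r| <= B) ->
  (forall a b, `|b| <= M -> j a + s a * (b - a) <= j b) ->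
  j (euler h u x) <= j (u x) - h * \int[lam]_y exchange j u (x, y).
Proof.
move=> mj jB js; set a := euler h u x.
have mju : measurable_fun setT (j \o u) by exact: measurableT_comp.
pose kx y := k (u x) (u y) (x - y).
have sk : summable_fun lam kx := summable_kernel_slice x.
have sj : summable_fun lam (fun y => j (u y) * kx y).
  by apply: (summable_kernel_slice_bounded (B := B)) => // y; apply: jB; exact: su.2.
have sU : summable_fun lam (fun y => u y * kx y).
  by apply: (summable_kernel_slice_bounded (B := M)) => //; exact: su.2.
have I1 : \int[lam]_y exchange j u (x, y) =
    j (u x) * \int[lam]_y kx y - \int[lam]_y (j (u y) * kx y).
  rewrite -RintZ// -RintB//; last exact: summableZ.
  by apply: eq_Rint => y; rewrite /exchange /= mulrBl.
have I2 : nonlocal u x = u x * \int[lam]_y kx y - \int[lam]_y (u y * kx y).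
  rewrite -RintZ// -RintB//; last exact: summableZ.
  by apply: eq_Rint => y; rewrite mulrBl.
have I3 : (j a - s a * a) * \int[lam]_y kx y + s a * \int[lam]_y (u y * kx y) <=
    \int[lam]_y (j (u y) * kx y).
  rewrite -RintZ// -RintZ// -RintD; [|exact: summableZ..].
  apply: Rint_le => //; first by apply: summableD; exact: summableZ.
  move=> y; have := js a (u y) (su.2 y).
  have := step_ge0 hk (u x) (u y) (x - y); rewrite -/(kx y) => k0 /(ler_wpM2r k0).
  by apply: le_trans; rewrite le_eqVlt; apply/orP; left; apply/eqP; ring.
have /andP[c0 c1] := kernel_slice_cfl x.
set K := \int[lam]_y kx y in I1 I2 I3.
have {}c0 : 0 <= h * K by [].
have {}c1 : h * K <= 1 by [].
set S := \int[lam]_y (u y * kx y) in I2 I3.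
have jx := js a (u x) (su.2 x).
have aE : a = u x - h * (u x * K - S) by rewrite /a /euler I2.
rewrite I1; set Q := \int[lam]_y (j (u y) * kx y) in I3 *.
have h3 := ler_wpM2l h0 I3.
have c1' : 0 <= 1 - h * K by lra.
have h4 := ler_wpM2l c1' jx.
have e : s a * a = s a * (u x - h * (u x * K - S)) by rewrite -aE.
nra.
Qed.

Lemma euler_bounded x : `|euler h u x| <= M.
Proof.
pose kx y := k (u x) (u y) (x - y).
have sk : summable_fun lam kx := summable_kernel_slice x.
have /andP[c0 c1] := kernel_slice_cfl x; rewrite -/(kx _) in c0 c1.
have k0 y : 0 <= kx y by exact: step_ge0.
have se : summable_fun lam (fun y => (u x - u y) * kx y) := exchange_slice_summable x.
have uM y : - M <= u y <= M by rewrite -ler_norml; exact: su.2.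
have up : \int[lam]_y ((u x - M) * kx y) <= nonlocal u x.
  apply: Rint_le => //; first exact: summableZ.
  move=> y; have /andP[_ uy] := uM y.
  have h1 : u x - M <= u x - u y by lra.
  exact: (ler_wpM2r (k0 y) h1).
have lo : nonlocal u x <= \int[lam]_y ((u x + M) * kx y).
  apply: Rint_le => //; first exact: summableZ.
  move=> y; have /andP[uy _] := uM y.
  have h1 : u x - u y <= u x + M by lra.
  exact: (ler_wpM2r (k0 y) h1).
rewrite !RintZ// in up lo.
have /andP[x1 x2] := uM x.
have := ler_wpM2l h0 up; have := ler_wpM2l h0 lo.
rewrite ler_norml /euler.
set K := \int[lam]_y kx y in c0 c1 *.
move=> lo' up'.
have c1' : 0 <= 1 - h * K by lra.
have x1' : 0 <= u x + M by lra.
have x2' : 0 <= M - u x by lra.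
have := mulr_ge0 c1' x1'; have := mulr_ge0 c1' x2' => g1 g2.
by apply/andP; split; lra.
Qed.

Lemma euler_state : state (euler h u).
Proof. by split; [exact: euler_summable|exact: euler_bounded]. Qed.

End one_state.

Section two_states.
Variable h : R.
Hypothesis h0 : 0 <= h.
Hypothesis hw : h * \int[lam]_z w z <= 1.

(** By monotonicity of the flux in each of its arguments, raising u away from x
    can only raise the result at x, while raising u at x raises the outflow by
    at most the total mass of w, which the step restriction compensates. *)
Lemma euler_mono u v : state u -> state v -> (forall x, u x <= v x) ->
  forall x, euler h u x <= euler h v x.
Proof.
move=> su sv uv x.
have mu := summable_measurable su.1; have mv := summable_measurable sv.1.
have sw : summable_fun lam (fun y => w (x - y)).
  exact: summable_reflect (step_summable hk).
have le : nonlocal v x - nonlocal u x <= (v x - u x) * \int[lam]_z w z.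
  have s1 := exchange_slice_summable sv x; have s2 := exchange_slice_summable su x.
  rewrite -(Rint_reflect x (step_summable hk)) -RintZ// -RintB//.
  apply: Rint_le; [exact: summableB|exact: summableZ|].
  move=> y.
  have /andP[_ hx] := step_slope hk (x - y) (sv.2 x) (su.2 x) (su.2 y) (uv x).
  have /andP[hy _] := step_slope hk (- (x - y)) (sv.2 y) (su.2 y) (sv.2 x) (uv y).
  rewrite -(step_sym hk (v x) (v y)) -(step_sym hk (v x) (u y)) in hy.
  by rewrite /exchange /=; lra.
have := ler_wpM2l h0 le.
have uvx : 0 <= v x - u x by rewrite subr_ge0.
have := ler_wpM2l uvx hw; rewrite mulr1 /euler.
set W := \int[lam]_z w z => h1 h2.
have -> : v x - h * nonlocal v x = u x - h * nonlocal u x +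
  ((v x - u x) - h * (nonlocal v x - nonlocal u x)) by ring.
rewrite lerDl subr_ge0; apply: le_trans h2 _.
by apply: le_trans h1; rewrite mulrCA.
Qed.

Lemma state_max u v : state u -> state v -> state (fun x => Num.max (u x) (v x)).
Proof.
move=> [su ub] [sv vb].
have mb x : `|Num.max (u x) (v x)| <= M.
  by rewrite /Num.max; case: ifP => _; [exact: vb|exact: ub].
split => //; apply: (summable_le (g := fun x : V => `|u x| + `|v x|)).
- by apply: measurable_maxr; [exact: (summable_measurable su)|exact: (summable_measurable sv)].
- by move=> x; rewrite /Num.max; case: ifP => _; rewrite ?lerDl ?lerDr.
- by apply: summableD; exact: summable_norm.
Qed.

(** Order preservation and conservation of mass give the contraction: both
    images lie below the image of the maximum. *)
Lemma euler_contraction u v : state u -> state v ->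
  \int[lam]_x `|euler h u x - euler h v x| <= \int[lam]_x `|u x - v x|.
Proof.
move=> su sv; have sm := state_max su sv.
set m := fun x => Num.max (u x) (v x) in sm.
have um x : u x <= m x by rewrite le_max lexx.
have vm x : v x <= m x by rewrite le_max lexx orbT.
have Tu := euler_mono su sm um; have Tv := euler_mono sv sm vm.
have su' := euler_summable su h; have sv' := euler_summable sv h.
have sm' := euler_summable sm h.
have -> : \int[lam]_x `|u x - v x| = \int[lam]_x (2 * m x - u x - v x).
  apply: eq_Rint => x; rewrite /m; case: (leP (u x) (v x)) => uv.
    by rewrite ler0_norm; lra.
  by rewrite gtr0_norm; lra.
apply: (@le_trans _ _ (\int[lam]_x (2 * euler h m x - euler h u x - euler h v x))).
  apply: Rint_le.
  - by apply/summable_norm/summableB.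
  - by apply: summableB => //; apply: summableB => //; exact: summableZ.
  - by move=> x; have := Tu x; have := Tv x; rewrite ler_norml => ? ?;
      apply/andP; split; lra.
have s1 := su.1; have s2 := sv.1; have s3 := sm.1.
rewrite !(RintB, RintZ, euler_mass)//; do ?exact: summableZ.
- by apply: summableB => //; exact: summableZ.
- by apply: summableB => //; exact: summableZ.
Qed.

(** The kernel only depends on the displacement, so a step commutes with
    translations; with the contraction this gives the decrease of the modulus
    of translation. *)
Lemma euler_translate u z x : measurable_fun setT u ->
  euler h (fun x => u (x - z)) x = euler h u (x - z).
Proof.
move=> mu; rewrite /euler /nonlocal; congr (_ - _ * _).
rewrite /Rintegral; congr fine.
pose F (y : V) := ((u (x - z) - u y) * k (u (x - z)) (u y) (x - z - y))%:E.
have mF : measurable_fun setT F.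
  apply/measurable_EFinP.
  exact: (measurable_slice (x - z) (measurable_exchange measurable_idR mu)).
have E (f : V -> \bar R) : measurable_fun setT f -> (forall y, 0 <= f y)%E ->
    (\int[lam]_y f (y - z)%R = \int[lam]_y f y)%E.
  by move=> mf f0; exact: (preserves_ge0_integral (shift_preserves (- z)) mf f0).
transitivity (\int[lam]_y F (y - z)%R)%E.
  apply: eq_integral => y _; rewrite /F; congr (_ * k _ _ _)%:E.
  by rewrite opprB addrA subrK.
rewrite [LHS]integralE [RHS]integralE.
have Ep (y : V) : ((fun y : V => F (y - z)%R)^\+)%E y = (F^\+)%E (y - z) by rewrite !funeposE.
have En (y : V) : ((fun y : V => F (y - z)%R)^\-)%E y = (F^\-)%E (y - z) by rewrite !funenegE.
under eq_integral do rewrite Ep.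
under [X in (_ - X)%E = _]eq_integral do rewrite En.
by rewrite (E _ (measurable_funepos mF))// (E _ (measurable_funeneg mF)).
Qed.

Lemma state_translate u z : state u -> state (fun x => u (x - z)).
Proof. by move=> [su ub]; split => //; exact: summable_translate. Qed.

Lemma euler_modulus u z : state u -> modulus (euler h u) z <= modulus u z.
Proof.
move=> su; apply: le_trans (euler_contraction su (state_translate z su)).
rewrite le_eqVlt; apply/orP; left; apply/eqP; apply: eq_Rint => x.
by rewrite euler_translate//; exact: (summable_measurable su.1).
Qed.

End two_states.
End euler_step.

(** * Regularised kernels *)

Section soft_threshold.
Context {R : realType}.
Implicit Types e d : R.

(** [d * cutoff e d] is the soft threshold of [d] at level [e]. *)
Definition cutoff e d : R := Num.max (`|d| - e) 0 / Num.max `|d| e.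

Lemma cutoff_ge0 e d : 0 < e -> 0 <= cutoff e d.
Proof.
by move=> e0; rewrite /cutoff divr_ge0// le_max ?lexx ?orbT// normr_ge0.
Qed.

Lemma cutoff_small e d : `|d| <= e -> cutoff e d = 0.
Proof. by move=> de; rewrite /cutoff max_r ?mul0r// subr_le0. Qed.

Lemma cutoff_large e d : 0 < e -> e < `|d| -> cutoff e d = 1 - e / `|d|.
Proof.
move=> e0 ed; rewrite /cutoff max_l ?subr_ge0 ?(ltW ed)// max_l ?(ltW ed)//.
by rewrite mulrBl divff// gt_eqF//; lra.
Qed.

Lemma cutoffN e d : cutoff e (- d) = cutoff e d.
Proof. by rewrite /cutoff normrN. Qed.

Lemma cutoff_le1 e d : 0 < e -> cutoff e d <= 1.
Proof.
move=> e0; have [de|de] := leP `|d| e; first by rewrite cutoff_small.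
by rewrite cutoff_large// gerBl divr_ge0// ltW.
Qed.

Lemma cutoff_homo e d d' : 0 < e -> `|d'| <= `|d| -> cutoff e d' <= cutoff e d.
Proof.
move=> e0 dd; have [de'|de'] := leP `|d'| e.
  by rewrite cutoff_small// cutoff_ge0.
have de := lt_le_trans de' dd.
rewrite !cutoff_large// lerD2l lerN2 ler_wpM2l ?(ltW e0)//.
by rewrite lef_pV2// posrE; lra.
Qed.

Lemma soft_small e d : `|d| <= e -> d * cutoff e d = 0.
Proof. by move=> de; rewrite cutoff_small// mulr0. Qed.

Lemma soft_pos e d : 0 < e -> e < d -> d * cutoff e d = d - e.
Proof.
move=> e0 ed; rewrite cutoff_large ?ger0_norm//; try lra.
by rewrite mulrBr mulr1 mulrCA divff ?mulr1// gt_eqF//; lra.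
Qed.

Lemma soft_neg e d : 0 < e -> d < - e -> d * cutoff e d = d + e.
Proof.
move=> e0 ed; rewrite -[d]opprK cutoffN mulNr soft_pos//; last lra.
by rewrite opprB addrC opprK.
Qed.

Lemma soft_lipschitz e d d' : 0 < e -> d' <= d ->
  0 <= d * cutoff e d - d' * cutoff e d' <= d - d'.
Proof.
move=> e0 dd.
have S x : [\/ [/\ - e <= x, x <= e & x * cutoff e x = 0],
    e < x /\ x * cutoff e x = x - e | x < - e /\ x * cutoff e x = x + e].
  have [xe|xe] := leP x e; last by constructor 2; rewrite soft_pos.
  have [xe'|xe'] := leP (- e) x; last by constructor 3; rewrite soft_neg.
  by constructor 1; rewrite soft_small// ler_norml xe' xe.
by case: (S d) => -[? ?]; case: (S d') => -[? ?]; try move=> ?; try move=> ?;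
  apply/andP; split; lra.
Qed.

Lemma soft_defect e d : 0 < e -> `|d| * (1 - cutoff e d) <= Num.min e `|d|.
Proof.
move=> e0; have [de|de] := leP `|d| e.
  by rewrite cutoff_small// subr0 mulr1.
have d0 : `|d| != 0 by rewrite gt_eqF//; lra.
by rewrite cutoff_large// opprB addrC subrK mulrCA divff// mulr1.
Qed.

Lemma measurable_cutoff e : 0 < e -> measurable_fun [set: R] (cutoff e).
Proof.
move=> e0; have mn : measurable_fun [set: R] (fun d : R => `|d|).
  exact: normr_measurable.
apply: measurable_funM.
  by apply: measurable_maxr => //; apply: measurable_funB.
apply: continuous_measurable_fun => x; apply: cvgV.
  by rewrite gt_eqF// lt_max e0 orbT.
by apply: (@continuous_max _ _ (fun d : R => `|d|) (fun=> e) x);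
  [exact: norm_continuous|exact: cst_continuous].
Qed.

End soft_threshold.

Section regularised_kernel.
Context {R : realType} {N : nat}.
Local Notation V := 'rV[R]_N.
Local Notation lam := (@lebesgue_rV R N).
Local Notation lam2 := (lam \x lam)%E.
Local Notation q := (@jump_weight R N).
Variables (M : R) (kap : V -> R) (J : R -> R -> V -> R).
Hypothesis M0 : 0 <= M.
Hypothesis hJ : jump_profile M kap J.

Let mkap := profile_majorant_measurable hJ.
Let kap0 := profile_majorant_ge0 hJ.

Definition level (n : nat) : R := n.+1%:R^-1.

Lemma level_gt0 n : 0 < level n. Proof. by rewrite invr_gt0. Qed.

Lemma level_le1 n : level n <= 1. Proof. by rewrite invf_le1// ler1n. Qed.

Lemma level_homo n m : (n <= m)%N -> level m <= level n.
Proof. by move=> nm; rewrite lef_pV2 ?posrE// ler_nat. Qed.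

Lemma level_cvg0 : level n @[n --> \oo] --> (0 : R).
Proof. exact: cvg_harmonic. Qed.

Definition far (n : nat) (z : V) : R := ((level n < `|z|)%R : bool)%:R.

Lemma far_ge0 n z : 0 <= far n z. Proof. by rewrite /far; case: (_ < _). Qed.

Lemma far_le1 n z : far n z <= 1. Proof. by rewrite /far; case: (_ < _). Qed.

Lemma measurable_far n : measurable_fun [set: V] (far n).
Proof.
rewrite (_ : far n = \1_[set z : V | level n < `|z|]).
  apply: measurable_indic; rewrite -[X in measurable X]setTI.
  rewrite (_ : [set z | _] = (fun z : V => `|z|) @^-1` `]level n, +oo[%classic).
    exact: (measurable_norm_rV measurableT (measurable_itv _)).
  by apply/seteqP; split => z /=; rewrite in_itv/= andbT.
by apply/funext => z; rewrite indicE /far mem_setE.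
Qed.

(** The singularity at z = 0 is removed, and differences |a - b| below the
    level are ignored, which makes (a - b) k a b z Lipschitz. *)
Definition cut_kernel (n : nat) (a b : R) (z : V) : R :=
  J a b z * cutoff (level n) (a - b) * far n z.

Lemma cut_kernel_ge0 n a b z : 0 <= cut_kernel n a b z.
Proof.
apply: mulr_ge0; last exact: far_ge0.
apply: mulr_ge0; first exact: (profile_ge0 hJ).
by apply: cutoff_ge0; exact: level_gt0.
Qed.

Lemma cut_kernel_le_far n a b z : `|a| <= M -> `|b| <= M ->
  cut_kernel n a b z <= kap z * far n z.
Proof.
move=> aM bM; apply: ler_wpM2r; first exact: far_ge0.
apply: le_trans (profile_le hJ z aM bM).
apply: ler_piMr; first exact: (profile_ge0 hJ).
by apply: cutoff_le1; exact: level_gt0.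
Qed.

Lemma cut_kernel_le n a b z : `|a| <= M -> `|b| <= M ->
  cut_kernel n a b z <= kap z.
Proof.
move=> aM bM; apply: (le_trans (cut_kernel_le_far n z aM bM)).
by rewrite ler_piMr ?far_le1.
Qed.

Lemma summable_far n : summable_fun lam (fun z => kap z * far n z).
Proof.
have l0 := level_gt0 n; have l1 := level_le1 n.
apply: (summable_le (g := fun z : V => (level n)^-1 * (q z * kap z))).
- by apply: measurable_funM => //; exact: measurable_far.
- move=> z; rewrite ger0_norm; last by rewrite mulr_ge0 ?far_ge0.
  have -> : (level n)^-1 * (q z * kap z) = (q z / level n) * kap z by ring.
  rewrite (mulrC (kap z)); apply: ler_wpM2r => //.
  have q0 := jump_weight_ge0 z.
  rewrite /far; case: ltP => h /=; last by rewrite divr_ge0// ltW.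
  by rewrite ler_pdivlMr// mul1r le_min l1 ltW.
- by apply: summableZ; exact: (profile_majorant_summable hJ).
Qed.

(** Monotonicity: both the flux (a - b) J a b z and the cutoff grow with the
    distance of a to b on either side of b. The slope: the term vanishes unless
    |a - b| exceeds the level, and there J is Lipschitz. *)
Lemma cut_slope (e C a a' b : R) (z : V) : 0 < e -> 0 <= C ->
  (forall a b c d z, `|a| <= M -> `|b| <= M -> `|c| <= M -> `|d| <= M ->
      e <= `|a - b| -> e <= `|c - d| ->
      `|J a b z - J c d z| <= C * (`|a - c| + `|b - d|) * kap z) ->
  `|a| <= M -> `|a'| <= M -> `|b| <= M -> a' <= a ->
  0 <= (a - b) * cutoff e (a - b) * J a b z -
       (a' - b) * cutoff e (a' - b) * J a' b z <=
       (a - a') * ((1 + 2 * M * C) * kap z).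
Proof.
move=> e0 C0 lip aM a'M bM aa.
set d := a - b; set d' := a' - b.
have dd : d' <= d by rewrite /d /d'; lra.
have Jge x y : 0 <= J x y z by exact: (profile_ge0 hJ).
have Jle x : `|x| <= M -> J x b z <= kap z by move=> xM; exact: (profile_le hJ).
have c0 x : 0 <= cutoff e x by exact: cutoff_ge0.
have k0 := kap0 z.
have adE : a - a' = d - d' by rewrite /d /d'; ring.
have /andP[s0 s1] := soft_lipschitz e0 dd.
set s := d * cutoff e d in s0 s1 *; set s' := d' * cutoff e d' in s0 s1 *.
apply/andP; split.
  rewrite subr_ge0 /s /s'.
(* The cases of a' and a both above b, both below, and on either side. *)
  have [d'0|d'0] := leP 0 d'.
    have dJ : d' * J a' b z <= d * J a b z.
      by apply: (profile_mono hJ) => //; rewrite /d' in d'0; lra.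
    have cc : cutoff e d' <= cutoff e d.
      by apply: cutoff_homo => //; rewrite !ger0_norm//; lra.
    have nd0 : 0 <= d' * J a' b z by rewrite mulr_ge0.
    have := ler_pM (c0 d') nd0 cc dJ; lra.
  have [d0|d0] := leP d 0.
    have dJ : (- d) * J a b z <= (- d') * J a' b z.
      rewrite /d /d' !opprB (profile_sym hJ a) (profile_sym hJ a').
      by apply: (profile_mono hJ) => //; rewrite /d in d0; lra.
    have cc : cutoff e d <= cutoff e d'.
      by apply: cutoff_homo => //; rewrite !ler0_norm//; lra.
    have nd0 : 0 <= - d * J a b z by rewrite mulr_ge0 ?oppr_ge0.
    have := ler_pM (c0 d) nd0 cc dJ; lra.
  apply: (@le_trans _ _ 0).
    by rewrite -mulrA; apply: mulr_le0_ge0; [exact: ltW|exact: mulr_ge0].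
  by rewrite -mulrA; apply: mulr_ge0; [exact: ltW|exact: mulr_ge0].
have Jb := Jle _ aM; have Jb' := Jle _ a'M.
have C2 : 0 <= 2 * M * C by rewrite !mulr_ge0.
have ad0 : 0 <= d - d' by lra.
rewrite adE.
have base : (d - d') * kap z <= (d - d') * ((1 + 2 * M * C) * kap z).
  by apply: ler_wpM2l => //; rewrite ler_peMl// lerDl.
have [de'|de'] := leP `|d'| e.
  have s'0 : s' = 0 by exact: soft_small.
  rewrite s'0 mul0r subr0; apply: le_trans base.
  by apply: ler_pM => //; rewrite s'0 in s0 s1; lra.
have [de|de] := leP `|d| e.
  have s00 : s = 0 by exact: soft_small.
  rewrite s00 mul0r sub0r -mulNr; apply: le_trans base.
  by apply: ler_pM => //; rewrite s00 in s0 s1; lra.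
have L := lip a b a' b z aM bM a'M bM (ltW de) (ltW de').
rewrite subrr normr0 addr0 adE (ger0_norm ad0) in L.
have -> : s * J a b z - s' * J a' b z =
  (s - s') * J a b z + s' * (J a b z - J a' b z) by ring.
have t1 : (s - s') * J a b z <= (d - d') * kap z by apply: ler_pM.
have s'M : `|s'| <= 2 * M.
  rewrite /s' normrM [`|cutoff _ _|]ger0_norm//.
  apply: (@le_trans _ _ `|d'|); first by rewrite ler_piMr ?cutoff_le1.
  by rewrite /d' (le_trans (ler_normB _ _))//; lra.
have t2 : s' * (J a b z - J a' b z) <= 2 * M * (C * (d - d') * kap z).
  by apply: (le_trans (ler_norm _)); rewrite normrM; apply: ler_pM.
lra.
Qed.

Lemma cut_kernel_step n : exists2 L : R, 1 <= L &
  step_kernel M (fun z => L * (kap z * far n z)) (cut_kernel n).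
Proof.
have l0 := level_gt0 n.
have [C C0 lip] := profile_lipschitz hJ l0.
have C2 : 0 <= 2 * M * C by rewrite !mulr_ge0.
exists (1 + 2 * M * C); first by rewrite lerDl.
split.
- apply: measurable_funM; first apply: measurable_funM.
  + exact: (profile_measurable hJ).
  + have md : measurable_fun setT (fun p : (R * R) * V => p.1.1 - p.1.2).
      apply: measurable_funB.
        exact: (measurableT_comp measurable_fst measurable_fst).
      exact: (measurableT_comp measurable_snd measurable_fst).
    exact: (measurableT_comp (measurable_cutoff l0) md).
  + exact: (measurableT_comp (measurable_far n) measurable_snd).
- by apply: summableZ; exact: summable_far.
- exact: cut_kernel_ge0.
- move=> a b z; rewrite /cut_kernel (profile_sym hJ) -opprB cutoffN /far normrN //.
- move=> a b z aM bM; apply: (le_trans (cut_kernel_le_far n z aM bM)).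
  by rewrite ler_peMl ?lerDl// mulr_ge0 ?far_ge0.
- move=> a a' b z aM a'M bM aa.
  have /andP[h1 h2] := cut_slope z l0 C0 lip aM a'M bM aa.
  have f0 := far_ge0 n z.
  have E x : (x - b) * cut_kernel n x b z =
      (x - b) * cutoff (level n) (x - b) * J x b z * far n z.
    by rewrite /cut_kernel; ring.
  rewrite !E; have := mulr_ge0 h1 f0; have := ler_wpM2r f0 h2.
  by move=> g2 g1; apply/andP; split; lra.
Qed.

(** A bound for the change of the flux under regularisation: everything is lost
    for displacements |z| below the level, and elsewhere at most the level. *)
Definition defect (n : nat) (d : R) (z : V) : R :=
  ((1 - far n z) * `|d| + Num.min (level n) `|d|) * kap z.

Lemma defect_ge0 n d z : 0 <= defect n d z.
Proof.
apply: mulr_ge0 => //; apply: addr_ge0.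
  by rewrite mulr_ge0// subr_ge0 far_le1.
by rewrite le_min normr_ge0 ltW ?level_gt0.
Qed.

Lemma cut_kernel_defect n a b z : `|a| <= M -> `|b| <= M ->
  `|(a - b) * J a b z - (a - b) * cut_kernel n a b z| <= defect n (a - b) z.
Proof.
move=> aM bM; rewrite -mulrBr normrM /cut_kernel /defect.
have J0 : 0 <= J a b z by exact: (profile_ge0 hJ).
have Jk := profile_le hJ z aM bM.
have c0 := cutoff_ge0 (a - b) (level_gt0 n).
have c1 := cutoff_le1 (a - b) (level_gt0 n).
have sd := soft_defect (a - b) (level_gt0 n).
have m0 : 0 <= Num.min (level n) `|a - b| by rewrite le_min normr_ge0 ltW ?level_gt0.
rewrite /far; case: ltP => _ /=; last first.
  rewrite !(mulr0, subr0) mul1r (ger0_norm J0).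
  by apply: ler_pM => //; rewrite lerDl.
rewrite subrr mul0r add0r mulr1 -{1}[J a b z]mulr1 -mulrBr normrM (ger0_norm J0).
rewrite [`|1 - _|]ger0_norm ?subr_ge0//.
rewrite mulrCA mulrC; apply: ler_pM => //.
by rewrite mulr_ge0 ?subr_ge0.
Qed.

Lemma defect_homo n m d z : (n <= m)%N -> defect m d z <= defect n d z.
Proof.
move=> nm; apply: ler_wpM2r => //; apply: lerD.
  apply: ler_wpM2r => //; rewrite lerD2l lerN2 /far.
  have := level_homo nm; case: ltP => // h1; case: ltP => // h2 h3.
  by have := lt_le_trans h1 (le_trans h2 h3); rewrite ltxx.
by rewrite le_min !ge_min lexx orbT (level_homo nm).
Qed.

(** ** Smallness of weighted integrals of the majorant *)

Lemma majorant_cvg0 (g : nat -> V -> R) (K : R) :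
  (forall n, measurable_fun setT (g n)) ->
  (forall n z, `|g n z| <= K * q z) ->
  (forall z, g n z @[n --> \oo] --> 0) ->
  forall e : R, 0 < e -> exists n0, forall n, (n0 <= n)%N ->
    \int[lam]_z (kap z * g n z) <= e.
Proof.
move=> mg gK g0 e e0.
have [_] : summable_fun lam (fun _ : V => 0 : R) /\
    (\int[lam]_z (kap z * g n z)) @[n --> \oo] --> \int[lam]_z (0 : R).
  apply: (Rint_cvg (g := fun z : V => K * (q z * kap z))).
  - by move=> n; exact: measurable_funM.
  - exact: measurable_cst.
  - by apply: aeW => z; rewrite -(mulr0 (kap z)); apply: cvgM => //; exact: cvg_cst.
  - by apply: summableZ; exact: (profile_majorant_summable hJ).
  - move=> n z; rewrite normrM ger0_norm// mulrA mulrC.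
    by apply: ler_wpM2r.
rewrite Rint0 => /cvgrPdist_le /(_ e e0) [n0 _ H]; exists n0 => n n0n.
by have := H n n0n; rewrite sub0r normrN; apply: le_trans; exact: ler_norm.
Qed.

Lemma near_mass_small (e : R) : 0 < e -> exists n0, forall n, (n0 <= n)%N ->
  \int[lam]_z (kap z * ((1 - far n z) * q z)) <= e.
Proof.
apply: (majorant_cvg0 (K := 1)).
- move=> n; apply: measurable_funM; last exact: measurable_jump_weight.
  by apply: measurable_funB => //; exact: measurable_far.
- move=> n z; rewrite ger0_norm; last first.
    by rewrite mulr_ge0 ?jump_weight_ge0// subr_ge0 far_le1.
  by apply: ler_wpM2r; [exact: jump_weight_ge0|have := far_ge0 n z; lra].
- move=> z; have [->|z0] := eqVneq z 0.
    by rewrite /jump_weight normr0 min_r//; under eq_fun do rewrite mulr0; exact: cvg_cst.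
  have nz : 0 < `|z| by rewrite normr_gt0.
  apply: cvg_near_cst; apply: (filterS _ (cvgr_lt 0 level_cvg0 _ nz)) => n ln.
  by rewrite /far ln subrr mul0r.
Qed.

Lemma capped_mass_small (C e : R) : 0 <= C -> 0 < e -> exists2 s : R, 0 < s &
  \int[lam]_z (kap z * Num.min (C * q z) (2 * s)) <= e.
Proof.
move=> C0 e0.
have [n0 H] : exists n0, forall n, (n0 <= n)%N ->
    \int[lam]_z (kap z * Num.min (C * q z) (2 * level n)) <= e.
  apply: (majorant_cvg0 (K := C)) e0.
  - move=> n; apply: measurable_minr => //.
    by apply: measurable_funM => //; exact: measurable_jump_weight.
  - move=> n z; rewrite ger0_norm; first by rewrite ge_min lexx.
    by rewrite le_min !mulr_ge0 ?jump_weight_ge0// ltW ?level_gt0.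
  - move=> z; apply/cvgrPdist_le => r r0; have r20 : 0 < r / 2 by lra.
    apply: (filterS _ (cvgr_le 0 level_cvg0 _ r20)) => n ln.
    rewrite sub0r normrN ger0_norm.
      by rewrite ge_min; apply/orP; right; lra.
    by rewrite le_min !mulr_ge0 ?jump_weight_ge0// ltW ?level_gt0.
by exists (level n0); [exact: level_gt0|exact: H].
Qed.

(** A Lipschitz weight that equals 1 outside the ball of radius r: integrated
    against it, |u| measures the mass near infinity. *)
Definition ramp (r : R) (x : V) : R := Num.min 1 (`|x| / r).

Lemma ramp_ge0 r x : 0 < r -> 0 <= ramp r x.
Proof. by move=> r0; rewrite le_min ler01 divr_ge0// ltW. Qed.

Lemma ramp_le1 r x : ramp r x <= 1.
Proof. by rewrite ge_min lexx. Qed.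

Lemma measurable_ramp r : measurable_fun [set: V] (ramp r).
Proof.
apply: measurable_minr => //; apply: measurable_funM => //.
exact: measurable_norm_rV.
Qed.

Lemma ramp_lipschitz r x y : 0 < r -> `|ramp r x - ramp r y| <= ramp r (x - y).
Proof.
move=> r0.
have A (a b c : R) : 0 <= a -> 0 <= b -> a <= b + c -> b <= a + c ->
    `|Num.min 1 a - Num.min 1 b| <= Num.min 1 c.
  move=> a0 b0 ab ba; rewrite ler_norml; apply/andP.
  by rewrite /Num.min; case: ltP => ?; case: ltP => ?; case: ltP => ?; split; lra.
apply: A; rewrite ?divr_ge0 ?(ltW r0)//.
  rewrite -mulrDl ler_wpM2r ?invr_ge0 ?(ltW r0)//.
  by rewrite -{1}(subrK y x) addrC ler_normD.
rewrite -mulrDl ler_wpM2r ?invr_ge0 ?(ltW r0)//.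
by rewrite -{1}(subrK x y) addrC (le_trans (ler_normD _ _))// (distrC y x).
Qed.

Lemma summable_ramp_majorant r : 0 < r ->
  summable_fun lam (fun z => kap z * ramp r z).
Proof.
move=> r0; apply: (summable_le (g := fun z : V => (1 + r^-1) * (q z * kap z))).
- by apply: measurable_funM => //; exact: measurable_ramp.
- move=> z; rewrite ger0_norm ?mulr_ge0 ?ramp_ge0// mulrA mulrC.
  apply: ler_wpM2r => //; rewrite /ramp /jump_weight.
  have ri : 0 <= r^-1 by rewrite invr_ge0 ltW.
  have := normr_ge0 z; move: `|z| => t t0.
  have tr : 0 <= t * r^-1 by rewrite mulr_ge0.
  case: (leP 1 t) => h.
    by rewrite mulr1 ge_min lerDl ri.
  by rewrite ge_min mulrDl mul1r (mulrC _ t) lerDr t0 orbT.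
- by apply: summableZ; exact: (profile_majorant_summable hJ).
Qed.

(** For large r this bounds the rate at which mass can reach the outside of the
    ball of radius r. *)
Lemma ramp_mass_small (e : R) : 0 < e -> exists2 r : R, 0 < r &
  \int[lam]_z (kap z * ramp r z) <= e.
Proof.
move=> e0.
have [n0 H] : exists n0, forall n, (n0 <= n)%N ->
    \int[lam]_z (kap z * ramp n.+1%:R z) <= e.
  apply: (majorant_cvg0 (K := 1)) e0.
  - by move=> n; exact: measurable_ramp.
  - move=> n z; rewrite ger0_norm ?ramp_ge0 ?ltr0n// mul1r.
    rewrite /ramp /jump_weight le_min ge_min lexx/= ge_min; apply/orP; right.
    by rewrite ler_pdivrMr ?ltr0n// ler_peMr// ler1n.
  - move=> z; apply/cvgrPdist_le => s s0.
    have z1 : 0 < s / (`|z| + 1) by rewrite divr_gt0// ltr_wpDl.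
    apply: (filterS _ (cvgr_le 0 level_cvg0 _ z1)) => n ln.
    rewrite sub0r normrN ger0_norm ?ramp_ge0 ?ltr0n//.
    rewrite ge_min; apply/orP; right.
    move: ln; rewrite ler_pdivlMr ?ltr_wpDl// /level => ln.
    rewrite mulrC; apply: le_trans ln.
    by rewrite ler_wpM2l ?invr_ge0// lerDl.
by exists n0.+1%:R; [rewrite ltr0n|exact: H].
Qed.

End regularised_kernel.

(** * Explicit Euler schemes: stability, consistency and convergence *)

Section schemes.
Context {R : realType} {N : nat}.
Local Notation V := 'rV[R]_N.
Local Notation lam := (@lebesgue_rV R N).
Local Notation lam2 := (lam \x lam)%E.
Local Notation q := (@jump_weight R N).
Local Notation norm1 u := (\int[lam]_x `|u x|).
Local Notation dist1 u v := (\int[lam]_x `|u x - v x|).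
Variables (M : R) (kap : V -> R) (J : R -> R -> V -> R).
Hypothesis M0 : 0 <= M.
Hypothesis hJ : jump_profile M kap J.
Local Notation K := (\int[lam]_z (q z * kap z)).
Local Notation level := (@level R).
Local Notation far := (@far R N).
Local Notation ck := (cut_kernel J).
Local Notation state := (@state R N M).
Local Notation A n := (nonlocal (ck n)).

Variable L : nat -> R.
Hypothesis L1 : forall n, 1 <= L n.
Hypothesis hL : forall n, step_kernel M (fun z => L n * (kap z * far n z)) (ck n).
Local Notation W n := (\int[lam]_z (L n * (kap z * far n z))).

(** The step sizes: small with respect to the Lipschitz constants of the
    regularised operators, and each an integral multiple of the later ones. *)
Variable h : nat -> R.
Hypothesis h_gt0 : forall n, 0 < h n.
Hypothesis h_small : forall n, h n * (1 + W n) <= level n.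
Hypothesis h_dvd : forall n m, (n <= m)%N -> exists2 i : nat, (0 < i)%N & h n = i%:R * h m.

Definition scheme n k (u : V -> R) := iter k (euler (ck n) (h n)) u.

Let kap0 := profile_majorant_ge0 hJ.
Let h0 n : 0 <= h n. Proof. exact: ltW. Qed.

Lemma ler_of_eq (a b : R) : a = b -> a <= b.
Proof. by move=> ->. Qed.

Lemma W_ge0 n : 0 <= W n.
Proof.
apply: Rint_ge0 => z; rewrite !mulr_ge0 ?far_ge0//.
by apply: le_trans (L1 n).
Qed.

Lemma scheme_cfl n : h n * W n <= 1.
Proof.
apply: le_trans (@level_le1 R n); apply: le_trans (h_small n).
by apply: ler_wpM2l => //; rewrite lerDr.
Qed.

Lemma scheme_state n k u : state u -> state (scheme n k u).
Proof.
move=> su; elim: k => // k IH; rewrite /scheme iterS.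
exact: (euler_state (hL n) M0 IH (h0 n) (scheme_cfl n)).
Qed.

Lemma scheme_mass n k u : state u -> \int[lam]_x scheme n k u x = \int[lam]_x u x.
Proof.
move=> su; elim: k => // k IH; rewrite /scheme iterS.
by rewrite (euler_mass (hL n) M0 (scheme_state n k su)).
Qed.

Lemma scheme_contraction n k u v : state u -> state v ->
  dist1 (scheme n k u) (scheme n k v) <= dist1 u v.
Proof.
move=> su sv; elim: k => // k IH; apply: le_trans IH; rewrite /scheme !iterS.
apply: (euler_contraction (hL n) M0 (h0 n) (scheme_cfl n));
  exact: scheme_state.
Qed.

Lemma scheme_modulus n k u z : state u ->
  modulus (scheme n k u) z <= modulus u z.
Proof.
move=> su; elim: k => // k IH; apply: le_trans IH; rewrite /scheme !iterS.
apply: (euler_modulus (hL n) M0 (h0 n) (scheme_cfl n)); exact: scheme_state.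
Qed.

(** Integrating Jensen's inequality for one step, the exchange of j(u) drops out
    since it is antisymmetric. *)
Lemma scheme_jensen n k u (j s : R -> R) (C : R) : state u ->
  measurable_fun setT j -> 0 <= C -> (forall r, `|r| <= M -> `|j r| <= C * `|r|) ->
  (forall a b, `|b| <= M -> j a + s a * (b - a) <= j b) ->
  \int[lam]_x j (scheme n k u x) <= \int[lam]_x j (u x).
Proof.
move=> su mj C0 jC js; elim: k => // k IH; apply: le_trans IH; rewrite /scheme !iterS.
have := scheme_state n k su; rewrite /scheme; set v := iter _ _ _ => sv.
have sv' := euler_state (hL n) M0 sv (h0 n) (scheme_cfl n).
have sj w : state w -> summable_fun lam (j \o w).
  move=> sw; apply: (summable_le (g := fun x : V => C * `|w x|)).
  - by apply: measurableT_comp => //; exact: (summable_measurable sw.1).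
  - by move=> x; apply: jC; exact: sw.2.
  - by apply: summableZ; apply: summable_norm; exact: sw.1.
have [s1 s2 e1] := exchange_test (hL n) M0 sv mj C0 jC (phi := fun=> 1) (B := 1)
  (measurable_cst _) (fun _ => ler_of_eq (normr1 R)).
have I0 : \int[lam]_x (\int[lam]_y exchange (ck n) j v (x, y)) = 0.
  transitivity (\int[lam]_x (1 * \int[lam]_y exchange (ck n) j v (x, y))).
    by apply: eq_Rint => x; rewrite mul1r.
  by rewrite e1; under eq_Rint do rewrite subrr mulr0; rewrite Rint0 mulr0.
have s3 : summable_fun lam (fun x => \int[lam]_y exchange (ck n) j v (x, y)).
  by move: s1; under eq_fun do rewrite mul1r.
apply: (@le_trans _ _ (\int[lam]_x
    (j (v x) - h n * \int[lam]_y exchange (ck n) j v (x, y)))).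
  apply: Rint_le.
  - exact: (sj _ sv').
  - by apply: summableB; [exact: (sj _ sv)|exact: summableZ].
  - move=> x; have jB (r : R) : `|r| <= M -> `|j r| <= C * M.
      by move=> rM; apply: (le_trans (jC r rM)); exact: ler_wpM2l.
    exact: (euler_jensen (hL n) sv (h0 n) (scheme_cfl n) x mj jB js).
rewrite RintB; [|exact: (sj _ sv)|exact: summableZ].
by rewrite RintZ// I0 mulr0 subr0.
Qed.

Lemma norm_subgradient (a b : R) : `|a| + Num.sg a * (b - a) <= `|b|.
Proof.
rewrite mulrBr -normrEsg addrC subrK (le_trans (ler_norm _))// normrM.
by rewrite normr_sg ler_piMl// lern1; case: (_ != _).
Qed.

Lemma scheme_norm n k u : state u -> norm1 (scheme n k u) <= norm1 u.
Proof.
move=> su; have mn : measurable_fun [set: R] (fun a : R => `|a|).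
  exact: normr_measurable.
have jC (r : R) : `|r| <= M -> `| `|r| | <= 1 * `|r| by rewrite normr_id mul1r.
exact: (scheme_jensen n k su mn ler01 jC (fun a b _ => norm_subgradient a b)).
Qed.

(** Mass moves to infinity at a finite rate, uniformly in the scheme. *)
Lemma scheme_tail n k u r : state u -> 0 < r ->
  \int[lam]_x (`|scheme n k u x| * ramp r x) <=
  \int[lam]_x (`|u x| * ramp r x) +
    k%:R * h n * (norm1 u * \int[lam]_z (kap z * ramp r z)).
Proof.
move=> su r0; elim: k => [|k IH]; first by rewrite !mul0r addr0.
set c := \int[lam]_z (kap z * ramp r z) in IH *.
have sv := scheme_state n k su; have nv := scheme_norm n k su.
rewrite /scheme iterS; rewrite /scheme in IH sv nv; set v := iter k _ _ in IH sv nv *.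
have sv' := euler_state (hL n) M0 sv (h0 n) (scheme_cfl n).
have mn : measurable_fun [set: R] (fun a : R => `|a|) by exact: normr_measurable.
have jC (a : R) : `|a| <= M -> `| `|a| | <= 1 * `|a| by rewrite normr_id mul1r.
have rb (x : V) : `|ramp r x| <= 1 by rewrite ger0_norm ?ramp_ge0 ?ramp_le1.
have mr := measurable_ramp (N := N) r.
have [s1 s2 e1] := exchange_test (hL n) M0 sv mn ler01 jC mr rb.
have sR w : state w -> summable_fun lam (fun x => `|w x| * ramp r x).
  move=> sw; apply: (summable_le (g := fun x : V => `|w x|)).
  - apply: measurable_funM => //.
    by apply: measurableT_comp => //; exact: (summable_measurable sw.1).
  - by move=> x; rewrite normrM normr_id ler_piMr.
  - by apply: summable_norm; exact: sw.1.
have step1 : \int[lam]_x (`|euler (ck n) (h n) v x| * ramp r x) <=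
   \int[lam]_x (`|v x| * ramp r x) - h n *
     (2^-1 * \int[lam2]_p (exchange (ck n) (fun a => `|a|) v p * (ramp r p.1 - ramp r p.2))).
  rewrite -e1 -RintZ// -RintB; [|exact: sR|exact: summableZ].
  apply: Rint_le; [exact: sR|by apply: summableB; [exact: sR|exact: summableZ]|].
  move=> x; rewrite [X in _ <= _ - X]mulrCA (mulrC (`|v x|)) -mulrBr mulrC.
  apply: ler_wpM2l; first exact: ramp_ge0.
  have jB (a : R) : `|a| <= M -> `| `|a| | <= M by rewrite normr_id.
  exact: (euler_jensen (hL n) sv (h0 n) (scheme_cfl n) x mn jB
    (fun a b _ => norm_subgradient a b)).
have sk : summable_fun lam (fun z => kap z * ramp r z) by exact: (summable_ramp_majorant hJ).
have snv := summable_norm sv.1.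
have k0 (z : V) : 0 <= kap z * ramp r z by rewrite mulr_ge0 ?ramp_ge0.
have [c1 C1] := summable_conv snv sk (fun=> normr_ge0 _) k0.
have [c2 C2] := summable_conv_snd snv sk (fun=> normr_ge0 _) k0.
have step2 : - (\int[lam2]_p (exchange (ck n) (fun a => `|a|) v p * (ramp r p.1 - ramp r p.2)))
    <= 2 * (c * norm1 v).
  have aux (a : R) : - a <= `|a| by rewrite -normrN ler_norm.
  apply: (le_trans (aux _)); apply: (le_trans (Rint_norm s2)).
  rewrite mulr_natl mulr2n; apply: le_trans (lerD C1 C2); rewrite -RintD//.
  apply: Rint_le; [exact: summable_norm|exact: summableD|].
  move=> p; rewrite normrM /exchange normrM -mulrDl mulrA.
  apply: ler_pM => //; last exact: ramp_lipschitz.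
  rewrite [`|ck _ _ _ _|]ger0_norm; last exact: (step_ge0 (hL n)).
  apply: ler_pM => //; first exact: (step_ge0 (hL n)).
    by rewrite (le_trans (ler_normB _ _))// !normr_id.
  by apply: (cut_kernel_le hJ); exact: sv.2.
have cc0 : 0 <= c by exact: Rint_ge0.
have step3 := ler_wpM2l cc0 nv.
apply: (le_trans step1); rewrite -(natr1 k).
have aux (P Q I hh c' nv' nu kk : R) : P <= Q + kk * hh * (nu * c') ->
    hh * (c' * nv') <= hh * (c' * nu) -> hh * - I <= hh * (2 * (c' * nv')) ->
    P - hh * (2^-1 * I) <= Q + (kk + 1) * hh * (nu * c').
  by move=> *; lra.
exact: (aux _ _ _ _ _ _ _ _ IH (ler_wpM2l (h0 n) step3) (ler_wpM2l (h0 n) step2)).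
Qed.

Section regular_datum.
Variables (u : V -> R) (C : R).
Hypothesis su : state u.
Hypothesis C0 : 0 <= C.
Hypothesis uC : forall z, modulus u z <= C * q z.

(** The estimate that survives the removal of the regularisation: along a fixed
    displacement z the integral is at most kap z times the modulus of v. *)
Lemma exchange_mass n v : state v -> (forall z, modulus v z <= C * q z) ->
  \int[lam2]_p `|exchange (ck n) id v p| <= C * K.
Proof.
move=> sv vC; have mv := summable_measurable sv.1.
have sqk := profile_majorant_summable hJ.
rewrite -RintZ//.
have sE x z : x - (x - z) = z :> V by rewrite opprB addrC subrK.
have me : measurable_fun setT (exchange (ck n) id v).
  exact: (measurable_exchange (hL n) (@measurable_idR R) mv).
have le z : forall x, `|exchange (ck n) id v (x, x - z)| <=
    kap z * `|v x - v (x - z)|.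
  move=> x; rewrite /exchange /= sE normrM mulrC; apply: ler_wpM2r => //.
  rewrite ger0_norm; last exact: (step_ge0 (hL n)).
  by apply: (cut_kernel_le hJ); exact: sv.2.
have sl z : summable_fun lam (fun x => `|exchange (ck n) id v (x, x - z)|).
  apply: (summable_le (g := fun x : V => kap z * `|v x - v (x - z)|)).
  - apply: measurableT_comp => //; apply: measurableT_comp me _.
    apply: measurable_fun_pair => //.
    exact: (shift_preserves (- z)).1.
  - by move=> x; rewrite normr_id; exact: le.
  - by apply: summableZ; apply: summable_modulus; exact: sv.1.
have := @pair_integral_le R N (fun p => `|exchange (ck n) id v p|)
  (fun z => C * (q z * kap z)) (measurableT_comp (@normr_measurable R setT) me) (fun=> normr_ge0 _)
  (summableZ C sqk) _ sl _; case => //.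
- by move=> z; rewrite !mulr_ge0// jump_weight_ge0.
- move=> z; apply: (@le_trans _ _ (kap z * modulus v z)).
    rewrite /modulus -RintZ; last by apply: summable_modulus; exact: sv.1.
    apply: Rint_le => //.
    by apply: summableZ; apply: summable_modulus; exact: sv.1.
  by have := ler_wpM2l (kap0 z) (vC z); lra.
Qed.

Lemma nonlocal_norm n v : state v -> (forall z, modulus v z <= C * q z) ->
  norm1 (A n v) <= C * K.
Proof.
move=> sv vC; apply: le_trans (exchange_mass n sv vC).
have se := exchange_summable (hL n) M0 sv (@measurable_idR R) (C := 1)
  (fun r _ => ler_of_eq (esym (mul1r `|r|))).
have [s1 ->] := summable_Rint_param (summable_norm se).
apply: Rint_le => //.
  apply: summable_norm; exact: (nonlocal_summable (hL n) M0 sv).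
by move=> x; apply: Rint_norm; exact: (exchange_slice_summable (hL n) sv).
Qed.

Lemma scheme_reg n k z : modulus (scheme n k u) z <= C * q z.
Proof. by apply: le_trans (uC z); exact: scheme_modulus. Qed.

Lemma scheme_time1 n k : dist1 (scheme n k.+1 u) (scheme n k u) <= h n * (C * K).
Proof.
have sv := scheme_state n k su.
apply: le_trans (ler_wpM2l (h0 n) (nonlocal_norm n sv (scheme_reg n k))).
rewrite -RintZ; last by apply: summable_norm; exact: (nonlocal_summable (hL n) M0 sv).
rewrite le_eqVlt; apply/orP; left; apply/eqP; apply: eq_Rint => x.
rewrite /scheme iterS /euler -/(scheme n k u) addrC addrA addNr sub0r normrN.
by rewrite normrM ger0_norm.
Qed.

Lemma dist1_triangle (a b c : V -> R) : summable_fun lam a -> summable_fun lam b ->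
  summable_fun lam c -> dist1 a c <= dist1 a b + dist1 b c.
Proof.
move=> sa sb sc; rewrite -RintD; [|exact/summable_norm/summableB..].
apply: Rint_le; first exact/summable_norm/summableB.
  by apply: summableD; exact/summable_norm/summableB.
by move=> x; exact: ler_distD.
Qed.

Lemma scheme_time n k i :
  dist1 (scheme n (k + i) u) (scheme n k u) <= i%:R * h n * (C * K).
Proof.
elim: i => [|i IH].
  by rewrite addn0 !mul0r; under eq_Rint do rewrite subrr normr0; rewrite Rint0.
have s j := (scheme_state n j su).1.
apply: (le_trans (dist1_triangle (s _) (s (k + i)%N) (s _))).
rewrite addnS -(natr1 i) !mulrDl mul1r addrC; apply: lerD => //.
exact: scheme_time1.
Qed.

End regular_datum.

(** Deduced from the contraction of one Euler step, of size 1 / (1 + W), instead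
    of a direct estimate of the nonlinearity. *)
Lemma nonlocal_lipschitz n u v : state u -> state v ->
  dist1 (A n u) (A n v) <= 2 * (1 + W n) * dist1 u v.
Proof.
move=> su sv; have W0 := W_ge0 n.
have e0 : 0 < 1 + W n by lra.
set e := (1 + W n)^-1; have ie : 0 < e by rewrite invr_gt0.
have cfl : e * W n <= 1 by rewrite mulrC ler_pdivrMr// mul1r lerDr.
have ct := euler_contraction (hL n) M0 (ltW ie) cfl su sv.
have s1 := nonlocal_summable (hL n) M0 su; have s2 := nonlocal_summable (hL n) M0 sv.
have s3 := euler_summable (hL n) M0 su e; have s4 := euler_summable (hL n) M0 sv e.
have s5 := su.1; have s6 := sv.1.
have : e * dist1 (A n u) (A n v) <= 2 * dist1 u v.
  rewrite mulr_natl mulr2n; apply: le_trans (lerD (lexx _) ct).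
  rewrite -RintZ; last exact/summable_norm/summableB.
  rewrite -RintD; [|exact/summable_norm/summableB..].
  apply: Rint_le.
  - by apply: summableZ; exact/summable_norm/summableB.
  - by apply: summableD; exact/summable_norm/summableB.
  - move=> x; rewrite -[e in e * _]gtr0_norm// -normrM.
    have -> : e * (A n u x - A n v x) =
      (u x - v x) - (euler (ck n) e u x - euler (ck n) e v x).
      by rewrite /euler; ring.
    exact: ler_normB.
move=> H; have := ler_wpM2l (ltW e0) H.
have -> : forall D : R, (1 + W n) * (e * D) = D.
  by move=> D; rewrite mulrA divff ?mul1r// gt_eqF.
by rewrite mulrA (mulrC (1 + W n)).
Qed.

(** ** Uniform smallness of the defect *)

(** For a given datum and a given time, C and tau can be chosen such that the
    iterates of all the schemes up to that time are in the class. *)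
Definition regular_class (C : R) (tau : R -> R) (v : V -> R) :=
  [/\ state v, forall z, modulus v z <= C * q z &
      forall r, 0 < r -> \int[lam]_x (`|v x| * ramp r x) <= tau r].

(** On a large cube the integrand is at most the level, which tends to 0, and
    outside it the ramp is 1. *)
Lemma capped_norm_small (C : R) (tau : R -> R) (s : R) : 0 < s ->
  (forall e, 0 < e -> exists2 r, 0 < r & tau r <= e) ->
  exists n0, forall n, (n0 <= n)%N -> forall v, regular_class C tau v ->
    \int[lam]_x Num.min (level n) `|v x| <= s.
Proof.
move=> s0 tau0; have s20 : 0 < s / 2 by lra.
have [r r0 tr] := tau0 _ s20.
pose k := (Num.truncn r).+1; pose vol := \int[lam]_x (\1_(@cube R N k) x : R).
have vol0 : 0 <= vol by apply: Rint_ge0 => x.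
have e0 : 0 < s / 2 / (vol + 1) by rewrite divr_gt0// ltr_wpDl.
have [n0 _ H] := cvgr_le 0 (@level_cvg0 R) _ e0.
exists n0 => n n0n v [sv _ vt].
have l0 := @level_gt0 R n.
have sc : summable_fun lam \1_(@cube R N k) by exact: summable_box.
have sr : summable_fun lam (fun x => `|v x| * ramp r x).
  apply: (summable_le (g := fun x : V => `|v x|)).
  - apply: measurable_funM; last exact: measurable_ramp.
    by apply: measurableT_comp => //; exact: (summable_measurable sv.1).
  - by move=> x; rewrite normrM normr_id ler_piMr// ger0_norm ?ramp_ge0 ?ramp_le1.
  - by apply: summable_norm; exact: sv.1.
apply: (@le_trans _ _ (level n * vol + tau r)); last first.
  have : level n * (vol + 1) <= s / 2.
    by rewrite -ler_pdivlMr ?ltr_wpDl//; exact: H.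
  have : level n * vol <= level n * (vol + 1) by rewrite ler_wpM2l ?(ltW l0)// lerDl.
  lra.
apply: le_trans (lerD (lexx _) (vt r r0)).
rewrite -RintZ// -RintD//; last exact: summableZ.
apply: Rint_le.
- apply: (summable_le (g := fun x : V => `|v x|)).
  + apply: measurable_minr => //; apply: measurableT_comp => //.
    exact: (summable_measurable sv.1).
  + by move=> x; rewrite ger0_norm ?ge_min ?lexx ?orbT// le_min (ltW l0) normr_ge0.
  + by apply: summable_norm; exact: sv.1.
- by apply: summableD => //; exact: summableZ.
- move=> x; rewrite indicE; have [xk|xk] := pselect (cube k x).
    rewrite mem_set// mulr1 ge_min lerDl mulr_ge0//; exact: ramp_ge0.
  rewrite memNset// mulr0 add0r ge_min; apply/orP; right.
  rewrite /ramp min_l ?mulr1// ler_pdivlMr// mul1r leNgt; apply/negP => xr.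
  by apply: xk; apply: cube_norm; apply: (lt_trans xr); exact: truncnS_gt.
Qed.

Lemma measurable_defect n (v : V -> R) : measurable_fun setT v ->
  measurable_fun setT (fun p : V * V => defect kap n (v p.1 - v p.2) (p.1 - p.2)).
Proof.
move=> mv; apply: measurable_funM; last first.
  exact: (measurable_on_disp (profile_majorant_measurable hJ)).
have md : measurable_fun setT (fun p : V * V => `|v p.1 - v p.2|).
  apply: measurableT_comp => //; apply: measurable_funB.
    exact: measurable_on_fst.
  exact: measurable_on_snd.
apply: measurable_funD; last exact: measurable_minr.
apply: measurable_funM => //; apply: measurable_funB => //.
exact: (measurable_on_disp (measurable_far n)).
Qed.

(** The regularised operators are uniformly close on functions with a bounded
    modulus and no mass at infinity: near z = 0 by the modulus, and elsewhere
    because most of the mass of v sits where |v| exceeds the level. *)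
Lemma defect_small (C : R) (tau : R -> R) (e : R) : 0 <= C -> 0 < e ->
  (forall e, 0 < e -> exists2 r, 0 < r & tau r <= e) ->
  exists n0, forall n, (n0 <= n)%N -> forall v, regular_class C tau v ->
    summable_fun lam2 (fun p => defect kap n (v p.1 - v p.2) (p.1 - p.2)) /\
    \int[lam2]_p defect kap n (v p.1 - v p.2) (p.1 - p.2) <= e.
Proof.
move=> C0 e0 tau0; have e20 : 0 < e / 2 by lra.
have [s s0 Hs] := capped_mass_small hJ C0 e20.
have [n1 H1] := capped_norm_small C s0 tau0.
have e3 : 0 < e / 2 / (C + 1) by rewrite divr_gt0// ltr_wpDl.
have [n2 H2] := near_mass_small hJ e3.
exists (maxn n1 n2) => n; rewrite geq_max => /andP[n1n n2n] v rv.
have [sv vC _] := rv; have mv := summable_measurable sv.1.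
have cn := H1 n n1n v rv; have nm := H2 n n2n.
have sqk := profile_majorant_summable hJ; have mk := profile_majorant_measurable hJ.
have sE x z : x - (x - z) = z :> V by rewrite opprB addrC subrK.
have f1 z : 0 <= 1 - far n z by rewrite subr_ge0 far_le1.
have l0 := @level_gt0 R n.
have q0 := @jump_weight_ge0 R N; have mq := @measurable_jump_weight R N.
have min0 (a : R) : 0 <= a -> 0 <= Num.min (level n) a.
  by move=> a0; rewrite le_min a0 ltW.
have sA : summable_fun lam (fun z => kap z * ((1 - far n z) * q z)).
  apply: (summable_le (g := fun z : V => q z * kap z)) => //.
  - apply: measurable_funM => //; apply: measurable_funM => //.
    by apply: measurable_funB => //; exact: measurable_far.
  - move=> z; rewrite ger0_norm ?mulr_ge0// mulrC; apply: ler_wpM2r => //.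
    by rewrite ler_piMl// gerBl far_ge0.
have sB : summable_fun lam (fun z => kap z * Num.min (C * q z) (2 * s)).
  apply: (summable_le (g := fun z : V => C * (q z * kap z))) => //.
  - apply: measurable_funM => //; apply: measurable_minr => //.
    exact: measurable_funM.
  - move=> z; rewrite ger0_norm; last first.
      by rewrite mulr_ge0// le_min !mulr_ge0// ltW.
    by rewrite mulrA mulrC ler_wpM2r// ge_min lexx.
  - exact: summableZ.
have sM z : summable_fun lam (fun x => `|v x - v (x - z)|).
  by apply: summable_modulus; exact: sv.1.
have smin (g : V -> R) : summable_fun lam g ->
    summable_fun lam (fun x => Num.min (level n) `|g x|).
  move=> sg; apply: (summable_le (g := fun x : V => `|g x|)).
  - apply: measurable_minr => //; apply: measurableT_comp => //.
    exact: summable_measurable sg.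
  - by move=> x; rewrite ger0_norm ?min0// ge_min lexx orbT.
  - exact: summable_norm.
have smd z : summable_fun lam (fun x => Num.min (level n) `|v x - v (x - z)|).
  by apply: smin; apply: summableB; [exact: sv.1|apply: summable_translate; exact: sv.1].
have imin z : \int[lam]_x Num.min (level n) `|v x - v (x - z)| <=
    Num.min (C * q z) (2 * s).
  rewrite le_min; apply/andP; split.
    apply: le_trans (vC z); apply: Rint_le => // x.
    by rewrite ge_min lexx orbT.
  have sn := smin _ sv.1; have st := summable_translate z sn.
  apply: (@le_trans _ _ (2 * \int[lam]_x Num.min (level n) `|v x|)); last first.
    by apply: ler_wpM2l.
  rewrite mulr_natl mulr2n -{2}(Rint_translate z sn) -RintD//.
  apply: Rint_le => //; first exact: summableD.
  have aux (l a b c : R) : 0 < l -> 0 <= a -> 0 <= b -> c <= a + b ->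
      Num.min l c <= Num.min l a + Num.min l b.
    by move=> *; rewrite /Num.min; case: ltP => ?; case: ltP => ?; case: ltP => ?; lra.
  by move=> x; apply: aux => //; exact: ler_normB.
have [] := @pair_integral_le R N
  (fun p => defect kap n (v p.1 - v p.2) (p.1 - p.2))
  (fun z => C * (kap z * ((1 - far n z) * q z)) + kap z * Num.min (C * q z) (2 * s)).
- exact: measurable_defect.
- by move=> p; exact: (defect_ge0 hJ).
- by apply: summableD => //; exact: summableZ.
- move=> z; apply: addr_ge0; first by rewrite !mulr_ge0.
  by rewrite mulr_ge0// le_min !mulr_ge0// ltW.
- move=> z /=; rewrite /defect; under eq_fun do rewrite sE mulrC.
  by apply: summableZ; apply: summableD => //; exact: summableZ.
- move=> z /=; rewrite /defect; under eq_Rint do rewrite sE mulrC.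
  rewrite RintZ; last by apply: summableD => //; exact: summableZ.
  rewrite RintD//; last exact: summableZ.
  rewrite RintZ//.
  have := ler_wpM2l (f1 z) (vC z); rewrite /modulus => g1.
  have := ler_wpM2l (kap0 z) (lerD g1 (imin z)).
  lra.
move=> sF le; split => //; apply: (le_trans le).
rewrite RintD//; last exact: summableZ.
rewrite RintZ//.
have I0 : 0 <= \int[lam]_z (kap z * ((1 - far n z) * q z)).
  by apply: Rint_ge0 => z; rewrite !mulr_ge0.
have : (C + 1) * \int[lam]_z (kap z * ((1 - far n z) * q z)) <= e / 2.
  by rewrite mulrC -ler_pdivlMr ?ltr_wpDl.
lra.
Qed.

Lemma nonlocal_defect n m v : (n <= m)%N -> state v ->
  summable_fun lam2 (fun p => defect kap n (v p.1 - v p.2) (p.1 - p.2)) ->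
  dist1 (A m v) (A n v) <=
    2 * \int[lam2]_p defect kap n (v p.1 - v p.2) (p.1 - p.2).
Proof.
move=> nm sv sd.
have idC (r : R) : `|r| <= M -> `|id r| <= 1 * `|r| by rewrite mul1r.
have sm := exchange_summable (hL m) M0 sv (@measurable_idR R) idC.
have sn := exchange_summable (hL n) M0 sv (@measurable_idR R) idC.
have sD := summable_norm (summableB sm sn).
have [s1 e1] := summable_Rint_param sD.
apply: (@le_trans _ _ (\int[lam2]_p `|exchange (ck m) id v p - exchange (ck n) id v p|)).
  rewrite e1; apply: Rint_le => //.
    apply/summable_norm/summableB.
      exact: (nonlocal_summable (hL m) M0 sv).
    exact: (nonlocal_summable (hL n) M0 sv).
  move=> x; have t1 := exchange_slice_summable (hL m) sv x.
  have t2 := exchange_slice_summable (hL n) sv x.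
  by rewrite /nonlocal -RintB//; apply: Rint_norm; exact: summableB.
rewrite -RintZ//; apply: Rint_le => //; first exact: summableZ.
move=> p; rewrite /exchange /=.
have vb := sv.2.
have d1 := cut_kernel_defect hJ n (p.1 - p.2) (vb p.1) (vb p.2).
have d2 := cut_kernel_defect hJ m (p.1 - p.2) (vb p.1) (vb p.2).
have d3 := defect_homo hJ (v p.1 - v p.2) (p.1 - p.2) nm.
rewrite distrC in d2.
have := ler_distD ((v p.1 - v p.2) * J (v p.1) (v p.2) (p.1 - p.2))
  ((v p.1 - v p.2) * ck m (v p.1) (v p.2) (p.1 - p.2))
  ((v p.1 - v p.2) * ck n (v p.1) (v p.2) (p.1 - p.2)).
lra.
Qed.

(** ** Comparison of two schemes *)

Section comparison.
Variables (u : V -> R) (C : R) (d : R) (n m i : nat).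
Hypothesis su : state u.
Hypothesis C0 : 0 <= C.
Hypothesis uC : forall z, modulus u z <= C * q z.
Hypothesis d0 : 0 <= d.
Hypothesis hmi : h n = i%:R * h m.
Variable T : R.
Hypothesis near_ops : forall k, k%:R * h m <= T ->
  dist1 (A m (scheme m k u)) (A n (scheme m k u)) <= d.
Let B := d + 2 * level n * (C * K).

Let K0 : 0 <= K.
Proof. by apply: Rint_ge0 => z; rewrite mulr_ge0 ?jump_weight_ge0. Qed.

(** Along the fine steps that make up a coarse one, the two operators differ by
    d, and the argument of the coarse operator moves by at most a multiple
    of the coarse step; the restriction on h n makes its Lipschitz constant harmless. *)
Lemma coarse_step_error k j : (j <= i)%N -> (k + j)%:R * h m <= T ->
  \int[lam]_x `|scheme m (k + j) u x -
    (scheme m k u x - j%:R * h m * A n (scheme m k u) x)| <= j%:R * h m * B.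
Proof.
elim: j => [|j IH] ji kjT.
  rewrite addn0 !mul0r.
  by under eq_Rint do rewrite mul0r subr0 subrr normr0; rewrite Rint0.
have hm := h_gt0 m.
have kjT' : (k + j)%:R * h m <= T.
  by apply: le_trans kjT; rewrite ler_wpM2r ?(ltW hm)// ler_nat leq_add2l.
have {}IH := IH (ltnW ji) kjT'.
have sk := scheme_state m k su; have skj := scheme_state m (k + j) su.
have sA := nonlocal_summable (hL n) M0 sk.
have sA' := nonlocal_summable (hL n) M0 skj.
have sAm := nonlocal_summable (hL m) M0 skj.
have s1 : summable_fun lam (fun x => scheme m (k + j) u x -
    (scheme m k u x - j%:R * h m * A n (scheme m k u) x)).
  apply: summableB; first exact: skj.1.
  by apply: summableB; [exact: sk.1|exact: summableZ].
have s2 : summable_fun lam (fun x => A m (scheme m (k + j) u) x -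
   A n (scheme m (k + j) u) x) by exact: summableB.
have s3 : summable_fun lam (fun x => A n (scheme m (k + j) u) x -
   A n (scheme m k u) x) by exact: summableB.
have e1 := near_ops kjT'.
have e2 : dist1 (A n (scheme m (k + j) u)) (A n (scheme m k u)) <=
    2 * level n * (C * K).
  apply: (le_trans (nonlocal_lipschitz n skj sk)).
  have W0 := W_ge0 n.
  have W20 : 0 <= 2 * (1 + W n) by lra.
  apply: (le_trans (ler_wpM2l W20 (scheme_time su C0 uC m k j))).
  have CK : 0 <= C * K by exact: mulr_ge0.
  have jh : j%:R * h m <= h n by rewrite hmi ler_wpM2r ?(ltW hm)// ler_nat ltnW.
  have := ler_wpM2r CK (ler_wpM2l W20 jh).
  have := ler_wpM2r CK (h_small n).
  lra.
apply: (@le_trans _ _ (\int[lam]_x (`|scheme m (k + j) u x -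
    (scheme m k u x - j%:R * h m * A n (scheme m k u) x)| + h m *
    (`|A m (scheme m (k + j) u) x - A n (scheme m (k + j) u) x| +
     `|A n (scheme m (k + j) u) x - A n (scheme m k u) x|)))).
  apply: Rint_le.
  - apply: summable_norm; apply: summableB; first exact: (scheme_state m _ su).1.
    by apply: summableB; [exact: sk.1|exact: summableZ].
  - apply: summableD; first exact: summable_norm.
    by apply: summableZ; apply: summableD; exact: summable_norm.
  - move=> x; rewrite addnS {1}/scheme iterS /euler -/(scheme m (k + j) u).
    set a := scheme m (k + j) u; set b := scheme m k u.
    have -> : a x - h m * A m a x - (b x - j.+1%:R * h m * A n b x) =
      (a x - (b x - j%:R * h m * A n b x)) - h m *
       ((A m a x - A n a x) + (A n a x - A n b x)) by rewrite -(natr1 j); ring.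
    apply: (le_trans (ler_normB _ _)); rewrite lerD2l normrM (gtr0_norm hm).
    by apply: ler_wpM2l; [exact: ltW|exact: ler_normD].
rewrite RintD; [|exact: summable_norm|by apply: summableZ; apply: summableD; exact: summable_norm].
rewrite RintZ; last by apply: summableD; exact: summable_norm.
rewrite RintD; [|exact: summable_norm..].
apply: (le_trans (lerD IH (ler_wpM2l (ltW hm) (lerD e1 e2)))).
by rewrite -(natr1 j) [(j%:R + 1) * _]mulrDl mul1r [leRHS]mulrDl.
Qed.

(** Errors add up without amplification, because each coarse step is a
    contraction. *)
Lemma scheme_compare k : (i * k)%:R * h m <= T ->
  dist1 (scheme m (i * k) u) (scheme n k u) <= k%:R * h n * B.
Proof.
elim: k => [|k IH] kT.
  by rewrite muln0 !mul0r; under eq_Rint do rewrite subrr normr0; rewrite Rint0.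
have hm := h_gt0 m.
have kT' : (i * k)%:R * h m <= T.
  by apply: le_trans kT; rewrite ler_wpM2r ?(ltW hm)// ler_nat leq_mul2l leqnSn orbT.
rewrite mulnS addnC in kT *.
have sk := scheme_state m (i * k) su; have sk' := scheme_state n k su.
have c1 := coarse_step_error (leqnn i) kT.
have c2 := euler_contraction (hL n) M0 (h0 n) (scheme_cfl n) sk sk'.
have s1 := (scheme_state m (i * k + i) su).1.
have s2 := euler_summable (hL n) M0 sk (h n).
have s3 := (scheme_state n k.+1 su).1.
apply: (le_trans (dist1_triangle s1 s2 s3)).
rewrite -(natr1 k) !mulrDl mul1r addrC; apply: lerD.
  exact: le_trans c2 (IH kT').
move: c1; rewrite -hmi; apply: le_trans.
by rewrite le_eqVlt; apply/orP; left; apply/eqP; apply: eq_Rint => x.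
Qed.

End comparison.

Definition flow (n : nat) (t : R) (u : V -> R) : V -> R :=
  scheme n (Num.truncn (t / h n)) u.

Lemma flow_state n t u : state u -> state (flow n t u).
Proof. exact: scheme_state. Qed.

Lemma flow_contraction n t u v : state u -> state v ->
  dist1 (flow n t u) (flow n t v) <= dist1 u v.
Proof. exact: scheme_contraction. Qed.

(** On regular data the schemes remain in one regular class, on which the
    regularised operators are uniformly close; convergence comes from this and
    from the contraction, without any compactness. *)
Lemma flow_cauchy u C T e : state u -> 0 <= C ->
  (forall z, modulus u z <= C * q z) -> 0 <= T -> 0 < e ->
  exists n0, forall n m, (n0 <= n)%N -> (n <= m)%N ->
    forall t, 0 <= t -> t <= T -> dist1 (flow m t u) (flow n t u) <= e.
Proof.
move=> su C0 uC T0 e0.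
have K0 : 0 <= K by apply: Rint_ge0 => z; rewrite mulr_ge0 ?jump_weight_ge0.
have CK : 0 <= C * K by exact: mulr_ge0.
(* The margin 1 covers the last, incomplete coarse step. *)
pose T1 := T + 1; have T10 : 0 < T1 by rewrite /T1; lra.
pose tau r := \int[lam]_x (`|u x| * ramp r x) +
  T1 * (norm1 u * \int[lam]_z (kap z * ramp r z)).
have nu0 : 0 <= norm1 u by apply: Rint_ge0 => x.
have ramp_anti (r r' : R) (z : V) : 0 < r -> r <= r' -> ramp r' z <= ramp r z.
  move=> r0 rr; rewrite le_min ge_min lexx/= ge_min; apply/orP; right.
  by rewrite ler_wpM2l// lef_pV2// posrE; exact: lt_le_trans rr.
have tau0 s : 0 < s -> exists2 r, 0 < r & tau r <= s.
  move=> s0; have s20 : 0 < s / 2 by lra.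
  have den : 0 < T1 * (norm1 u + 1) by rewrite mulr_gt0// ltr_wpDl.
  have [r1 r10 Hr1] := ramp_mass_small hJ (divr_gt0 s20 den).
  have mnu : measurable_fun setT (fun x : V => `|u x|).
    by apply: measurableT_comp => //; exact: (summable_measurable su.1).
  have [_] : summable_fun lam (fun _ : V => 0 : R) /\
      (\int[lam]_x (`|u x| * ramp k.+1%:R x)) @[k --> \oo] --> \int[lam]_x (0 : R).
    apply: (Rint_cvg (g := fun x : V => `|u x|)).
    - by move=> k; apply: measurable_funM => //; exact: measurable_ramp.
    - exact: measurable_cst.
    - apply: aeW => x; rewrite -(mulr0 `|u x|); apply: cvgM; first exact: cvg_cst.
      apply: (@squeeze_cvgr _ _ _ _ (fun=> 0) (fun k => `|x| * level k)).
      + apply: nearW => k; rewrite ramp_ge0 ?ltr0n//=.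
        by rewrite ge_min lexx orbT.
      + exact: cvg_cst.
      + by rewrite -(mulr0 `|x|); apply: cvgM; [exact: cvg_cst|exact: level_cvg0].
    - by apply: summable_norm; exact: su.1.
    - by move=> k x; rewrite normrM normr_id ler_piMr// ger0_norm ?ramp_ge0 ?ramp_le1.
  rewrite Rint0 => /cvgrPdist_le /(_ _ s20) [k0 _ Hk].
  pose k := maxn k0 (Num.truncn r1).
  have r1k : r1 <= k.+1%:R.
    rewrite (le_trans (ltW (truncnS_gt _)))// ler_nat ltnS.
    exact: leq_maxr.
  exists k.+1%:R => //; rewrite [s]splitr; apply: lerD.
    have := Hk k (leq_maxl _ _); rewrite sub0r normrN; apply: le_trans.
    exact: ler_norm.
  have I0 : 0 <= \int[lam]_z (kap z * ramp k.+1%:R z).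
    by apply: Rint_ge0 => z; rewrite mulr_ge0 ?ramp_ge0.
  have le : \int[lam]_z (kap z * ramp k.+1%:R z) <= s / 2 / (T1 * (norm1 u + 1)).
    apply: le_trans Hr1; apply: Rint_le.
    - exact: (summable_ramp_majorant hJ).
    - exact: (summable_ramp_majorant hJ).
    - by move=> z; apply: ler_wpM2l => //; exact: ramp_anti.
  rewrite ler_pdivlMr// in le.
  have := mulr_ge0 (ltW T10) I0; lra.
(* The operators are within 2 s of each other, which costs at most 2 s T. *)
pose s := e / (4 * (T + 1)).
have s0 : 0 < s by rewrite divr_gt0// mulr_gt0// ltr_wpDl.
have [n1 H1] := defect_small C0 s0 tau0.
have e40 : 0 < e / (4 * (C * K + 1) * (T + 1)).
  by rewrite divr_gt0// !mulr_gt0// ltr_wpDl.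
have [n2 _ H2] := cvgr_le 0 (@level_cvg0 R) _ e40.
exists (maxn n1 n2) => n m; rewrite geq_max => /andP[n1n n2n] nm t t0 tT.
have l0 := @level_gt0 R n; have l2 := H2 n n2n; have l1 := @level_le1 R n.
have hl j : h j <= level j.
  apply: le_trans (h_small j); rewrite ler_peMr// ?lerDl ?W_ge0//.
have [i i0 hmi] := h_dvd nm.
have hm := h_gt0 m; have hn := h_gt0 n.
have reach k : k%:R * h m <= T1 -> regular_class C tau (scheme m k u).
  move=> kT; split; first exact: scheme_state.
    by move=> z; exact: scheme_reg.
  move=> r r0; apply: (le_trans (scheme_tail m k su r0)); rewrite lerD2l.
  apply: ler_wpM2r => //; rewrite mulr_ge0//.
  by apply: Rint_ge0 => z; rewrite mulr_ge0 ?ramp_ge0.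
have near_ops k : k%:R * h m <= T1 ->
    dist1 (A m (scheme m k u)) (A n (scheme m k u)) <= 2 * s.
  move=> kT; have [sd le] := H1 n n1n _ (reach k kT).
  apply: (le_trans (nonlocal_defect nm (scheme_state m k su) sd)).
  exact: ler_wpM2l.
pose k := Num.truncn (t / h n); pose k' := Num.truncn (t / h m).
have tn0 : 0 <= t / h n by rewrite divr_ge0// ltW.
have tm0 : 0 <= t / h m by rewrite divr_ge0// ltW.
have /andP[k1 k2] := truncn_itv tn0; have /andP[k1' k2'] := truncn_itv tm0.
have tmn : t / h m = i%:R * (t / h n).
  rewrite hmi invfM; field; rewrite pnatr_eq0 -lt0n i0 /=.
  by rewrite gt_eqF.
rewrite -/k in k1 k2; rewrite -/k' in k1' k2'.
(* The fine time k' lies within the coarse step that starts at i k. *)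
have kk' : (i * k <= k')%N.
  rewrite -ltnS -(ltr_nat R); apply: le_lt_trans k2'.
  by rewrite tmn natrM ler_wpM2l.
have kk2 : (k' < i * k.+1)%N.
  rewrite -(ltr_nat R); apply: (le_lt_trans k1').
  by rewrite tmn natrM ltr_pM2l// ltr0n.
have khT : k%:R * h n <= T.
  by apply: le_trans tT; rewrite -ler_pdivlMr.
have ikT : (i * k)%:R * h m <= T1.
  rewrite natrM mulrAC -hmi mulrC; rewrite /T1; lra.
have cmp := scheme_compare su C0 uC hmi near_ops ikT.
have tim := scheme_time su C0 uC m (i * k) (k' - i * k).
rewrite subnKC// in tim.
have s1 := (scheme_state m k' su).1.
have s2 := (scheme_state m (i * k) su).1.
have s3 := (scheme_state n k su).1.
apply: (le_trans (dist1_triangle s1 s2 s3)).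
have jh : (k' - i * k)%:R * h m <= h n.
  rewrite hmi ler_wpM2r ?(ltW hm)// ler_nat leq_subLR -mulnSr ltnW//.
have g1 := ler_wpM2r CK (le_trans jh (hl n)).
have B0 : 0 <= 2 * s + 2 * level n * (C * K).
  apply: addr_ge0; apply: mulr_ge0 => //; first exact: ltW.
  by apply: mulr_ge0 => //; exact: ltW.
have g2 := ler_wpM2r B0 khT.
have g3 : 4 * (T + 1) * s = e.
  by rewrite /s mulrC divfK// gt_eqF// mulr_gt0// ltr_wpDl.
have g4 : level n * (4 * (C * K + 1) * (T + 1)) <= e.
  by rewrite -ler_pdivlMr ?mulr_gt0 ?ltr_wpDl.
have Ts : 0 <= T * s by rewrite mulr_ge0// ltW.
have lT : 0 <= level n * T by rewrite mulr_ge0// ltW.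
have lCK : 0 <= level n * (C * K) by rewrite mulr_ge0// ltW.
have lCKT : 0 <= level n * (C * K) * T by rewrite mulr_ge0.
lra.
Qed.

Lemma flow_time u C n s t : state u -> 0 <= C ->
  (forall z, modulus u z <= C * q z) -> 0 <= s -> s <= t ->
  dist1 (flow n t u) (flow n s u) <= (t - s + h n) * (C * K).
Proof.
move=> su C0 uC s0 st.
have K0 : 0 <= K by apply: Rint_ge0 => z; rewrite mulr_ge0 ?jump_weight_ge0.
have hn := h_gt0 n.
have t0 := le_trans s0 st.
have tn0 : 0 <= t / h n by rewrite divr_ge0// ltW.
have sn0 : 0 <= s / h n by rewrite divr_ge0// ltW.
have /andP[k1 k2] := truncn_itv tn0; have /andP[k1' k2'] := truncn_itv sn0.
rewrite /flow.
set k := Num.truncn (t / h n) in k1 k2 *; set k' := Num.truncn (s / h n) in k1' k2' *.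
have kk : (k' <= k)%N.
  rewrite -ltnS -(ltr_nat R); apply: le_lt_trans k2.
  by apply: (le_trans k1'); rewrite ler_wpM2r// invr_ge0 ltW.
have := scheme_time su C0 uC n k' (k - k'); rewrite subnKC//.
move/le_trans; apply; apply: ler_wpM2r; first exact: mulr_ge0.
rewrite natrB// mulrBl.
rewrite ler_pdivlMr// in k1; rewrite ltr_pdivrMr// -natr1 mulrDl mul1r in k2'.
lra.
Qed.

End schemes.

(** * Rapidly convergent sequences in L^1 *)

Section fast_convergence.
Context d (T : measurableType d) (R : realType).
Variable mu : {measure set T -> \bar R}.
Implicit Types f g : T -> R.

(** Fatou's lemma for a convergent sequence with eventually bounded
    integrals. *)
Lemma Rint_fatou (f_ : nat -> T -> R) f (c : R) n0 :
  (forall n, summable_fun mu (f_ n)) -> (forall n x, 0 <= f_ n x) ->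
  measurable_fun setT f -> (forall x, 0 <= f x) ->
  {ae mu, forall x, f_ n x @[n --> \oo] --> f x} ->
  (forall n, (n0 <= n)%N -> \int[mu]_x f_ n x <= c) ->
  summable_fun mu f /\ \int[mu]_x f x <= c.
Proof.
move=> sf_ f_0 mf f0 cf fc.
have mf_ n : measurable_fun setT (EFin \o f_ n) by case/integrableP: (sf_ n).
have mE : measurable_fun setT (EFin \o f) by exact/measurable_EFinP.
have le : (\int[mu]_x (f x)%:E <= c%:E)%E.
  have := @fatou _ T R mu setT measurableT (fun n => EFin \o f_ n) mf_.
  have f_0' n x : setT x -> (0 <= (EFin \o f_ n) x)%E by rewrite lee_fin.
  move=> /(_ f_0'); set I := (\int[mu]_(x in _) _)%E.
  have -> : I = (\int[mu]_x (f x)%:E)%E.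
    apply: ae_eq_integral => //.
      have -> : (fun x => limn_einf ((fun n => EFin \o f_ n) ^~ x)) =
          (fun x => - limn_esup (fun n => - (f_ n x)%:E))%E by [].
      apply: measurableT_comp => //; apply: measurable_fun_limn_esup => n.
      exact: (measurableT_comp (@oppe_measurable R setT) (mf_ n)).
    apply: filterS cf => x cx _ /=.
    have cE : (f_ n x)%:E @[n --> \oo] --> (f x)%:E.
      by apply: cvg_EFin => //; exact: nearW.
    by have [-> _] := cvg_limn_einf_sup cE.
  move/le_trans; apply; rewrite limn_einf_lim; apply: lime_le.
    exact: is_cvg_einfs.
  apply: nearW => n; apply: (@le_trans _ _ (\int[mu]_x (f_ (maxn n n0) x)%:E)%E).
    by apply: ereal_inf_lbound; exists (maxn n n0) => //=; exact: leq_maxl.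
  by rewrite -EFin_Rint// lee_fin; apply: fc; exact: leq_maxr.
have sf : summable_fun mu f.
  apply: summable_le_lty => //.
  have -> : (\int[mu]_x `|f x|%:E = \int[mu]_x (f x)%:E)%E.
    by apply: eq_integral => x _; rewrite ger0_norm.
  by apply: (le_lt_trans le); exact: ltry.
by split => //; rewrite -lee_fin (EFin_Rint sf).
Qed.

Lemma summable_series_ae (f_ : nat -> T -> R) (B : R) :
  (forall n, summable_fun mu (f_ n)) ->
  (forall n, \sum_(i < n) \int[mu]_x `|f_ i x| <= B) ->
  {ae mu, forall x, cvgn (fun n => \sum_(i < n) f_ i x)}.
Proof.
move=> sf fB.
pose a n x := (`|f_ n x|%:E : \bar R).
have a0 n x : (0 <= a n x)%E by rewrite lee_fin.
have ma n : measurable_fun setT (a n).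
  by apply/measurable_EFinP; apply: measurableT_comp => //; exact: summable_measurable (sf n).
have IS : (\int[mu]_x (\sum_(n <oo) a n x) <= B%:E)%E.
  rewrite integral_nneseries//; apply: lime_le.
    by apply: is_cvg_nneseries => n _ _; exact: integral_ge0.
  apply: nearW => n; rewrite big_mkord.
  rewrite (eq_bigr (fun i : 'I_n => (\int[mu]_x `|f_ i x|)%:E)); last first.
    by move=> i _; rewrite EFin_Rint//; exact: summable_norm.
  by rewrite sumEFin lee_fin; exact: fB.
have S0 x : (0 <= \sum_(n <oo) a n x)%E by exact: nneseries_ge0.
have mS : measurable_fun setT (fun x => \sum_(n <oo) a n x)%E.
  exact: (@ge0_emeasurable_sum _ _ _ setT a xpredT (fun k x _ _ => a0 k x)
    (fun k _ => ma k)).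
have iS : mu.-integrable setT (fun x => \sum_(n <oo) a n x)%E.
  apply/integrableP; split => //.
  under eq_integral do rewrite gee0_abs//.
  by apply: (le_lt_trans IS); exact: ltry.
have := integrable_ae measurableT iS; apply: filterS => x /(_ I) fx.
have bnd n : \sum_(i < n) `|f_ i x| <= fine (\sum_(n <oo) a n x)%E.
  rewrite -lee_fin fineK// -sumEFin.
  have := @nneseries_lim_ge R (a ^~ x) xpredT 0%N n (fun _ _ _ => a0 _ _).
  by rewrite big_mkord.
have : cvgn (series (fun n => f_ n x)).
  apply: normed_cvg; apply: nondecreasing_is_cvgn.
    exact: (@nondecreasing_series R (fun n => `|f_ n x|) xpredT 0
      (fun _ _ _ => normr_ge0 _)).
  exists (fine (\sum_(n <oo) a n x)%E) => _ [n _ <-].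
  by have := bnd n; rewrite -(big_mkord xpredT (fun i => `|f_ i x|)).
by rewrite seriesEord.
Qed.

Lemma geometric_sum_le (n : nat) : \sum_(i < n) (2^-1 : R) ^+ i <= 2.
Proof.
suff : \sum_(i < n) (2^-1 : R) ^+ i = 2 - 2 * 2^-1 ^+ n.
  by move=> ->; rewrite gerBl mulr_ge0// exprn_ge0.
elim: n => [|n IH]; first by rewrite big_ord0 expr0 mulr1 subrr.
by rewrite big_ord_recr /= IH exprS; field.
Qed.

(** A geometric rate in L^1 makes the series of increments converge absolutely
    almost everywhere; the same rate, doubled, then holds for the limit. *)
Lemma fast_cauchy (f_ : nat -> T -> R) (C : R) (n0 : nat) :
  (forall n, summable_fun mu (f_ n)) -> 0 <= C ->
  (forall n, (n0 <= n)%N ->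
    \int[mu]_x `|f_ n.+1 x - f_ n x| <= C * 2^-1 ^+ n) ->
  {ae mu, forall x, cvgn (f_ ^~ x)} /\
  forall f, measurable_fun setT f ->
    {ae mu, forall x, f_ n x @[n --> \oo] --> f x} ->
    forall n, (n0 <= n)%N -> summable_fun mu (fun x => f_ n x - f x) /\
      \int[mu]_x `|f_ n x - f x| <= 2 * C * 2^-1 ^+ n.
Proof.
move=> sf C0 fC.
have sd m n : summable_fun mu (fun x => f_ m x - f_ n x) by exact: summableB.
have tel m k x : f_ (m + k)%N x = f_ m x + \sum_(i < k) (f_ (m + i).+1 x - f_ (m + i)%N x).
  elim: k => [|k IH]; first by rewrite addn0 big_ord0 addr0.
  by rewrite big_ord_recr /= addrA -IH addnS addrC subrK.
have bound m k : (n0 <= m)%N ->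
    \sum_(i < k) \int[mu]_x `|f_ (m + i).+1 x - f_ (m + i)%N x| <=
      2 * C * 2^-1 ^+ m.
  move=> nm; apply: (@le_trans _ _ (\sum_(i < k) C * 2^-1 ^+ m * 2^-1 ^+ i)).
    apply: ler_sum => i _; rewrite -mulrA -exprD; apply: fC.
    exact: (leq_trans nm (leq_addr _ _)).
  rewrite -mulr_sumr -[2 * C * _]mulrA (mulrC 2); apply: ler_wpM2l.
    by rewrite mulr_ge0// exprn_ge0.
  exact: geometric_sum_le.
split.
  have := @summable_series_ae (fun i x => f_ (n0 + i).+1 x - f_ (n0 + i)%N x)
    _ (fun i => sd _ _) (fun k => bound n0 k (leqnn _)).
  apply: filterS => x cx; apply/cvg_ex; exists (f_ n0 x +
    limn (fun n => \sum_(i < n) (f_ (n0 + i).+1 x - f_ (n0 + i)%N x))).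
  rewrite -(cvg_shiftn n0) /=.
  have E : (fun n => f_ (n + n0)%N x) =
      (fun n => f_ n0 x + \sum_(i < n) (f_ (n0 + i).+1 x - f_ (n0 + i)%N x)).
    by apply/funext => n; rewrite addnC tel.
  by rewrite E; apply: cvgD; [exact: cvg_cst|exact: cx].
move=> f mf cf n nn.
have mfn m : measurable_fun setT (f_ m) := summable_measurable (sf m).
have [] := @Rint_fatou (fun m x => `|f_ n x - f_ m x|) (fun x => `|f_ n x - f x|)
  (2 * C * 2^-1 ^+ n) n.
- by move=> m; apply: summable_norm.
- by [].
- by apply: measurableT_comp => //; exact: measurable_funB.
- by [].
- by apply: filterS cf => x cx; apply: cvg_norm; apply: cvgB => //; exact: cvg_cst.
- move=> m nm; apply: le_trans (bound n (m - n)%N nn).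
  rewrite -Rint_sum; last by move=> i; exact: summable_norm.
  apply: Rint_le; [exact: summable_norm|by apply: summable_sum => i; exact: summable_norm|].
  move=> x; rewrite distrC -{1}(subnKC nm) tel addrAC subrr add0r.
  exact: ler_norm_sum.
move=> s le; split => //.
by apply: (summable_le _ _ s) => //; exact: measurable_funB.
Qed.

End fast_convergence.

(** * Approximate solutions with arbitrary integrable data *)

Section approximate_flows.
Context {R : realType} {N : nat}.
Local Notation V := 'rV[R]_N.
Local Notation lam := (@lebesgue_rV R N).
Local Notation q := (@jump_weight R N).
Local Notation dist1 u v := (\int[lam]_x `|u x - v x|).
Local Notation geo j := ((2^-1 : R) ^+ j).
Variables (M : R) (kap : V -> R) (J : R -> R -> V -> R).
Hypothesis M0 : 0 <= M.
Hypothesis hJ : jump_profile M kap J.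
Local Notation K := (\int[lam]_z (q z * kap z)).
Local Notation ck := (cut_kernel J).

(** Admissible step sizes exist: negative powers of 2, to get divisibility. *)
Lemma parameters_exist : exists (L : nat -> R) (h : nat -> R),
  [/\ forall n, 1 <= L n,
      forall n, step_kernel M (fun z => L n * (kap z * far n z)) (ck n),
      forall n, 0 < h n,
      forall n, h n * (1 + \int[lam]_z (L n * (kap z * far n z))) <= @level R n &
      forall n m, (n <= m)%N -> exists2 i : nat, (0 < i)%N & h n = i%:R * h m].
Proof.
have [|L HL] := @choice nat R (fun n L => 1 <= L /\
    step_kernel M (fun z => L * (kap z * far n z)) (ck n)).
  by move=> n; have [L] := cut_kernel_step M0 hJ n; exists L.
pose W n := \int[lam]_z (L n * (kap z * far n z)).
pose r n := (Num.truncn ((1 + W n) / @level R n)).+1.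
pose p n := (\sum_(i < n.+1) r i)%N.
have W0 n : 0 <= W n.
  apply: Rint_ge0 => z; have [L1 _] := HL n.
  by rewrite !mulr_ge0 ?far_ge0 ?(profile_majorant_ge0 hJ)//; exact: le_trans L1.
exists L, (fun n => ((2 ^ p n)%N%:R)^-1); split.
- by move=> n; have [] := HL n.
- by move=> n; have [] := HL n.
- by move=> n; rewrite invr_gt0 ltr0n expn_gt0.
- move=> n; rewrite -/(W n) mulrC ler_pdivrMr ?ltr0n ?expn_gt0//.
  rewrite mulrC -ler_pdivrMr ?level_gt0//.
  apply: (le_trans (ltW (truncnS_gt _))); rewrite -/(r n) ler_nat.
  apply: (leq_trans (ltnW (ltn_expl (r n) (ltnSn 1)))).
  by rewrite leq_exp2l// /p big_ord_recr /= leq_addl.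
- move=> n m nm; have pnm : (p n <= p m)%N.
    rewrite /p -!(big_mkord xpredT r) (@big_cat_nat _ _ _ n.+1 0 m.+1)//=.
    exact: leq_addr.
  exists (2 ^ (p m - p n))%N; first by rewrite expn_gt0.
  have nz k : (2 ^ k)%N%:R != 0 :> R by rewrite pnatr_eq0 -lt0n expn_gt0.
  have -> : (2 ^ p m)%N%:R = (2 ^ (p m - p n))%N%:R * (2 ^ p n)%N%:R :> R.
    by rewrite -natrM -expnD subnK.
  by rewrite invfM mulrA divff// mul1r.
Qed.

Definition clip (a : R) : R := Num.max (- M) (Num.min M a).

Lemma clip_bound a : `|clip a| <= M.
Proof.
rewrite ler_norml /clip; apply/andP; split; first by rewrite le_max lexx.
by rewrite ge_max ge_min lexx /= andbT ge0_cp.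
Qed.

Lemma clip_id a : `|a| <= M -> clip a = a.
Proof.
by rewrite ler_norml => /andP[a1 a2]; rewrite /clip min_r// max_r.
Qed.

Lemma clip_lipschitz a b : `|clip a - clip b| <= 1 * `|a - b|.
Proof.
rewrite mul1r.
wlog ab : a b / b <= a => [H|].
  by have [/H//|/ltW/H] := leP b a; rewrite distrC [leRHS]distrC.
rewrite [leRHS]ger0_norm ?subr_ge0// ler_norml /clip /Num.max /Num.min.
by case: (ltP M a) => ?; case: (ltP M b) => ?; case: ltP => ?; case: ltP => ?;
  apply/andP; split; lra.
Qed.

Lemma measurable_clip : measurable_fun [set: R] clip.
Proof. by apply: measurable_maxr => //; exact: measurable_minr. Qed.

(** Clipping keeps the approximations within the bound M without enlarging their
    modulus or their distance to u. *)
Lemma regular_data (u : V -> R) : state M u ->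
  exists (w : nat -> V -> R) (C : nat -> R), forall j,
    [/\ state M (w j), 0 <= C j, forall z, modulus (w j) z <= C j * q z &
        dist1 (w j) u <= geo j].
Proof.
move=> [su ub].
have [|w Hw] := @choice nat (V -> R) (fun j w => state M w /\
    bv_like w /\ dist1 w u <= geo j).
  move=> j; have gj : 0 < geo j by rewrite exprn_gt0.
  have [_ /(_ _ gj)[g bg ug]] := bv_closure_summable su.
  have bw := bv_like_lipschitz measurable_clip (clip_id _) ler01 clip_lipschitz bg.
  have c0 : `|0 : R| <= M by rewrite normr0.
  have {}bw := bw c0.
  exists (clip \o g); split.
    by split; [have [] := bw|move=> x; exact: clip_bound].
  split => //; apply: le_trans ug; have [sg _] := bg; have [sw _] := bw.
  apply: Rint_le; [exact/summable_norm/summableB|exact/summable_norm/summableB|].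
  by move=> x /=; rewrite -{1}(clip_id (ub x)) distrC -[leRHS]mul1r clip_lipschitz.
have [|C HC] := @choice nat R (fun j C => 0 <= C /\ forall z, modulus (w j) z <= C * q z).
  by move=> j; have [_ [[_ [C C0 wC]] _]] := Hw j; exists C.
by exists w, C => j; have [? [? ?]] := Hw j; have [? ?] := HC j.
Qed.

(** The constant of the j-th regular datum may blow up with j; the level nu j is
    chosen after the datum, fine enough for the scheme to have converged on the
    time interval [0, j + 1]. Changing the datum from j to j + 1 costs its
    distance, by contraction. *)
Lemma approximate_flows (u : V -> R) : state M u ->
  exists (L h : nat -> R) (w : nat -> V -> R) (nu : nat -> nat) (C : nat -> R),
  [/\ [/\ forall n, 1 <= L n,
      forall n, step_kernel M (fun z => L n * (kap z * far n z)) (ck n),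
      forall n, 0 < h n &
      forall n, h n * (1 + \int[lam]_z (L n * (kap z * far n z))) <= @level R n],
      forall j, [/\ (j <= nu j)%N, state M (w j), 0 <= C j & dist1 (w j) u <= geo j],
      forall j t, 0 <= t -> t <= j.+1%:R ->
        dist1 (flow J h (nu j.+1) t (w j.+1)) (flow J h (nu j) t (w j)) <= 3 * geo j &
      forall j s t, 0 <= s -> s <= t ->
        dist1 (flow J h (nu j) t (w j)) (flow J h (nu j) s (w j)) <=
          C j * (t - s) + geo j].
Proof.
move=> su.
have [L [h [L1 hL h0 hW hd]]] := parameters_exist.
have [w [C HwC]] := regular_data su.
have K0 : 0 <= K.
  by apply: Rint_ge0 => z; rewrite mulr_ge0 ?jump_weight_ge0 ?(profile_majorant_ge0 hJ).
have gj j : 0 < geo j by rewrite exprn_gt0.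
have [|n1 H1] := @choice nat nat (fun j n0 => forall n m, (n0 <= n)%N -> (n <= m)%N ->
    forall t, 0 <= t -> t <= j.+1%:R ->
      dist1 (flow J h m t (w j)) (flow J h n t (w j)) <= geo j).
  move=> j; have [sw C0 wC _] := HwC j.
  exact: (flow_cauchy M0 hJ L1 hL h0 hW hd sw C0 wC (ler0n R j.+1) (gj j)).
have [|n2 H2] := @choice nat nat (fun j n0 => forall n, (n0 <= n)%N ->
    h n * (C j * K) <= geo j).
  move=> j; have [_ C0 _ _] := HwC j.
  have CK : 0 <= C j * K by exact: mulr_ge0.
  have e0 : 0 < geo j / (C j * K + 1) by rewrite divr_gt0// ltr_wpDl.
  have [n0 _ Hn] := cvgr_le 0 (@level_cvg0 R) _ e0.
  exists n0 => n n0n; have := Hn n n0n; rewrite /= ler_pdivlMr ?ltr_wpDl// => ln.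
  have W0 := W_ge0 hJ L1 n.
  have hl : h n <= @level R n.
    by apply: le_trans (hW n); rewrite ler_peMr ?(ltW (h0 n))// lerDl.
  apply: le_trans ln; apply: ler_pM => //; first exact: ltW.
  by rewrite lerDl.
pose nu j := (\sum_(i < j.+1) (maxn (maxn (n1 i) (n2 i)) 1))%N.
have nu_ge j : (maxn (maxn (n1 j) (n2 j)) 1 <= nu j)%N.
  by rewrite /nu big_ord_recr /= leq_addl.
have nu_mono j : (nu j <= nu j.+1)%N.
  by rewrite /nu [leqRHS]big_ord_recr /= leq_addr.
have nu1 j : (n1 j <= nu j)%N.
  by apply: leq_trans (nu_ge j); rewrite !leq_max leqnn.
have nu2 j : (n2 j <= nu j)%N.
  by apply: leq_trans (nu_ge j); rewrite !leq_max leqnn orbT.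
have nuj j : (j <= nu j)%N.
  apply: ltnW; elim: j => [|j IH].
    by apply: leq_trans (nu_ge 0%N); rewrite leq_max leqnn orbT.
  rewrite /nu big_ord_recr /= -/(nu j) -addn1; apply: leq_add => //.
  by rewrite leq_max leqnn orbT.
exists L, h, w, nu, (fun j => C j * K); split => //.
- by move=> j; have [? ? ? ?] := HwC j; split => //; exact: mulr_ge0.
- move=> j t t0 tj; have [sw C0 wC wu] := HwC j; have [sw' C0' wC' wu'] := HwC j.+1.
  have st n v : state M v -> summable_fun lam (flow J h n t v).
    by move=> sv; exact: (flow_state M0 hL h0 hW n t sv).1.
  apply: (le_trans (dist1_triangle (st _ _ sw') (st (nu j.+1) _ sw) (st _ _ sw))).
  have e1 := flow_contraction M0 hL h0 hW (nu j.+1) t sw' sw.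
  have e2 := H1 j (nu j) (nu j.+1) (nu1 j) (nu_mono j) t t0 tj.
  have e3 : dist1 (w j.+1) (w j) <= dist1 (w j.+1) u + dist1 (w j) u.
    have -> : dist1 (w j) u = dist1 u (w j) by apply: eq_Rint => x; rewrite distrC.
    exact: (dist1_triangle sw'.1 su.1 sw.1).
  have e4 : geo j.+1 <= geo j.
    by rewrite exprS; apply: ler_piMl; [exact: ltW (gj j)|rewrite invf_le1 ?ltr0n// ler1n].
  apply: (le_trans (lerD (le_trans e1 (le_trans e3 (lerD (le_trans wu' e4) wu))) e2)).
  by rewrite le_eqVlt; apply/orP; left; apply/eqP; rewrite !mulrDl !mul1r addrA.
- move=> j s t s0 st; have [sw C0 wC wu] := HwC j.
  apply: (le_trans (flow_time M0 hJ hL h0 hW (nu j) sw C0 wC s0 st)).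
  have := H2 j (nu j) (nu2 j).
  lra.
Qed.

(** Schemes, constant in time on each step, are jointly measurable in (t, x). *)
Lemma measurable_steps (g : nat -> V -> R) (c : R) : 0 < c ->
  (forall k, measurable_fun setT (g k)) ->
  measurable_fun setT (fun p : measurableTypeR R * V => g (Num.truncn (p.1 / c)) p.2).
Proof.
move=> c0 mg _ B mB; rewrite setTI.
pose E (k : nat) : set (measurableTypeR R) := [set t : R | Num.truncn (t / c) = k].
have mE k : measurable (E k).
  pose f (t : R) : R := (Num.truncn (t / c))%:R.
  have mf : measurable_fun setT f.
    apply: nondecreasing_measurable => // s t st.
    rewrite ler_nat; apply: le_truncn.
    by rewrite ler_wpM2r// invr_ge0 ltW.
  rewrite (_ : E k = f @^-1` [set k%:R]).
    by rewrite -[X in measurable X]setTI; apply: mf => //; exact: measurable_set1.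
  apply/seteqP; split => t /=; first by rewrite /E/= /f => ->.
  by rewrite /f => /eqP; rewrite eqr_nat => /eqP.
rewrite (_ : _ @^-1` B = \bigcup_k (E k `*` (g k @^-1` B))).
  apply: bigcupT_measurable => k; apply: measurableX => //.
  by rewrite -[X in measurable X]setTI; exact: mg.
apply/seteqP; split => [[t x] /= Bx|[t x] /= [k _ [/= <-]]] //.
by exists (Num.truncn (t / c)).
Qed.

End approximate_flows.

(** * The limit of the approximate solutions *)

Section power_subgradient.
Context {R : realType}.

(** Young's inequality for the conjugate exponents p and p / (p - 1). *)
Lemma powR_tangent (p x y : R) : 1 <= p -> 0 <= x -> 0 <= y ->
  x `^ p + p * x `^ (p - 1) * (y - x) <= y `^ p.
Proof.
move=> p1 x0 y0; have p0 : 0 < p by lra.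
rewrite le_eqVlt in p1; case/orP: p1 => [/eqP <-|p1].
  by rewrite subrr powRr0 !powRr1//; lra.
have p10 : p - 1 != 0 by rewrite subr_eq0 gt_eqF.
have pn0 : p != 0 by rewrite gt_eqF.
pose q := p / (p - 1).
have q0 : 0 < q by rewrite divr_gt0//; lra.
have pq : p^-1 + q^-1 = 1 by rewrite /q invf_div; field.
have := @conjugate_powR R y (x `^ (p - 1)) p q y0 (powR_ge0 _ _) p0 q0 pq.
rewrite -powRrM /q mulrCA divff// mulr1 => Y.
have xx : x * x `^ (p - 1) = x `^ p by rewrite mulr_powRB1.
have e : x `^ p / (p / (p - 1)) = x `^ p - x `^ p / p by rewrite invf_div; field.
rewrite e in Y.
have := ler_wpM2l (ltW p0) Y.
have -> : p * (y `^ p / p + (x `^ p - x `^ p / p)) = y `^ p + p * x `^ p - x `^ p.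
  by field.
set X := x `^ (p - 1) in xx *; rewrite -xx.
lra.
Qed.

Definition pow_abs (p a : R) : R := `|a| `^ p.

Definition pow_slope (p a : R) : R := p * `|a| `^ (p - 1) * Num.sg a.

Lemma pow_subgradient (p a b : R) : 1 <= p ->
  pow_abs p a + pow_slope p a * (b - a) <= pow_abs p b.
Proof.
move=> p1; apply: le_trans (powR_tangent p1 (normr_ge0 a) (normr_ge0 b)).
rewrite lerD2l /pow_slope -mulrA; apply: ler_wpM2l.
  by rewrite mulr_ge0 ?powR_ge0//; lra.
have := norm_subgradient a b; lra.
Qed.

Lemma measurable_pow_abs p : measurable_fun [set: R] (pow_abs p).
Proof.
by apply: (measurableT_comp (measurable_powR p)); exact: normr_measurable.
Qed.

Lemma pow_abs_lipschitz (p M a b : R) : 1 <= p -> `|a| <= M -> `|b| <= M ->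
  `|pow_abs p a - pow_abs p b| <= p * M `^ (p - 1) * `|a - b|.
Proof.
move=> p1.
suff H x y : `|x| <= M -> pow_abs p x - pow_abs p y <= p * M `^ (p - 1) * `|x - y|.
  move=> aM bM; rewrite ler_norml; apply/andP; split; last exact: H.
  by have := H b a bM; rewrite distrC; lra.
move=> xM; have := pow_subgradient x y p1 => T.
apply: (@le_trans _ _ (pow_slope p x * (x - y))); first by lra.
apply: (le_trans (ler_norm _)); rewrite normrM; apply: ler_wpM2r => //.
rewrite /pow_slope !normrM (ger0_norm (powR_ge0 _ _)) (@ger0_norm _ p); last by lra.
apply: (@le_trans _ _ (p * `|x| `^ (p - 1))).
  rewrite ler_piMr ?mulr_ge0 ?powR_ge0//; first by lra.
  by rewrite normr_sg lern1; case: (_ != _).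
apply: ler_wpM2l; first by lra.
by apply: ge0_ler_powR => //; rewrite ?nnegrE//; [lra|exact: le_trans xM].
Qed.

Lemma pow_abs_le (p M a : R) : 1 <= p -> 0 <= M -> `|a| <= M ->
  `|pow_abs p a| <= p * M `^ (p - 1) * `|a|.
Proof.
move=> p1 M0 aM; have z0 : `|0 : R| <= M by rewrite normr0.
have := pow_abs_lipschitz p1 aM z0.
by rewrite !subr0 {2}/pow_abs normr0 powR0 ?subr0// gt_eqF//; lra.
Qed.

End power_subgradient.

Section limit_flow.
Context {R : realType} {N : nat}.
Local Notation V := 'rV[R]_N.
Local Notation lam := (@lebesgue_rV R N).
Local Notation dist1 u v := (\int[lam]_x `|u x - v x|).
Local Notation geo j := ((2^-1 : R) ^+ j).
Variables (M : R) (v : nat -> R -> V -> R) (D : nat -> R).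
Hypothesis M0 : 0 <= M.
Hypothesis sv : forall j t, state M (v j t).
Hypothesis mv : forall j,
  measurable_fun setT (fun p : measurableTypeR R * V => v j p.1 p.2).
Hypothesis v_cauchy : forall j t, 0 <= t -> t <= j.+1%:R ->
  dist1 (v j.+1 t) (v j t) <= 3 * geo j.
Hypothesis v_time : forall j s t, 0 <= s -> s <= t ->
  dist1 (v j t) (v j s) <= D j * (t - s) + geo j.
Hypothesis D0 : forall j, 0 <= D j.

(** At each time the sequence converges for almost every x; the upper limit is
    defined for all x, jointly measurable in (t, x), and bounded everywhere. *)
Definition limit_flow (t : R) (x : V) : R :=
  fine (limn_esup (fun j => (v j t x)%:E)).

Lemma limn_esup_bounded (a : nat -> R) : (forall j, `|a j| <= M) ->
  ((- M)%:E <= limn_esup (fun j => (a j)%:E) <= M%:E)%E.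
Proof.
move=> aM; rewrite limn_esup_lim; apply/andP; split.
- apply: lime_ge; first exact: is_cvg_esups.
  apply: nearW => n; apply: (@le_trans _ _ (a n)%:E).
    by rewrite lee_fin; have := aM n; rewrite ler_norml => /andP[].
  by apply: ereal_sup_ubound; exists n => //=.
- apply: lime_le; first exact: is_cvg_esups.
  apply: nearW => n; apply: ge_ereal_sup => _ [k /= _ <-].
  by rewrite lee_fin; have := aM k; rewrite ler_norml => /andP[].
Qed.

Lemma limit_flow_bounded t x : `|limit_flow t x| <= M.
Proof.
have /andP[h1 h2] := limn_esup_bounded (fun j => (sv j t).2 x).
have fin : limn_esup (fun j => (v j t x)%:E) \is a fin_num.
  by rewrite fin_numElt (lt_le_trans _ h1) ?ltNyr// (le_lt_trans h2)// ltry.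
by rewrite ler_norml -!lee_fin /limit_flow fineK// h1 h2.
Qed.

Lemma limit_flow_cvg t x l : v j t x @[j --> \oo] --> l -> limit_flow t x = l.
Proof.
move=> vl; have cE : (v j t x)%:E @[j --> \oo] --> l%:E.
  by apply: cvg_EFin => //; exact: nearW.
by rewrite /limit_flow; have [_ ->] := cvg_limn_einf_sup cE.
Qed.

Lemma measurable_limit_flow :
  measurable_fun setT (fun p : measurableTypeR R * V => limit_flow p.1 p.2).
Proof.
apply: (measurableT_comp (fine_measurable measurableT)).
apply: (@measurable_fun_limn_esup _ _ R setT
  (fun j (p : measurableTypeR R * V) => (v j p.1 p.2)%:E)) => j.
exact/measurable_EFinP.
Qed.

Lemma measurable_limit_flow_slice t : measurable_fun setT (limit_flow t).
Proof. exact: (measurableT_comp measurable_limit_flow (pair1_measurable t)). Qed.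

Let fast t : 0 <= t -> {ae lam, forall x, cvgn (v ^~ t ^~ x)} /\
  forall f : V -> R, measurable_fun setT f -> {ae lam, forall x, v j t x @[j --> \oo] --> f x} ->
  forall j, (Num.truncn t <= j)%N ->
    summable_fun lam (fun x => v j t x - f x) /\ dist1 (v j t) f <= 2 * 3 * geo j.
Proof.
move=> t0; apply: fast_cauchy => //; first by move=> j; exact: (sv j t).1.
move=> j tj; apply: v_cauchy => //.
by rewrite (le_trans (ltW (truncnS_gt t)))// ler_nat.
Qed.

Lemma limit_flow_ae t : 0 <= t ->
  {ae lam, forall x, v j t x @[j --> \oo] --> limit_flow t x}.
Proof.
move=> t0; have [+ _] := fast t0; apply: filterS => x /cvg_ex[l vl].
by rewrite (limit_flow_cvg vl).
Qed.

Lemma limit_flow_summable t : 0 <= t -> summable_fun lam (limit_flow t).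
Proof.
move=> t0; have [_ H] := fast t0.
have [s _] := H _ (measurable_limit_flow_slice t) (limit_flow_ae t0) _ (leqnn _).
have := summableB (sv (Num.truncn t) t).1 s.
by under eq_fun do rewrite opprB addrC subrK.
Qed.

Lemma limit_flow_dist t j : 0 <= t -> (Num.truncn t <= j)%N ->
  dist1 (v j t) (limit_flow t) <= 6 * geo j.
Proof.
move=> t0 tj; have [_ H] := fast t0.
have [_] := H _ (measurable_limit_flow_slice t) (limit_flow_ae t0) j tj.
by have -> : (2 * 3 = 6 :> R) by lra.
Qed.

Lemma geo_small (c e : R) : 0 < e -> exists j0, forall j, (j0 <= j)%N -> c * geo j <= e.
Proof.
move=> e0; have : c * geo j @[j --> \oo] --> (0 : R).
  rewrite -(mulr0 c); apply: cvgM; first exact: cvg_cst.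
  apply: cvg_expr; rewrite ger0_norm ?invr_ge0//.
  by rewrite invf_lt1// ltr1n.
move=> /cvgrPdist_le /(_ e e0) [j0 _ H]; exists j0 => j jj0.
by have := H j jj0; rewrite sub0r normrN; apply: le_trans; exact: ler_norm.
Qed.

Lemma limit_flow_continuous t (e : R) : 0 <= t -> 0 < e ->
  exists2 d : R, 0 < d & forall s, 0 <= s -> `|s - t| < d ->
    dist1 (limit_flow s) (limit_flow t) <= e.
Proof.
move=> t0 e0; have e20 : 0 < e / 2 by lra.
have [j0 H] := geo_small 13 e20.
pose j := maxn j0 (Num.truncn (t + 1)).
have Hj := H j (leq_maxl _ _).
have d0 : 0 < Num.min 1 (e / 2 / (D j + 1)).
  by rewrite lt_min ltr01/= divr_gt0// ltr_wpDl.
exists (Num.min 1 (e / 2 / (D j + 1))) => // s s0.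
rewrite lt_min => /andP[st1 std].
have trj r : r <= t + 1 -> (Num.truncn r <= j)%N.
  by move=> rt; apply: leq_trans (leq_maxr _ _); exact: le_truncn.
have sj := limit_flow_dist s0 (trj s _); have tj := limit_flow_dist t0 (trj t _).
have {}sj := sj (ltac:(move: st1; rewrite ltr_norml => /andP[? ?]; lra)).
have {}tj := tj (ltac:(lra)).
have mid : dist1 (v j s) (v j t) <= D j * `|s - t| + geo j.
  have [st|ts] := leP s t.
    have -> : dist1 (v j s) (v j t) = dist1 (v j t) (v j s).
      by apply: eq_Rint => x; rewrite distrC.
    by rewrite distrC ger0_norm ?subr_ge0//; exact: v_time.
  by rewrite gtr0_norm ?subr_gt0//; apply: v_time => //; exact: ltW.
have Dst : D j * `|s - t| <= e / 2.
  apply: (@le_trans _ _ ((D j + 1) * (e / 2 / (D j + 1)))).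
    by apply: ler_pM => //; [rewrite lerDl|exact: ltW].
  by rewrite mulrC divfK// gt_eqF// ltr_wpDl.
have ss := limit_flow_summable s0; have ts := limit_flow_summable t0.
have sjs := (sv j s).1; have sjt := (sv j t).1.
have sj' : dist1 (limit_flow s) (v j s) <= 6 * geo j.
  by apply: le_trans sj; rewrite le_eqVlt; apply/orP; left; apply/eqP;
    apply: eq_Rint => x; rewrite distrC.
apply: (le_trans (dist1_triangle ss sjs ts)).
have := dist1_triangle sjs sjt ts.
lra.
Qed.

Lemma limit_flow_mass t (m : R) : 0 <= t ->
  (forall j, `|\int[lam]_x v j t x - m| <= geo j) ->
  \int[lam]_x limit_flow t x = m.
Proof.
move=> t0 vm; apply/eqP; rewrite -subr_eq0 -normr_le0; apply/ler_addgt0Pl => e e0.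
rewrite addr0; have [j0 H] := geo_small 7 e0.
pose j := maxn j0 (Num.truncn t).
have Hj := H j (leq_maxl _ _).
have d := limit_flow_dist t0 (leq_maxr j0 (Num.truncn t)); rewrite -/j in d.
have ss := limit_flow_summable t0; have sj := (sv j t).1.
have : `|\int[lam]_x limit_flow t x - \int[lam]_x v j t x| <= 6 * geo j.
  rewrite -RintB// (le_trans (Rint_norm (summableB ss sj)))//.
  apply: le_trans d; rewrite le_eqVlt; apply/orP; left; apply/eqP.
  by apply: eq_Rint => x; rewrite distrC.
have := ler_distD (\int[lam]_x v j t x) (\int[lam]_x limit_flow t x) m.
have := vm j.
lra.
Qed.

(** Fatou's lemma: a convex functional that decreases along the approximations,
    up to the error made on the data, decreases along the limit. *)
Lemma limit_flow_functional t (f : R -> R) (c B : R) : 0 <= t ->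
  measurable_fun setT f -> (forall a, 0 <= f a) ->
  (forall a b, `|a| <= M -> `|b| <= M -> `|f a - f b| <= B * `|a - b|) ->
  f 0 = 0 -> 0 <= B ->
  (forall j, \int[lam]_x f (v j t x) <= c + B * geo j) ->
  summable_fun lam (f \o limit_flow t) /\ \int[lam]_x f (limit_flow t x) <= c.
Proof.
move=> t0 mf f0 fB fz B0 fc.
have z0 : `|0 : R| <= M by rewrite normr0.
have sf j : summable_fun lam (fun x => f (v j t x)).
  apply: (summable_le (g := fun x : V => B * `|v j t x|)).
  - by apply: measurableT_comp => //; exact: (summable_measurable (sv j t).1).
  - by move=> x; have := fB _ _ ((sv j t).2 x) z0; rewrite fz !subr0.
  - by apply: summableZ; apply: summable_norm; exact: (sv j t).1.
have H (e : R) : 0 < e -> summable_fun lam (f \o limit_flow t) /\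
    \int[lam]_x f (limit_flow t x) <= c + e.
  move=> e0; have [j0 Hj] := geo_small B e0.
  apply: (@Rint_fatou _ _ R lam (fun j x => f (v j t x)) (f \o limit_flow t) (c + e) j0).
  - exact: sf.
  - by move=> j x; exact: f0.
  - by apply: measurableT_comp => //; exact: measurable_limit_flow_slice.
  - by move=> x; exact: f0.
  - apply: filterS (limit_flow_ae t0) => x vx; apply/cvgrPdist_le => r r0.
    have r1 : 0 < r / (B + 1) by rewrite divr_gt0// ltr_wpDl.
    have /cvgrPdist_le/(_ _ r1) := vx; apply: filterS => j hj.
    apply: (le_trans (fB _ _ (limit_flow_bounded t x) ((sv j t).2 x))).
    apply: (@le_trans _ _ ((B + 1) * (r / (B + 1)))).
      by apply: ler_pM => //; rewrite lerDl.
    by rewrite mulrC divfK// gt_eqF// ltr_wpDl.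
  - by move=> j jj0; apply: (le_trans (fc j)); rewrite lerD2l; exact: Hj.
split; first by have [] := H 1 ltr01.
by apply/ler_addgt0Pr => e e0; have [] := H e e0.
Qed.

End limit_flow.

(** * Test functions *)

Section directional_mean_value.
Context {R : realType} {W : normedModType R}.
Variables (f : W -> R) (v : W).
Hypothesis df : forall p, derivable f p v.

Lemma is_derive_line (p : W) (s : R) :
  is_derive s 1 (fun r : R => f (p + r *: v)) ('D_v f (p + s *: v)).
Proof.
have E : (fun h : R => h^-1 *: (((fun r : R => f (p + r *: v)) \o shift s) (h *: 1)
    - f (p + s *: v))) =
  (fun h : R => h^-1 *: ((f \o shift (p + s *: v)) (h *: v) - f (p + s *: v))).
  apply/funext => h /=; congr (_ *: (f _ - _)).
  by rewrite scaler1 scalerDl addrCA.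
by split; [rewrite /derivable E; exact: df|rewrite /derive E].
Qed.

Lemma mean_value_line (p : W) (a b : R) : a < b -> exists2 c : R, a < c < b &
  f (p + b *: v) - f (p + a *: v) = 'D_v f (p + c *: v) * (b - a).
Proof.
move=> ab.
have [|c /[!in_itv]/= cab ->] := @MVT R (fun r : R => f (p + r *: v))
  (fun s => 'D_v f (p + s *: v)) a b ab (fun s _ => is_derive_line p s).
  by apply: derivable_within_continuous => s _; have [] := is_derive_line p s.
by exists c.
Qed.

Lemma lipschitz_line (C : R) (p : W) (a b : R) : (forall p, `|'D_v f p| <= C) ->
  `|f (p + b *: v) - f (p + a *: v)| <= C * `|b - a|.
Proof.
move=> dC; wlog ab : a b / a <= b.
  move=> H; have [/H//|/ltW/H] := leP a b.
  by rewrite distrC (distrC b).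
move: ab; rewrite le_eqVlt => /predU1P[->|ab].
  by rewrite !subrr !normr0 mulr0.
have [c _ ->] := mean_value_line p ab.
by rewrite normrM ler_wpM2r.
Qed.

End directional_mean_value.

Section test_functions.
Context {R : realType} {N : nat}.
Local Notation V := 'rV[R]_N.
Local Notation q := (@jump_weight R N).

(** What the weak formulation uses of a test function: dpsi is its derivative in
    time, the modulus of continuity in space compensates the singularity of the
    kernel uniformly in time, and the support lies in ]0, T[ x cube k. *)
Record tame_test (psi dpsi : R * V -> R) (C T : R) (k : nat) : Prop := {
  tame_continuous : continuous psi;
  tame_dcontinuous : continuous dpsi;
  tame_derive1 : forall t x, derive1 (fun s => psi (s, x)) t = dpsi (t, x);
  tame_mvt : forall (a b : R) x, a < b -> exists2 c : R, a < c < b &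
    psi (b, x) - psi (a, x) = dpsi (c, x) * (b - a);
  tame_bound_gt0 : 0 < C;
  tame_bound : forall p, `|psi p| <= C;
  tame_dbound : forall p, `|dpsi p| <= C;
  tame_jump : forall t x y, `|psi (t, x) - psi (t, y)| <= C * q (x - y);
  tame_time_gt0 : 0 < T;
  tame_support : forall t x, psi (t, x) != 0 -> [/\ 0 < t, t < T & cube k x]
}.

Lemma compact_support_bounded (f : R * V -> R) (K : set (R * V)) :
  continuous f -> compact K -> (forall p, ~ K p -> f p = 0) ->
  exists2 C : R, 0 <= C & forall p, `|f p| <= C.
Proof.
move=> cf cK f0.
have /compact_bounded[B [_ HB]] : compact (f @` K).
  by apply: continuous_compact => //; exact: continuous_subspaceT.
exists (`|B| + 1) => [|p]; first by rewrite addr_ge0.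
have [Kp|/f0 ->] := pselect (K p); last by rewrite normr0 addr_ge0.
by apply: HB; [rewrite ltr_pwDr// ler_norm|exists p].
Qed.

Variable psi : R * V -> R.
Hypothesis tpsi : test_function psi.

Let S := closure [set p | psi p != 0].

Lemma test_outside p : ~ S p -> psi p = 0.
Proof.
move=> Sp; apply/eqP; apply: contrapT => /negP pp.
by apply: Sp; exact: subset_closure.
Qed.

Lemma test_derive v : [/\ forall p, derivable psi p v, continuous ('D_v psi) &
  exists2 C : R, 0 <= C & forall p, `|'D_v psi p| <= C].
Proof.
have [Cpsi cS _] := tpsi; have [_ /(_ v)[dv [cv _]]] := Cpsi 1%N.
split => //; apply: (compact_support_bounded cv cS) => p Sp.
rewrite -[RHS](@derive_cst R (R * V)%type R 0 p v); apply: near_eq_derive.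
have : nbhs p (~` S) by apply: open_nbhs_nbhs; split => //; exact/closed_openC/closed_closure.
by apply: filterS => r Sr; rewrite test_outside.
Qed.

(** Coordinates are changed one at a time: only directional derivatives along
    the axes are available. *)
Lemma test_space_lipschitz : exists2 C : R, 0 <= C &
  forall t x y, `|psi (t, x) - psi (t, y)| <= C * `|x - y|.
Proof.
pose e (i : 'I_N) : R * V := (0, delta_mx 0 i).
have [|c Hc] := @boolp.choice _ _
    (fun i (c : R) => 0 <= c /\ forall p, `|'D_(e i) psi p| <= c).
  by move=> i; have [_ _ [C C0 HC]] := test_derive (e i); exists C.
exists (\sum_i c i) => [|t x y]; first by apply: sumr_ge0 => i _; have [] := Hc i.
pose z k : V := \row_i (if (i < k)%N then y 0 i else x 0 i).
have step k (kN : (k <= N)%N) :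
    `|psi (t, x) - psi (t, z k)| <= (\sum_(i < N | (i < k)%N) c i) * `|x - y|.
  elim: k kN => [|k IH] kN.
    have -> : z 0%N = x by apply/rowP => i; rewrite mxE.
    by rewrite subrr normr0 mulr_ge0// sumr_ge0// => i _; have [] := Hc i.
  pose K := Ordinal kN.
  rewrite (bigD1 K) //= (eq_bigl (fun i : 'I_N => (i < k)%N)); last first.
    by move=> i; rewrite ltnS -val_eqE/= [RHS]ltn_neqAle andbC.
  rewrite mulrDl [leRHS]addrC; apply: (le_trans (ler_distD (psi (t, z k)) _ _)).
  apply: lerD; first by apply: IH; exact: ltnW.
  have -> : (t, z k) = (t, z k) + 0 *: e K by rewrite scale0r addr0.
  have -> : (t, z k.+1) = (t, z k) + (y 0 K - x 0 K) *: e K.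
    congr pair; first by rewrite /= scaler0 addr0.
    apply/rowP => i; rewrite !mxE /= ltnS -val_eqE /=.
    have [ik|ik|ik] := ltngtP i k.
    - by rewrite /= mulr0 addr0.
    - by rewrite /= mulr0 addr0.
    - have -> : i = K by exact: val_inj.
      by rewrite /= mulr1 addrCA subrr addr0.
  have [dK _ _] := test_derive (e K); have [c0 HcK] := Hc K.
  apply: (le_trans (lipschitz_line dK _ _ _ HcK)).
  rewrite ler_wpM2l// sub0r opprB.
  by have := le_coord_norm (x - y) K; rewrite !mxE.
have -> : y = z N by apply/rowP => i; rewrite mxE ltn_ord.
have := step N (leqnn N); rewrite (eq_bigl xpredT) => [|i]; last by rewrite ltn_ord.
by have -> : y = z N by apply/rowP => i; rewrite mxE ltn_ord.
Qed.

Lemma test_tame : exists dpsi C T k, tame_test psi dpsi C T k.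
Proof.
have [Cpsi cS S0] := tpsi; have cpsi := (Cpsi 0%N).1.
have [dv cv [C1 C10 HC1]] := test_derive (1, 0).
have [C2 C20 HC2] := test_space_lipschitz.
have [C3 C30 HC3] := compact_support_bounded cpsi cS test_outside.
have /compact_bounded[B [_ HB]] := cS.
have B1 : B < `|B| + 1 by rewrite ltr_pwDr// ler_norm.
pose T := `|B| + 2; pose k := (Num.truncn T).+1.
have lineE t x : ((0, x) + t *: (1, 0) : R * V) = (t, x).
  by congr pair; rewrite /= ?scaler0 ?addr0// scaler1 add0r.
exists ('D_(1, 0) psi), (1 + C1 + C2 + 2 * C3), T, k; split => //.
- move=> t x; rewrite derive1E.
  have [_] := is_derive_line dv (0, x) t; rewrite lineE => <-.
  by congr ('D_1 _ t); apply/funext => s; rewrite lineE.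
- move=> a b x ab; have [c cab] := mean_value_line dv (0, x) ab.
  by rewrite !lineE => ?; exists c.
- lra.
- by move=> p; apply: (le_trans (HC3 p)); lra.
- by move=> p; apply: (le_trans (HC1 p)); lra.
- move=> t x y; rewrite /jump_weight /Num.min; case: ifPn => _.
    rewrite mulr1 (le_trans (ler_normB _ _))//.
    by have := HC3 (t, x); have := HC3 (t, y); lra.
  by apply: (le_trans (HC2 t x y)); rewrite ler_wpM2r//; lra.
- by rewrite /T ltr_wpDl.
- move=> t x p0; have Sp : S (t, x) by exact: subset_closure.
  have : `|(t, x) : R * V| <= `|B| + 1 := HB _ B1 _ Sp; rewrite prod_normE/= ge_max => /andP[tB xB].
  split; first exact: (S0 _ Sp).
    by apply: (le_lt_trans (ler_norm t)); rewrite /T; lra.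
  apply: cube_norm; apply: le_lt_trans xB _.
  by apply: lt_trans (truncnS_gt T); rewrite /T; lra.
Qed.

End test_functions.

(** * Passage to the limit in the weak formulation *)

Section step_integrals.
Context {R : realType}.
Local Notation leb := (@lebesgue_measure R).

Lemma truncn_step (t c : R) (k : nat) : 0 < c -> 0 <= t ->
  (k == Num.truncn (t / c)) = (k%:R * c <= t < k.+1%:R * c).
Proof.
move=> c0 t0; have tc : 0 <= t / c by rewrite divr_ge0// ltW.
by rewrite eq_sym truncn_eq// ler_pdivlMr// ltr_pdivrMr.
Qed.

Definition step_fun (g : nat -> R) (c : R) (t : R) : R :=
  if 0 <= t then g (Num.truncn (t / c)) else 0.

Lemma step_fun_sum (g : nat -> R) (c : R) (K : nat) : 0 < c ->
  (forall k, (K <= k)%N -> g k = 0) -> forall t, step_fun g c t =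
  \sum_(k < K) g k * \1_(`[k%:R * c, k.+1%:R * c[%classic) t.
Proof.
move=> c0 gK t; rewrite /step_fun; case: ifPn => t0; last first.
  rewrite big1// => k _; rewrite indicE memNset ?mulr0//= in_itv/=.
  move=> /andP[kt _]; move/negP: t0; apply; apply: le_trans kt.
  by rewrite mulr_ge0// ltW.
have E k : \1_(`[k%:R * c, k.+1%:R * c[%classic) t = (k == Num.truncn (t / c))%:R :> R.
  rewrite indicE truncn_step//; congr ((_ : bool)%:R).
  by apply/idP/idP; rewrite inE/= in_itv.
under eq_bigr do rewrite E.
set m := Num.truncn _; have [mK|Km] := ltnP m K.
  rewrite (bigD1 (Ordinal mK))//= eqxx mulr1 big1 ?addr0// => i.
  by rewrite -val_eqE/= => /negbTE ->; rewrite mulr0.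
rewrite gK// big1// => i _.
have /ltn_eqF -> : (i < m)%N by exact: leq_trans (ltn_ord i) Km.
by rewrite mulr0.
Qed.

Lemma summable_itv (a b : R) : a <= b ->
  summable_fun leb \1_(`[a, b[%classic) /\ \int[leb]_t \1_(`[a, b[%classic) t = b - a.
Proof.
move=> ab; have mI : measurable (`[a, b[%classic : set (measurableTypeR R)) by [].
have lI : leb `[a, b[%classic = (b - a)%:E.
  by rewrite lebesgue_measure_itv/= lte_fin; case: ltP => // ba; have /eqP -> : a == b;
    rewrite ?eq_le ?ab ?subrr.
split.
  apply: summable_le_lty => //.
  under eq_integral do rewrite ger0_norm//.
  rewrite integral_indic// setIT.
  by apply: le_lt_trans (ltry (b - a)); rewrite le_eqVlt; apply/orP; left; exact/eqP.
by rewrite /Rintegral integral_indic// setIT; exact: (f_equal fine lI).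
Qed.

Lemma step_fun_integral (g : nat -> R) (c : R) (K : nat) : 0 < c ->
  (forall k, (K <= k)%N -> g k = 0) ->
  measurable_fun [set: measurableTypeR R] (step_fun g c) /\
  \int[leb]_t step_fun g c t = \sum_(k < K) c * g k.
Proof.
move=> c0 gK.
have kc (k : nat) : k%:R * c <= k.+1%:R * c.
  by apply: ler_wpM2r; [exact: ltW|rewrite ler_nat].
have sI (k : 'I_K) : summable_fun leb (fun t => g k * \1_(`[k%:R * c, k.+1%:R * c[%classic) t).
  by apply: summableZ; have [] := summable_itv (kc k).
split.
  rewrite (funext (step_fun_sum c0 gK)).
  exact: (summable_measurable (summable_sum _ sI)).
have -> : \int[leb]_t step_fun g c t =
    \int[leb]_t (\sum_(k < K) g k * \1_(`[k%:R * c, k.+1%:R * c[%classic) t).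
  by apply: eq_Rint => t; exact: step_fun_sum.
rewrite Rint_sum//; apply: eq_bigr => k _.
have [s1 i1] := summable_itv (kc k).
by rewrite RintZ// i1 -mulrBl -natrB// subSnn mul1r mulrC.
Qed.

End step_integrals.

Section weak_pairing.
Context {R : realType} {N : nat}.
Local Notation V := 'rV[R]_N.
Local Notation lam := (@lebesgue_rV R N).
Local Notation lam2 := (lam \x lam)%E.
Local Notation q := (@jump_weight R N).
Variables (M : R) (kap : V -> R) (J : R -> R -> V -> R).
Hypothesis M0 : 0 <= M.
Hypothesis hJ : jump_profile M kap J.
Local Notation ck := (cut_kernel J).
Let mkap := profile_majorant_measurable hJ.
Let kap0 := profile_majorant_ge0 hJ.
Variables (C : R) (m : nat).
Hypothesis C0 : 0 <= C.

(** The slices at fixed times of a test function. *)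
Record space_test (phi : V -> R) : Prop := {
  space_measurable : measurable_fun setT phi;
  space_bound : forall x, `|phi x| <= C;
  space_jump : forall x y, `|phi x - phi y| <= C * q (x - y);
  space_support : forall x, phi x != 0 -> cube m x
}.

Local Notation Q := (\1_(@cube R N m) : V -> R).

(** Dominates, uniformly in time and in the regularisation, the product of a
    kernel bounded by kap and of a difference of values of a test function. *)
Definition envelope (p : V * V) : R := C *
  (Q p.1 * (q (p.1 - p.2) * kap (p.1 - p.2)) +
   Q p.2 * (q (p.1 - p.2) * kap (p.1 - p.2))).

Let qk0 (z : V) : 0 <= q z * kap z.
Proof. by rewrite mulr_ge0// jump_weight_ge0. Qed.

Let Q0 (x : V) : 0 <= Q x. Proof. by rewrite indicE. Qed.

Lemma summable_cube : summable_fun lam Q.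
Proof. exact: summable_box. Qed.

Lemma envelope_summable : summable_fun lam2 envelope.
Proof.
apply: summableZ; apply: summableD.
  by have [] := summable_conv summable_cube (profile_majorant_summable hJ) Q0 qk0.
by have [] := summable_conv_snd summable_cube (profile_majorant_summable hJ) Q0 qk0.
Qed.

Lemma space_test_jump phi x y (k : R) : space_test phi -> 0 <= k -> k <= kap (x - y) ->
  `|(phi x - phi y) * k| <= envelope (x, y).
Proof.
move=> tp k0 kk; rewrite normrM (ger0_norm k0) /envelope/=.
have QQ : phi x - phi y != 0 -> 1 <= Q x + Q y.
  move=> pxy; have [px|px] := eqVneq (phi x) 0.
    have [py|py] := eqVneq (phi y) 0; first by rewrite px py subrr eqxx in pxy.
    by rewrite [Q y]indicE (mem_set (space_support tp py)) lerDr.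
  by rewrite [Q x]indicE (mem_set (space_support tp px)) lerDl.
rewrite -mulrDl mulrCA.
have [->|pxy] := eqVneq (phi x - phi y) 0.
  by rewrite normr0 mul0r mulr_ge0 ?addr_ge0// mulr_ge0.
apply: (@le_trans _ _ (1 * (C * (q (x - y) * kap (x - y))))); last first.
  by apply: ler_wpM2r; [exact: mulr_ge0|exact: QQ].
rewrite mul1r mulrA; apply: ler_pM => //; exact: space_jump.
Qed.

Lemma exchange_envelope (k : R -> R -> V -> R) (v phi : V -> R) p :
  (forall x, `|v x| <= M) -> space_test phi ->
  0 <= k (v p.1) (v p.2) (p.1 - p.2) <= kap (p.1 - p.2) ->
  `|exchange k id v p * (phi p.1 - phi p.2)| <= 2 * M * envelope p.
Proof.
move=> vM tp /andP[k0 kk]; rewrite /exchange -mulrA normrM.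
apply: ler_pM => //.
  apply: (le_trans (ler_normB _ _)).
  by have := vM p.1; have := vM p.2; lra.
by rewrite mulrC; case: p k0 kk => x y /=; exact: space_test_jump.
Qed.

(** The nonlocal operator tested against phi, in the symmetrised form, where the
    difference of the values of phi tames the singularity for any bounded v. *)
Definition pairing (k : R -> R -> V -> R) (v phi : V -> R) : R :=
  2^-1 * \int[lam2]_p (exchange k id v p * (phi p.1 - phi p.2)).

Lemma measurable_profile_exchange (v : V -> R) : measurable_fun setT v ->
  measurable_fun setT (exchange J id v).
Proof.
move=> mv; apply: measurable_funM.
  apply: measurable_funB; [exact: measurable_on_fst|exact: measurable_on_snd].
apply: (measurable_kernel_along (profile_measurable hJ)); [exact: measurable_on_fst|exact: measurable_on_snd|].
exact: measurable_disp.
Qed.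

Lemma measurable_test_difference (phi : V -> R) : measurable_fun setT phi ->
  measurable_fun setT (fun p : V * V => phi p.1 - phi p.2).
Proof.
by move=> mp; apply: measurable_funB; [exact: measurable_on_fst|exact: measurable_on_snd].
Qed.

(** Away from z = 0 the regularisation disappears in the limit and J is
    continuous; at z = 0 the difference of the test function vanishes. *)
Lemma cut_kernel_cvg (n_ : nat -> nat) (a_ b_ : nat -> R) (a b : R) (z : V) :
  (forall j, (j <= n_ j)%N) -> (forall j, `|a_ j| <= M) -> (forall j, `|b_ j| <= M) ->
  a_ j @[j --> \oo] --> a -> b_ j @[j --> \oo] --> b -> z != 0 ->
  (a_ j - b_ j) * ck (n_ j) (a_ j) (b_ j) z @[j --> \oo] --> (a - b) * J a b z.
Proof.
move=> nj aM bM aa bb z0.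
have full : (a_ j - b_ j) * J (a_ j) (b_ j) z @[j --> \oo] --> (a - b) * J a b z.
  apply: cvgM; first exact: cvgB.
  exact: (cvg_along_pair (@profile_continuous _ _ _ _ _ hJ z) aa bb).
have gap : (a_ j - b_ j) * J (a_ j) (b_ j) z -
    (a_ j - b_ j) * ck (n_ j) (a_ j) (b_ j) z @[j --> \oo] --> (0 : R).
  apply/cvgrPdist_le => e e0.
  have nz : 0 < `|z| by rewrite normr_gt0.
  have ez : 0 < e / (kap z + 1) by rewrite divr_gt0// ltr_wpDl.
  have lz : 0 < Num.min `|z| (e / (kap z + 1)) by rewrite lt_min nz.
  apply: filterS (cvgr_lt 0 level_cvg0 _ lz) => j; rewrite lt_min => /andP[jz je].
  have lj : level (n_ j) <= level j :> R by exact: level_homo.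
  rewrite sub0r normrN; apply: (le_trans (cut_kernel_defect hJ (n_ j) z (aM j) (bM j))).
  rewrite /defect /far (le_lt_trans lj jz) subrr mul0r add0r.
  apply: (@le_trans _ _ (e / (kap z + 1) * (kap z + 1))).
    apply: ler_pM; [|exact: kap0| |by rewrite lerDl].
      by rewrite le_min normr_ge0 andbT ltW// level_gt0.
    by rewrite ge_min (le_trans lj (ltW je)).
  by rewrite divfK// gt_eqF// ltr_wpDl.
have := cvgB full gap; rewrite subr0 => H.
rewrite (_ : (fun j => _) = (fun j => (a_ j - b_ j) * J (a_ j) (b_ j) z) -
    (fun j => (a_ j - b_ j) * J (a_ j) (b_ j) z -
      (a_ j - b_ j) * ck (n_ j) (a_ j) (b_ j) z)); first exact: H.
by apply/funext => j /=; rewrite !fctE opprB addrC subrK.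
Qed.

Variables (L : nat -> R).
Hypothesis hL : forall n, step_kernel M (fun z => L n * (kap z * far n z)) (ck n).

Lemma pairing_cvg (n_ : nat -> nat) (v_ : nat -> V -> R) (v : V -> R)
    (phi_ : nat -> V -> R) (phi : V -> R) : (forall j, (j <= n_ j)%N) ->
  (forall j, measurable_fun setT (v_ j)) -> (forall j x, `|v_ j x| <= M) ->
  measurable_fun setT v ->
  {ae lam, forall x, v_ j x @[j --> \oo] --> v x} ->
  (forall j, space_test (phi_ j)) -> space_test phi ->
  (forall x, phi_ j x @[j --> \oo] --> phi x) ->
  pairing (ck (n_ j)) (v_ j) (phi_ j) @[j --> \oo] --> pairing J v phi.
Proof.
move=> nj mv_ vM mv vv tp_ tp pp; rewrite /pairing; apply: cvgM; first exact: cvg_cst.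
apply: (@Rint_cvg _ _ R lam2 _ _ (fun p : V * V => 2 * M * envelope p) _ _ _ _ _).2.
- move=> j; apply: measurable_funM.
    by apply: (measurable_exchange (hL _)) => //; exact: measurable_idR.
  exact: (measurable_test_difference (space_measurable (tp_ j))).
- apply: measurable_funM; first exact: measurable_profile_exchange.
  exact: (measurable_test_difference (space_measurable tp)).
- apply: filterS2 (ae_fst lam vv) (ae_snd lam vv) => -[x y] /= vx vy.
  have [xy|xy] := eqVneq x y.
    rewrite xy !subrr mulr0; under eq_fun do rewrite subrr mulr0.
    exact: cvg_cst.
  apply: cvgM; last by apply: cvgB.
  by apply: cut_kernel_cvg => //; rewrite subr_eq0.
- by apply: summableZ; exact: envelope_summable.
- move=> j p; apply: exchange_envelope => //.
  by rewrite (cut_kernel_ge0 hJ)/= (cut_kernel_le hJ).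
Qed.

Lemma pairing_bounded n (v phi : V -> R) : measurable_fun setT v ->
  (forall x, `|v x| <= M) -> space_test phi ->
  `|pairing (ck n) v phi| <= M * \int[lam2]_p envelope p.
Proof.
move=> mv vM tp; have es := envelope_summable.
have le p : `|exchange (ck n) id v p * (phi p.1 - phi p.2)| <= 2 * M * envelope p.
  by apply: exchange_envelope => //; rewrite (cut_kernel_ge0 hJ)/= (cut_kernel_le hJ).
have s : summable_fun lam2 (fun p => exchange (ck n) id v p * (phi p.1 - phi p.2)).
  apply: (summable_le (g := fun p : V * V => 2 * M * envelope p)) => //.
    apply: measurable_funM.
      by apply: (measurable_exchange (hL _)) => //; exact: measurable_idR.
    exact: (measurable_test_difference (space_measurable tp)).
  exact: summableZ.
have := le_trans (Rint_norm s) (Rint_le (summable_norm s) (summableZ (2 * M) es) le).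
have h2 : `|2^-1 : R| = 2^-1 by rewrite ger0_norm// invr_ge0.
rewrite RintZ// /pairing normrM h2 => H.
apply: (le_trans (ler_wpM2l _ H)); first by rewrite invr_ge0.
by rewrite -[2 * M * _]mulrA mulKf.
Qed.

End weak_pairing.

Section weak_limit.
Context {R : realType} {N : nat}.
Local Notation V := 'rV[R]_N.
Local Notation leb := (@lebesgue_measure R).
Local Notation lam := (@lebesgue_rV R N).
Local Notation lam2 := (lam \x lam)%E.
Local Notation q := (@jump_weight R N).
Variables (M : R) (kap : V -> R) (J : R -> R -> V -> R).
Hypothesis M0 : 0 <= M.
Hypothesis hJ : jump_profile M kap J.
Local Notation ck := (cut_kernel J).
Variables (L h : nat -> R).
Hypothesis L1 : forall n, 1 <= L n.
Hypothesis hL : forall n, step_kernel M (fun z => L n * (kap z * far n z)) (ck n).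
Hypothesis h0 : forall n, 0 < h n.
Hypothesis hW : forall n,
  h n * (1 + \int[lam]_z (L n * (kap z * far n z))) <= @level R n.
Variables (psi dpsi : R * V -> R) (C T : R) (m : nat).
Hypothesis tpsi : tame_test psi dpsi C T m.
Local Notation Q := (\1_(@cube R N m) : V -> R).
Let C0 : 0 <= C := ltW (tame_bound_gt0 tpsi).

Lemma tame_slice t : space_test C m (fun x => psi (t, x)).
Proof.
split=> [|x|x y|x].
- exact: (measurable_slice t (continuous_measurable_prod (tame_continuous tpsi))).
- exact: (tame_bound tpsi).
- exact: (tame_jump tpsi).
- by case/(tame_support tpsi).
Qed.

Lemma summable_mul_bounded (u phi : V -> R) (B : R) : summable_fun lam u ->
  measurable_fun setT phi -> (forall x, `|phi x| <= B) ->
  summable_fun lam (fun x => u x * phi x).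
Proof.
move=> su mphi pB; apply: (summable_le (g := fun x : V => B * `|u x|)).
- by apply: measurable_funM => //; exact: summable_measurable su.
- by move=> x; rewrite normrM mulrC ler_wpM2r.
- by apply: summableZ; exact: summable_norm.
Qed.

Lemma step_le_level n : h n <= level n.
Proof.
apply: le_trans (hW n); rewrite ler_peMr ?(ltW (h0 n))// lerDl.
exact: (W_ge0 hJ L1).
Qed.

(** ** The discrete identity *)

(** The weak formulation on one time step, divided by its length. *)
Definition weak_increment n (u : V -> R) (k : nat) : R :=
  \int[lam]_x (scheme J h n k u x *
    ((psi (k.+1%:R * h n, x) - psi (k%:R * h n, x)) / h n)) -
  pairing (ck n) (scheme J h n k u) (fun x => psi (k.+1%:R * h n, x)).

(** Summation by parts in time: the test function is taken at the new time in
    the nonlocal term. *)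
Lemma weak_increment_telescope n u k : state M u ->
  h n * weak_increment n u k =
  \int[lam]_x (scheme J h n k.+1 u x * psi (k.+1%:R * h n, x)) -
  \int[lam]_x (scheme J h n k u x * psi (k%:R * h n, x)).
Proof.
move=> su; have sk := scheme_state M0 hL h0 hW n k su.
set U := scheme J h n k u in sk *.
have -> : scheme J h n k.+1 u = euler (ck n) (h n) U by [].
rewrite /weak_increment -/U.
set p1 := fun x => psi (k.+1%:R * h n, x); set p0 := fun x => psi (k%:R * h n, x).
have t1 : space_test C m p1 := tame_slice _.
have t0 : space_test C m p0 := tame_slice _.
have s1 := summable_mul_bounded sk.1 (space_measurable t1) (space_bound t1).
have s0 := summable_mul_bounded sk.1 (space_measurable t0) (space_bound t0).
have sA := summable_mul_bounded (nonlocal_summable (hL n) M0 sk)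
  (space_measurable t1) (space_bound t1).
have := nonlocal_test (hL n) M0 sk (space_measurable t1) (space_bound t1).
rewrite -/(pairing _ _ _) => <-.
have -> : \int[lam]_x (U x * ((p1 x - p0 x) / h n)) =
    (h n)^-1 * (\int[lam]_x (U x * p1 x) - \int[lam]_x (U x * p0 x)).
  rewrite -RintB// -RintZ; last exact: summableB.
  by apply: eq_Rint => x; ring.
have -> : \int[lam]_x (euler (ck n) (h n) U x * p1 x) =
    \int[lam]_x (U x * p1 x) - h n * \int[lam]_x (p1 x * nonlocal (ck n) U x).
  have -> : \int[lam]_x (p1 x * nonlocal (ck n) U x) =
    \int[lam]_x (nonlocal (ck n) U x * p1 x) by apply: eq_Rint => x; rewrite mulrC.
  rewrite -RintZ// -RintB//; last exact: summableZ.
  by apply: eq_Rint => x; rewrite /euler mulrBl mulrA.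
by rewrite mulrBr mulVKf ?gt_eqF//; ring.
Qed.

Lemma tame_late t x : T <= t -> psi (t, x) = 0.
Proof.
move=> Tt; apply/eqP; apply: contrapT => /negP/(tame_support tpsi)[_ tT _].
by move: Tt; rewrite leNgt tT.
Qed.

Lemma tame_early t x : t <= 0 -> psi (t, x) = 0.
Proof.
move=> Tt; apply/eqP; apply: contrapT => /negP/(tame_support tpsi)[tT _ _].
by move: Tt; rewrite leNgt tT.
Qed.

Lemma pairing_zero k (v phi : V -> R) : (forall x, phi x = 0) -> pairing k v phi = 0.
Proof.
move=> p0; rewrite /pairing Rint_eq0 ?mulr0// => p.
by rewrite !p0 subrr mulr0.
Qed.

Lemma weak_increment_late n u k : T <= k%:R * h n -> weak_increment n u k = 0.
Proof.
move=> Tk; have Tk1 : T <= k.+1%:R * h n.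
  by apply: (le_trans Tk); apply: ler_wpM2r; [exact: ltW|rewrite ler_nat].
rewrite /weak_increment pairing_zero => [|x]; last exact: tame_late.
rewrite Rint_eq0 ?subrr// => x.
by rewrite !tame_late// subrr mul0r mulr0.
Qed.

Lemma weak_increment_sum n u K : state M u -> T <= K%:R * h n ->
  \sum_(k < K) h n * weak_increment n u k = 0.
Proof.
move=> su TK; pose F k := \int[lam]_x (scheme J h n k u x * psi (k%:R * h n, x)).
have S k : \sum_(i < k) h n * weak_increment n u i = F k - F 0%N.
  elim: k => [|k IH]; first by rewrite big_ord0 subrr.
  by rewrite big_ord_recr/= IH weak_increment_telescope// /F; ring.
have Fz k : (forall x, psi (k%:R * h n, x) = 0) -> F k = 0.
  by move=> p0; apply: Rint_eq0 => x; rewrite p0 mulr0.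
rewrite S !Fz ?subrr// => x; first by rewrite mul0r tame_early.
exact: tame_late.
Qed.

(** ** The limit in time *)

Section approximations.
Variables (nu : nat -> nat) (w : nat -> V -> R) (u : R -> V -> R).
Hypothesis nuj : forall j, (j <= nu j)%N.
Hypothesis sw : forall j, state M (w j).
Hypothesis mu : forall t, measurable_fun setT (u t).
Hypothesis uM : forall t x, `|u t x| <= M.
Hypothesis u_ae : forall t, 0 <= t ->
  {ae lam, forall x, flow J h (nu j) t (w j) x @[j --> \oo] --> u t x}.

(** The weak formulation at time t, after integration in space. *)
Definition weak_density (t : R) : R :=
  \int[lam]_x (u t x * dpsi (t, x)) - pairing J (u t) (fun x => psi (t, x)).

Let g j := weak_increment (nu j) (w j).
Let eta j := h (nu j).

Let eta_level j : eta j <= level j.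
Proof. by apply: (le_trans (step_le_level _)); exact: level_homo. Qed.

Let eta_small (d : R) : 0 < d -> \forall j \near \oo, eta j < d.
Proof.
move=> d0; apply: filterS (cvgr_lt 0 level_cvg0 _ d0) => j.
exact: le_lt_trans (eta_level j).
Qed.

Lemma tame_dlate t x : T < t -> dpsi (t, x) = 0.
Proof.
move=> Tt; rewrite -(tame_derive1 tpsi) derive1E.
rewrite -[RHS](@derive_cst R R R 0 t 1); apply: near_eq_derive.
have : nbhs t [set s | T < s] by exact: lt_nbhsr.
by apply: filterS => s /ltW Ts; rewrite tame_late.
Qed.

Lemma tame_dspace t x : ~ cube m x -> dpsi (t, x) = 0.
Proof.
move=> mx; rewrite -(tame_derive1 tpsi) derive1E.
rewrite (_ : (fun s => psi (s, x)) = cst 0) ?derive_cst//; apply/funext => s /=.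
by apply/eqP; apply: contrapT => /negP/(tame_support tpsi)[].
Qed.

Lemma tame_time_lipschitz (a b : R) x : a <= b -> `|psi (b, x) - psi (a, x)| <= C * (b - a).
Proof.
rewrite le_eqVlt => /predU1P[->|ab]; first by rewrite !subrr normr0 mulr0.
have [c _ ->] := tame_mvt tpsi x ab; rewrite normrM (gtr0_norm (_ : 0 < b - a)) ?subr_gt0//.
by rewrite ler_wpM2r ?subr_ge0 ?(ltW ab)//; exact: tame_dbound tpsi _.
Qed.

Lemma difference_quotient_le n k x :
  `|(psi (k.+1%:R * h n, x) - psi (k%:R * h n, x)) / h n| <= C * Q x.
Proof.
have [mx|mx] := pselect (cube m x).
  rewrite indicE mem_set// mulr1 normrM normfV (gtr0_norm (h0 n)) ler_pdivrMr//.
  have -> : C * h n = C * (k.+1%:R * h n - k%:R * h n).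
    by rewrite -mulrBl -natrB// subSnn mul1r.
  apply: tame_time_lipschitz; apply: ler_wpM2r; [exact: ltW|by rewrite ler_nat].
have p0 t : psi (t, x) = 0.
  by apply/eqP; apply: contrapT => /negP/(tame_support tpsi)[].
by rewrite !p0 subrr mul0r normr0 mulr_ge0.
Qed.

Lemma measurable_quotient (a b c : R) :
  measurable_fun [set: V] (fun x => (psi (b, x) - psi (a, x)) / c).
Proof.
apply: measurable_funM => //.
by apply: measurable_funB; exact: space_measurable (tame_slice _).
Qed.

Let step_interval j t : 0 <= t ->
  (Num.truncn (t / eta j))%:R * eta j <= t < (Num.truncn (t / eta j)).+1%:R * eta j.
Proof. by move=> t0; rewrite -truncn_step//; exact: h0. Qed.

Let next_cvg t x : 0 <= t ->
  psi ((Num.truncn (t / eta j)).+1%:R * eta j, x) @[j --> \oo] --> psi (t, x).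
Proof.
move=> t0; apply/cvgrPdist_le => e e0.
have := eta_small (divr_gt0 e0 (tame_bound_gt0 tpsi)); apply: filterS => j je.
have /andP[a b] := step_interval j t0.
rewrite distrC; apply: (le_trans (tame_time_lipschitz _ (ltW b))).
rewrite mulrC -ler_pdivlMr ?(tame_bound_gt0 tpsi)//; apply: le_trans (ltW je).
rewrite -natr1 mulrDl mul1r; lra.
Qed.

Let quotient_cvg t x : 0 <= t ->
  (psi ((Num.truncn (t / eta j)).+1%:R * eta j, x) -
   psi ((Num.truncn (t / eta j))%:R * eta j, x)) / eta j @[j --> \oo] --> dpsi (t, x).
Proof.
move=> t0.
have cd : dpsi (s, x) @[s --> t] --> dpsi (t, x).
  apply: (@cvg_comp _ _ _ (fun s : R => (s, x)) dpsi _ (nbhs (t, x))).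
    exact: (cvg_pair (@cvg_id _ (nbhs t)) (cvg_cst x)).
  exact: (tame_dcontinuous tpsi).
apply/cvgrPdist_le => e e0.
have /cvgrPdist_le/(_ e e0) := cd => /nbhs_ballP[d /= d0 Hd].
apply: filterS (eta_small d0) => j jd.
have /andP[a b] := step_interval j t0; set k := Num.truncn _ in a b *.
have E : k.+1%:R * eta j - k%:R * eta j = eta j.
  by rewrite -mulrBl -natrB// subSnn mul1r.
have [c /andP[ac cb] ->] := tame_mvt tpsi x (le_lt_trans a b).
rewrite E mulfK ?gt_eqF//; last exact: h0.
apply: Hd; rewrite /ball/= ltr_norml; apply/andP; split; lra.
Qed.

Let weak_increment_bounded j k :
  `|g j k| <= M * C * \int[lam]_x Q x + M * \int[lam2]_p envelope kap C m p.
Proof.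
have sk := scheme_state M0 hL h0 hW (nu j) k (sw j).
apply: (le_trans (ler_normB _ _)); apply: lerD; last first.
  exact: (pairing_bounded hJ C0 hL (nu j) (summable_measurable sk.1) sk.2 (tame_slice _)).
have sQ : summable_fun lam Q := summable_cube m.
pose dq x := (psi (k.+1%:R * h (nu j), x) - psi (k%:R * h (nu j), x)) / h (nu j).
have le x : `|scheme J h (nu j) k (w j) x * dq x| <= M * C * Q x.
  rewrite normrM -mulrA; apply: ler_pM => //; first exact: sk.2.
  exact: difference_quotient_le.
have s : summable_fun lam (fun x => scheme J h (nu j) k (w j) x * dq x).
  apply: (summable_le (g := fun x : V => M * C * Q x)) => //; last exact: summableZ.
  apply: measurable_funM; first exact: summable_measurable sk.1.
  exact: measurable_quotient.
rewrite -RintZ//; apply: (le_trans (Rint_norm s)).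
by apply: Rint_le => //; [exact: summable_norm|exact: summableZ].
Qed.

Let measurable_dslice t : measurable_fun [set: V] (fun x => dpsi (t, x)).
Proof.
exact: (measurable_slice t (continuous_measurable_prod (tame_dcontinuous tpsi))).
Qed.

Let weak_increment_cvg t : 0 <= t ->
  g j (Num.truncn (t / eta j)) @[j --> \oo] --> weak_density t.
Proof.
move=> t0; apply: cvgB; last first.
  apply: (pairing_cvg hJ C0 hL nuj _ _ _ (u_ae t0)) => //.
  - by move=> j; exact: summable_measurable (flow_state M0 hL h0 hW _ t (sw j)).1.
  - by move=> j; exact: (flow_state M0 hL h0 hW _ t (sw j)).2.
  - by move=> j; exact: tame_slice.
  - exact: tame_slice.
  - by move=> x; exact: next_cvg.
apply: (@Rint_cvg _ _ R lam _ _ (fun x : V => M * C * Q x) _ _ _ _ _).2.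
- move=> j; apply: measurable_funM; last exact: measurable_quotient.
  exact: summable_measurable (flow_state M0 hL h0 hW _ t (sw j)).1.
- by apply: measurable_funM.
- apply: filterS (u_ae t0) => x ux.
  by apply: cvgM; [exact: ux|exact: quotient_cvg].
- by apply: summableZ; exact: summable_cube.
- move=> j x; rewrite normrM -mulrA; apply: ler_pM => //.
    exact: (flow_state M0 hL h0 hW _ t (sw j)).2.
  exact: difference_quotient_le.
Qed.

(** The discrete densities are step functions of time with integral zero, they
    vanish after T + 1, are uniformly bounded, and converge at each time: two
    uses of dominated convergence, in space and in time. *)
Lemma weak_density_integral :
  summable_fun leb (fun t => if 0 <= t then weak_density t else 0) /\
  \int[leb]_t (if 0 <= t then weak_density t else 0) = 0.
Proof.
pose B := M * C * \int[lam]_x Q x + M * \int[lam2]_p envelope kap C m p.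
pose f j := step_fun (g j) (eta j).
pose f_lim t := if 0 <= t then weak_density t else 0.
have K j : {K : nat | T <= K%:R * eta j}.
  exists (Num.truncn (T / eta j)).+1; rewrite -ler_pdivrMr; last exact: h0.
  exact: ltW (truncnS_gt _).
have late j k : (sval (K j) <= k)%N -> g j k = 0.
  move=> Kk; apply: weak_increment_late; apply: (le_trans (svalP (K j))).
  by apply: ler_wpM2r; [exact: ltW (h0 (nu j))|rewrite ler_nat].
have F j := step_fun_integral (h0 (nu j)) (late j).
have fc t : f j t @[j --> \oo] --> f_lim t.
  rewrite /f /f_lim /step_fun; case: ifPn => t0; [exact: weak_increment_cvg|exact: cvg_cst].
have mlim : measurable_fun [set: measurableTypeR R] f_lim.
  apply/measurable_EFinP.
  apply: (@emeasurable_fun_cvg _ (measurableTypeR R) R setT (fun j t => (f j t)%:E)).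
    by move=> j; apply/measurable_EFinP; exact: (F j).1.
  by move=> t _; apply: cvg_EFin; [exact: nearW|exact: fc].
have [sl c] : summable_fun leb f_lim /\ \int[leb]_t f j t @[j --> \oo] --> \int[leb]_t f_lim t.
  apply: (@Rint_cvg _ (measurableTypeR R) R leb f f_lim
    (fun t => B * \1_(`[0, T + 1[%classic) t)) => //.
  - by move=> j; exact: (F j).1.
  - exact: aeW.
  - apply: summableZ; have [] // := @summable_itv R 0 (T + 1) _.
    by rewrite addr_ge0// ltW// (tame_time_gt0 tpsi).
  move=> j t; rewrite /f /step_fun.
  have B0 : 0 <= B by apply: le_trans (weak_increment_bounded 0 0).
  case: ifPn => t0; last by rewrite normr0 mulr_ge0.
  have [tT|Tt] := ltP t (T + 1).
    rewrite indicE mem_set ?mulr1; first exact: weak_increment_bounded.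
    by rewrite /= in_itv/= t0 tT.
  rewrite {1}/g weak_increment_late ?normr0 ?mulr_ge0//.
  have /andP[_ b] := step_interval j t0.
  have : eta j <= 1 by apply: (le_trans (eta_level j)); exact: level_le1.
  by move: b; rewrite -/(eta j) -natr1 mulrDl mul1r; lra.
have z j : \int[leb]_t f j t = 0.
  by rewrite (F j).2; apply: weak_increment_sum => //; exact: (svalP (K j)).
have c0 : \int[leb]_t f j t @[j --> \oo] --> (0 : R).
  by under eq_fun do rewrite z; exact: cvg_cst.
by split; [exact: sl|rewrite -(cvg_lim (@Rhausdorff R) c) (cvg_lim (@Rhausdorff R) c0)].
Qed.

End approximations.

End weak_limit.

(** * From the symmetrised form to the weak formulation *)

Section weak_formulation.
Context {R : realType} {N : nat}.
Local Notation V := 'rV[R]_N.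
Local Notation leb := (@lebesgue_measure R).
Local Notation lam := (@lebesgue_rV R N).
Local Notation lam2 := (lam \x lam)%E.
Local Notation q := (@jump_weight R N).
Variables (rho : R -> R -> V -> V -> R).
Hypothesis hrho : homogeneous_jump_kernel rho.
Variables (M : R) (kap : V -> R) (J : R -> R -> V -> R).
Hypothesis M0 : 0 <= M.
Hypothesis hJ : jump_profile M kap J.
Hypothesis rhoJ : {ae lam2, forall p, forall a b, rho a b p.1 p.2 = J a b (p.1 - p.2)}.
Variables (psi dpsi : R * V -> R) (C T : R) (m : nat).
Hypothesis tpsi : tame_test psi dpsi C T m.
Local Notation Q := (\1_(@cube R N m) : V -> R).
Variable u : R -> V -> R.
Hypothesis mu2 : measurable_fun setT (fun p : measurableTypeR R * V => u p.1 p.2).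
Hypothesis uM : forall t x, `|u t x| <= M.
Let C0 : 0 <= C := ltW (tame_bound_gt0 tpsi).
Let kap0 := profile_majorant_ge0 hJ.

Let mu t : measurable_fun setT (u t).
Proof. exact: (measurable_slice t mu2). Qed.

(** The points at which the given kernel may be replaced by its profile, for all
    values of the solution at once. *)
Definition faithful_at (x : V) : Prop :=
  {ae lam, forall y, forall a b, rho a b x y = J a b (x - y)}.

Lemma faithful_ae : {ae lam, forall x, faithful_at x}.
Proof. exact: (ae_slices rhoJ). Qed.

Lemma measurable_rho_along d (X : measurableType d) (a b : X -> R) (x y : X -> V) :
  measurable_fun setT a -> measurable_fun setT b ->
  measurable_fun setT x -> measurable_fun setT y ->
  measurable_fun setT (fun s => rho (a s) (b s) (x s) (y s)).
Proof.
move=> ma mb mx my.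
have mt : measurable_fun setT (fun s => ((a s, b s), (x s, y s))).
  by apply: measurable_fun_pair; exact: measurable_fun_pair.
exact: (measurableT_comp (jump_kernel_measurable hrho) mt).
Qed.

Let mslice t : measurable_fun setT (fun y : V => psi (t, y)).
Proof. exact: space_measurable (tame_slice tpsi t). Qed.

Let jump t x y := (psi (t, x) - psi (t, y)) * J (u t x) (u t y) (x - y).

Let measurable_jump_slice t x : measurable_fun setT (jump t x).
Proof.
apply: measurable_funM; first exact: measurable_funB.
apply: (measurable_kernel_along (profile_measurable hJ)) => //.
by apply: measurable_subrV => //; exact: measurable_id.
Qed.

Let measurable_rho_slice t x :
  measurable_fun setT (fun y => (psi (t, x) - psi (t, y)) * rho (u t x) (u t y) x y).
Proof.
apply: measurable_funM; first exact: measurable_funB.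
by apply: measurable_rho_along.
Qed.

Let jump_le t x y : `|jump t x y| <= C * (q (x - y) * kap (x - y)).
Proof.
rewrite normrM (ger0_norm (profile_ge0 hJ _ _ _)) mulrA; apply: ler_pM => //.
- exact: (profile_ge0 hJ).
- exact: (tame_jump tpsi).
- by apply: (profile_le hJ); exact: uM.
Qed.

Let jump_envelope t x y : `|jump t x y| <= envelope kap C m (x, y).
Proof.
apply: (space_test_jump hJ C0 (tame_slice tpsi t)).
  exact: (profile_ge0 hJ).
by apply: (profile_le hJ); exact: uM.
Qed.

Let jump_summable t x : summable_fun lam (jump t x).
Proof.
apply: (summable_le (g := fun y : V => C * (q (x - y) * kap (x - y)))) => //.
apply: summableZ.
exact: (summable_reflect x (profile_majorant_summable hJ)).
Qed.

Let jump_rho t x : faithful_at x -> {ae lam, forall y, jump t x y =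
  (psi (t, x) - psi (t, y)) * rho (u t x) (u t y) x y}.
Proof. by apply: filterS => y rJ; rewrite rJ. Qed.

Lemma rho_slice_summable t x : faithful_at x ->
  summable_fun lam (fun y => (psi (t, x) - psi (t, y)) * rho (u t x) (u t y) x y).
Proof.
move=> fx; have mj := measurable_jump_slice t x.
exact: (summable_aeeq mj (measurable_rho_slice t x) (jump_rho t fx) (jump_summable t x)).
Qed.

Let operator t x : R := \int[lam]_y jump t x y.

Lemma nonlocal_op_profile t x : faithful_at x ->
  nonlocal_op rho (u t) (fun y => psi (t, y)) x = operator t x.
Proof.
move=> fx; apply/esym.
exact: (Rint_aeeq (measurable_jump_slice t x) (measurable_rho_slice t x) (jump_rho t fx)).
Qed.

Let measurable_jump t : measurable_fun setT (fun p : V * V => jump t p.1 p.2).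
Proof.
apply: measurable_funM; first exact: (measurable_test_difference (mslice t)).
apply: (measurable_kernel_along (profile_measurable hJ)).
- exact: (measurable_on_fst (mu t)).
- exact: (measurable_on_snd (mu t)).
- exact: measurable_disp.
Qed.

Let tested t (p : V * V) := u t p.1 * jump t p.1 p.2.

Let tested_le t p : `|tested t p| <= M * envelope kap C m p.
Proof. by case: p => x y; rewrite normrM; apply: ler_pM => //=. Qed.

Let tested_summable t : summable_fun lam2 (tested t).
Proof.
apply: (summable_le (g := fun p : V * V => M * envelope kap C m p)).
- by apply: measurable_funM; [exact: (measurable_on_fst (mu t))|exact: measurable_jump].
- exact: tested_le.
- by apply: summableZ; exact: (envelope_summable hJ).
Qed.

(** Symmetry of the kernel: half of the integral comes from each order of the
    two points. *)
Lemma pairing_operator t : summable_fun lam (fun x => u t x * operator t x) /\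
  \int[lam]_x (u t x * operator t x) = pairing J (u t) (fun x => psi (t, x)).
Proof.
have E x : u t x * operator t x = \int[lam]_y tested t (x, y) by rewrite -RintZ.
have [s e] := summable_Rint_param (tested_summable t).
split; first by under eq_fun do rewrite E.
rewrite (eq_Rint _ E) -e.
have s' := pair_swap_summable (tested_summable t).
have -> : \int[lam2]_p tested t p =
    2^-1 * (\int[lam2]_p tested t p + \int[lam2]_p tested t (p.2, p.1)).
  by rewrite (pair_swap_Rint (tested_summable t)); lra.
rewrite -RintD// /pairing; congr (_ * _); apply: eq_Rint => -[x y].
rewrite /tested /jump /exchange /= (profile_sym hJ (u t y)) opprB; ring.
Qed.

Let adj := adjoint_op rho u psi.

Lemma adjoint_profile t x : faithful_at x ->
  adj t x = dpsi (t, x) - operator t x.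
Proof.
by move=> fx; rewrite /adj /adjoint_op nonlocal_op_profile// (tame_derive1 tpsi).
Qed.

Let weighted (p : measurableTypeR R * V) : R := u p.1 p.2 * adj p.1 p.2.

Lemma measurable_adjoint : measurable_fun setT weighted.
Proof.
have mpsi := continuous_measurable_prod (tame_continuous tpsi).
apply: measurable_funM => //; apply: measurable_funB.
  rewrite (_ : (fun p => _) = dpsi) //; last first.
    by apply/funext => -[t x]; exact: (tame_derive1 tpsi).
  exact: (continuous_measurable_prod (tame_dcontinuous tpsi)).
have mt : measurable_fun setT (fun p : (measurableTypeR R * V) * V => p.1.1).
  exact: (measurableT_comp measurable_fst measurable_fst).
have mx : measurable_fun setT (fun p : (measurableTypeR R * V) * V => p.1.2).
  exact: (measurableT_comp measurable_snd measurable_fst).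
have my : measurable_fun setT (fun p : (measurableTypeR R * V) * V => p.2).
  exact: measurable_snd.
have comp (f : measurableTypeR R * V -> R) (z : (measurableTypeR R * V) * V -> V) :
    measurable_fun setT f -> measurable_fun setT z ->
    measurable_fun setT (fun p => f (p.1.1, z p)).
  move=> mf mz; apply: (measurableT_comp mf).
  exact: measurable_fun_pair.
apply: (@measurable_Rint_param _ _ (measurableTypeR R * V)%type V R lam
  (fun p => (psi (p.1.1, p.1.2) - psi (p.1.1, p.2)) *
     rho (u p.1.1 p.1.2) (u p.1.1 p.2) p.1.2 p.2)).
apply: measurable_funM.
  by apply: measurable_funB; [exact: comp|exact: comp].
apply: measurable_rho_along => //.
  exact: (comp (fun p => u p.1 p.2)).
exact: (comp (fun p => u p.1 p.2)).
Qed.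

Let measurable_dslice t : measurable_fun [set: V] (fun x => dpsi (t, x)).
Proof.
exact: (measurable_slice t (continuous_measurable_prod (tame_dcontinuous tpsi))).
Qed.

Let local_le t x : `|u t x * dpsi (t, x)| <= M * C * Q x.
Proof.
rewrite normrM -mulrA; apply: ler_pM => //.
have [mx|mx] := pselect (cube m x).
  by rewrite indicE mem_set// mulr1; exact: (tame_dbound tpsi).
by rewrite (tame_dspace tpsi)// normr0 mulr_ge0.
Qed.

Let local_summable t : summable_fun lam (fun x => u t x * dpsi (t, x)).
Proof.
apply: (summable_le (g := fun x : V => M * C * Q x)).
- exact: measurable_funM.
- exact: local_le.
- by apply: summableZ; exact: summable_cube.
Qed.

Let weighted_ae t : {ae lam, forall x,
  u t x * dpsi (t, x) - u t x * operator t x = weighted (t, x)}.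
Proof.
by apply: filterS faithful_ae => x fx; rewrite /weighted adjoint_profile// mulrBr.
Qed.

Lemma weighted_integral t : summable_fun lam (fun x => weighted (t, x)) /\
  \int[lam]_x weighted (t, x) = weak_density J psi dpsi u t.
Proof.
have [s e] := pairing_operator t; have sd := summableB (local_summable t) s.
have mw : measurable_fun setT (fun x => weighted (t, x)).
  exact: (measurable_slice t measurable_adjoint).
split.
  exact: summable_aeeq (summable_measurable sd) mw (weighted_ae t) sd.
rewrite -(Rint_aeeq (summable_measurable sd) mw (weighted_ae t)).
by rewrite RintB// e.
Qed.

Let mass := M * C * \int[lam]_x Q x + M * \int[lam2]_p envelope kap C m p.

Let weighted_norm t : \int[lam]_x `|weighted (t, x)| <= mass.
Proof.
have [sw _] := weighted_integral t; have [s e] := pairing_operator t.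
have sn := summable_norm (tested_summable t).
have [si ei] := summable_Rint_param sn.
have es := envelope_summable hJ C m.
have op x : `|u t x * operator t x| <= \int[lam]_y `|tested t (x, y)|.
  rewrite -RintZ//; apply: Rint_norm; exact: (summableZ (u t x) (jump_summable t x)).
have sd := summableB (local_summable t) s.
rewrite -(Rint_aeeq (summable_measurable (summable_norm sd))
  (summable_measurable (summable_norm sw))); last first.
  by apply: filterS (weighted_ae t) => x ->.
pose b x := M * C * Q x + \int[lam]_y `|tested t (x, y)|.
have sQ : summable_fun lam (fun x => M * C * Q x) by apply: summableZ; exact: summable_cube.
apply: (@le_trans _ _ (\int[lam]_x b x)).
  apply: Rint_le; [exact: summable_norm|exact: summableD|move=> x].
  by apply: (le_trans (ler_normB _ _)); apply: lerD; [exact: local_le|exact: op].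
rewrite /b RintD// /mass RintZ; last exact: summable_cube.
rewrite -ei lerD2l -RintZ//.
by apply: (Rint_le sn (summableZ M es)) => p; exact: tested_le.
Qed.

Let weighted_late t x : T < t -> weighted (t, x) = 0.
Proof.
move=> Tt; have p0 y : psi (t, y) = 0 by exact: (tame_late tpsi _ (ltW Tt)).
rewrite /weighted /adj /adjoint_op (tame_derive1 tpsi) (tame_dlate tpsi)//.
rewrite /nonlocal_op Rint_eq0 ?subrr ?mulr0// => y.
by rewrite !p0 subrr mul0r.
Qed.

(** At each time the integral of the modulus is at most the constant mass, and
    it vanishes after time T. *)
Lemma weighted_integrable :
  (leb \x lam)%E.-integrable (`[0, +oo[%classic `*` setT)
    (fun p : measurableTypeR R * V => (weighted p)%:E).
Proof.
pose f (p : measurableTypeR R * V) : R := if 0 <= p.1 then weighted p else 0.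
have mass0 : 0 <= mass by apply: le_trans (weighted_norm 0); apply: Rint_ge0.
have mf : measurable_fun setT f.
  apply: measurable_fun_if => //.
  - by apply: measurable_fun_ler; [exact: measurable_cst|exact: measurable_fst].
  - exact: measurable_funTS measurable_adjoint.
have sf : summable_fun (leb \x lam)%E f.
  apply: (summable_iterated (g := fun t : measurableTypeR R =>
    mass * \1_(`[0, T + 1[%classic) t)) => //.
  - by move=> t; rewrite mulr_ge0.
  - apply: aeW => t; rewrite /f /=.
    have [t0|t0] := boolP (0 <= t); last first.
      rewrite normr0 integral0 lee_fin.
      by rewrite mulr_ge0.
    have [Tt|tT] := ltP T t.
      under eq_integral do rewrite weighted_late// normr0.
      by rewrite integral0 lee_fin mulr_ge0.
    rewrite -EFin_Rint; last by apply: summable_norm; have [] := weighted_integral t.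
    rewrite lee_fin indicE mem_set ?mulr1//= in_itv/= t0/=.
    by rewrite (le_lt_trans tT)// ltrDl.
  - apply: summableZ; have [] // := @summable_itv R 0 (T + 1) _.
    by rewrite addr_ge0// ltW// (tame_time_gt0 tpsi).
have D : measurable (`[0%R, +oo[%classic `*` setT : set (measurableTypeR R * V)).
  exact: measurableX.
have := integrableS measurableT D (@subsetT _ _) sf.
apply: eq_integrable => // -[t x]; rewrite inE/= => -[/= + _].
by rewrite in_itv/= andbT /f/= => ->.
Qed.

Lemma weak_formulation_of_density :
  summable_fun leb (fun t => if 0 <= t then weak_density J psi dpsi u t else 0) ->
  \int[leb]_t (if 0 <= t then weak_density J psi dpsi u t else 0) = 0 ->
  (\int[leb]_(t in `[0%R, +oo[%classic) \int[lam]_x (u t x * adj t x)%:E = 0)%E.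
Proof.
move=> sW iW; rewrite integral_mkcond.
transitivity (\int[leb]_t (if 0 <= t then weak_density J psi dpsi u t else 0)%:E)%E.
  apply: eq_integral => t _; rewrite patchE mem_setE in_itv/= andbT.
  case: ifPn => // _; have [s e] := weighted_integral t.
  by rewrite -e EFin_Rint.
by rewrite -EFin_Rint// iW.
Qed.

End weak_formulation.

(** * The evolution of a bounded integrable datum *)

Section evolutions.
Context {R : realType} {N : nat}.
Local Notation V := 'rV[R]_N.
Local Notation leb := (@lebesgue_measure R).
Local Notation lam := (@lebesgue_rV R N).
Local Notation dist1 u v := (\int[lam]_x `|u x - v x|).
Local Notation geo j := ((2^-1 : R) ^+ j).
Variables (M : R) (kap : V -> R) (J : R -> R -> V -> R).
Hypothesis M0 : 0 <= M.
Hypothesis hJ : jump_profile M kap J.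

(** Everything that the limit retains from the approximations. The initial value
    is attained up to a null set. *)
Record evolution (u : V -> R) (U : R -> V -> R) : Prop := {
  evolution_measurable :
    measurable_fun setT (fun p : measurableTypeR R * V => U p.1 p.2);
  evolution_bound : forall t x, `|U t x| <= M;
  evolution_summable : forall t, 0 <= t -> summable_fun lam (U t);
  evolution_initial : dist1 (U 0) u = 0;
  evolution_continuous : forall t e : R, 0 <= t -> 0 < e ->
    exists2 d : R, 0 < d & forall s, 0 <= s -> `|s - t| < d ->
      dist1 (U s) (U t) <= e;
  evolution_mass : forall t, 0 <= t -> \int[lam]_x U t x = \int[lam]_x u x;
  evolution_power : forall p t : R, 1 <= p -> 0 <= t ->
    summable_fun lam (pow_abs p \o U t) /\
    \int[lam]_x pow_abs p (U t x) <= \int[lam]_x pow_abs p (u x);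
  evolution_weak : forall psi dpsi C T m, tame_test psi dpsi C T m ->
    summable_fun leb (fun t => if 0 <= t then weak_density J psi dpsi U t else 0) /\
    \int[leb]_t (if 0 <= t then weak_density J psi dpsi U t else 0) = 0
}.

Lemma pow_abs_summable (p : R) (u : V -> R) : 1 <= p -> state M u ->
  summable_fun lam (pow_abs p \o u).
Proof.
move=> p1 su; apply: (summable_le (g := fun x : V => p * M `^ (p - 1) * `|u x|)).
- apply: measurableT_comp; first exact: measurable_pow_abs.
  exact: summable_measurable su.1.
- by move=> x; apply: pow_abs_le => //; exact: su.2.
- by apply: summableZ; exact: summable_norm su.1.
Qed.

Lemma evolution_exists (u : V -> R) : state M u -> exists U, evolution u U.
Proof.
move=> su.
have [L [h [w [nu [D [[L1 hL h0 hW] Hw Hc Ht]]]]]] := approximate_flows M0 hJ su.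
have sw j : state M (w j) by have [] := Hw j.
have nuj j : (j <= nu j)%N by have [] := Hw j.
have D0 j : 0 <= D j by have [] := Hw j.
have wu j : dist1 (w j) u <= geo j by have [] := Hw j.
pose v j t := flow J h (nu j) t (w j).
have sv j t : state M (v j t) := flow_state M0 hL h0 hW (nu j) t (sw j).
have mv j : measurable_fun setT (fun p : measurableTypeR R * V => v j p.1 p.2).
  apply: (measurable_steps (g := fun k => scheme J h (nu j) k (w j)) (h0 (nu j))) => k.
  exact: summable_measurable (scheme_state M0 hL h0 hW (nu j) k (sw j)).1.
have mU := measurable_limit_flow mv.
exists (limit_flow v); split => //.
- exact: limit_flow_bounded sv.
- by move=> t t0; exact: (limit_flow_summable sv mv Hc t0).
- apply/eqP; rewrite eq_le Rint_ge0 ?andbT => [|x]; last exact: normr_ge0.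
  apply/ler_addgt0Pr => e e0; rewrite add0r.
  have [j0 Hj] := geo_small 7 e0; pose j := j0.
  have d := limit_flow_dist sv mv Hc (lexx 0) (j := j).
  have {}d : dist1 (v j 0) (limit_flow v 0) <= 6 * geo j by apply: d; rewrite truncn0.
  have v0 : v j 0 = w j by rewrite /v /flow mul0r truncn0.
  have sU := limit_flow_summable sv mv Hc (lexx 0).
  apply: (le_trans (dist1_triangle sU (sw j).1 su.1)).
  have E : dist1 (limit_flow v 0) (w j) = dist1 (v j 0) (limit_flow v 0).
    by rewrite v0; apply: eq_Rint => x; rewrite distrC.
  rewrite E; apply: (le_trans (lerD d (wu j))).
  apply: le_trans (Hj j (leqnn _)); rewrite -[X in _ + X]mul1r -mulrDl.
  by apply: ler_wpM2r; [exact: exprn_ge0|lra].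
- by move=> t e t0 e0; exact: (limit_flow_continuous sv mv Hc Ht D0 t0 e0).
- move=> t t0; apply: (limit_flow_mass sv mv Hc t0) => j.
  rewrite (scheme_mass M0 hL h0 hW _ _ (sw j)) -RintB; [|exact: (sw j).1|exact: su.1].
  exact: le_trans (Rint_norm (summableB (sw j).1 su.1)) (wu j).
- move=> p t p1 t0; pose B := p * M `^ (p - 1).
  have B0 : 0 <= B by rewrite mulr_ge0 ?powR_ge0//; lra.
  apply: (limit_flow_functional M0 sv mv Hc (f := pow_abs p) (B := B)) => //.
  + exact: measurable_pow_abs.
  + by move=> a; exact: powR_ge0.
  + by move=> a b aM bM; exact: pow_abs_lipschitz.
  + by rewrite /pow_abs normr0 powR0// gt_eqF//; lra.
  move=> j; apply: (@le_trans _ _ (\int[lam]_x pow_abs p (w j x))).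
    apply: (scheme_jensen M0 hL h0 hW _ _ (s := pow_slope p) (C := B) (sw j)) => //.
    * exact: measurable_pow_abs.
    * by move=> r rM; exact: pow_abs_le.
    * by move=> a b _; exact: pow_subgradient.
  have s1 := pow_abs_summable p1 (sw j); have s2 := pow_abs_summable p1 su.
  rewrite addrC -lerBlDr -RintB//.
  apply: (@le_trans _ _ (\int[lam]_x (B * `|w j x - u x|))).
    apply: Rint_le; [exact: summableB| |move=> x].
      by apply: summableZ; apply: summable_norm; exact: summableB (sw j).1 su.1.
    apply: (le_trans (ler_norm _)).
    by apply: pow_abs_lipschitz => //; [exact: (sw j).2|exact: su.2].
  rewrite RintZ; first by apply: ler_wpM2l.
  by apply: summable_norm; exact: summableB (sw j).1 su.1.
- move=> psi dpsi C T m tpsi.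
  apply: (weak_density_integral M0 hJ L1 hL h0 hW tpsi nuj sw) => t.
    exact: measurable_limit_flow_slice mv t.
  exact: (limit_flow_ae sv Hc).
Qed.

End evolutions.

(** * Norms in extended form *)

Section norms.
Context {R : realType} {N : nat}.
Local Notation V := 'rV[R]_N.
Local Notation lam := (@lebesgue_rV R N).

Lemma ereal_cvg0 (T : Type) (F : set_system T) {FF : Filter F} (f : T -> \bar R) :
  (forall e : R, 0 < e -> \forall x \near F, (0 <= f x <= e%:E)%E) ->
  f x @[x --> F] --> 0%E.
Proof.
move=> H; apply/fine_cvgP; split.
  apply: filterS (H 1 ltr01) => x /andP[x0 x1].
  by rewrite ge0_fin_numE// (le_lt_trans x1)// ltry.
apply/cvgrPdist_le => e e0; apply: filterS (H e e0) => x /andP[x0 xe].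
have fx : f x \is a fin_num by rewrite ge0_fin_numE// (le_lt_trans xe)// ltry.
rewrite sub0r normrN ger0_norm ?fine_ge0//.
by rewrite -lee_fin fineK.
Qed.

Lemma norm1_Rint (f : V -> R) : summable_fun lam f ->
  'N[lam]_1[EFin \o f]%E = (\int[lam]_x `|f x|)%:E.
Proof. by move=> sf; rewrite Lnorm1 EFin_Rint//; exact: summable_norm. Qed.

Lemma Lnorm_power (r : R) (f : V -> R) : summable_fun lam (pow_abs r \o f) ->
  'N[lam]_(r%:E)[EFin \o f]%E = (((\int[lam]_x pow_abs r (f x)) `^ r^-1)%:E).
Proof.
move=> sf; rewrite unlock -poweR_EFin EFin_Rint//.
Qed.

Lemma Lnorm_bound (M : R) (f : V -> R) : (forall x, `|f x| <= M) ->
  ('N[lam]_+oo[EFin \o f] <= M%:E)%E.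
Proof.
move=> fM; rewrite unlock lebesgue_rV_gt0.
by apply/ess_supP; apply: nearW => x /=; rewrite lee_fin.
Qed.

Lemma Lfun_of_norm (p : \bar R) (f : V -> R) : measurable_fun setT f ->
  ('N[lam]_p[EFin \o f] < +oo)%E -> f \in Lfun lam p.
Proof. by move=> mf fp; rewrite inE; apply/andP; split; rewrite inE. Qed.

(** A function whose mass equals its norm has no negative part. *)
Lemma nonneg_of_integral (f : V -> R) : summable_fun lam f ->
  \int[lam]_x `|f x| <= \int[lam]_x f x -> {ae lam, forall x, 0 <= f x}.
Proof.
move=> sf h; have sn := summable_norm sf; have sg := summableB sn sf.
have g0 x : 0 <= `|f x| - f x by rewrite subr_ge0 ler_norm.
have : (\int[lam]_x `|(`|f x| - f x)%:E| = 0)%E.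
  rewrite (eq_integral (fun x => (`|f x| - f x)%:E)) => [|x _]; last first.
    by rewrite gee0_abs// lee_fin.
  rewrite -EFin_Rint//; congr EFin; apply/eqP; rewrite eq_le Rint_ge0// andbT.
  by rewrite RintB// subr_le0.
move/(ae_eq_integral_abs lam measurableT).
move=> H; have := H (measurable_int _ sg); apply: filterS => x /(_ I)/= [] /eqP.
by rewrite subr_eq0 => /eqP <-.
Qed.

End norms.

(** * Conclusion *)

Theorem corollary1p6 (R : realType) (N : nat) (hN : (0 < N)%N)
    (rho : R -> R -> 'rV[R]_N -> 'rV[R]_N -> R)
    (hrho : homogeneous_jump_kernel rho)
    (u0 : 'rV[R]_N -> R)
    (u0_L1 : u0 \in Lfun (lebesgue_rV N) 1%E)
    (u0_Linfty : u0 \in Lfun (lebesgue_rV N) +oo%E) :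
  exists u : R -> 'rV[R]_N -> R,
    [/\ very_weak_solution rho u0 u,
        essentially_bounded_L1_Linfty u /\ L1_continuous u,
        forall t : R, 0 <= t ->
          \int[lebesgue_rV N]_x u t x = \int[lebesgue_rV N]_x u0 x,
        forall (p : \bar R) (t : R), (1 <= p)%E -> 0 <= t ->
          ('N[lebesgue_rV N]_p[EFin \o u t]
             <= 'N[lebesgue_rV N]_p[EFin \o u0])%E &
        {ae lebesgue_rV N, forall x, 0 <= u0 x} ->
        forall t : R, 0 <= t -> {ae lebesgue_rV N, forall x, 0 <= u t x}].
Proof.
pose lam := @lebesgue_rV R N.
have mu0 : measurable_fun setT u0 by move: u0_L1; rewrite inE => /andP[/[!inE]].
have su0 : summable_fun lam u0 by exact/Lfun1_integrable.
have [M M0 MN] : exists2 M : R, 0 <= M & ('N[lam]_+oo[EFin \o u0] = M%:E)%E.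
  have fin : ('N[lam]_+oo[EFin \o u0] \is a fin_num)%E.
    rewrite ge0_fin_numE ?Lnorm_ge0//.
    by move: u0_Linfty; rewrite inE => /andP[_ /[!inE]].
  by exists (fine 'N[lam]_+oo[EFin \o u0]); rewrite ?fine_ge0 ?Lnorm_ge0// fineK.
have u0M : {ae lam, forall x, `|u0 x| <= M}.
  have := ess_sup_ge lam (abse \o (EFin \o u0)).
  move: MN; rewrite unlock lebesgue_rV_gt0 => ->.
  by apply: filterS => x /=; rewrite lee_fin.
(* The data agrees almost everywhere with one that is bounded at every point. *)
pose u := clip M \o u0.
have mu : measurable_fun setT u by apply: measurableT_comp => //; exact: measurable_clip.
have uu0 : {ae lam, forall x, u x = u0 x}.
  by apply: filterS u0M => x; exact: clip_id.
have u0u : {ae lam, forall x, u0 x = u x} by apply: filterS uu0 => x ->.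
have su : state M u.
  split; first exact: summable_aeeq mu0 mu u0u su0.
  by move=> x; exact: clip_bound.
have [kap [J [hJ rhoJ]]] := jump_profile_exists hrho M0.
have [U hU] := evolution_exists M0 hJ su.
have mU := evolution_measurable hU; have UM := evolution_bound hU.
have sU := evolution_summable hU.
have mUt t : measurable_fun setT (U t) by exact: (measurable_slice t mU).
have U1 t : 0 <= t -> \int[lam]_x `|U t x| <= \int[lam]_x `|u x|.
  move=> t0; have [_] := evolution_power hU (lexx 1) t0.
  have E (f : 'rV[R]_N -> R) : \int[lam]_x pow_abs 1 (f x) = \int[lam]_x `|f x|.
    by apply: eq_Rint => x; rewrite /pow_abs powRr1.
  by rewrite !E.
have L1U t : 0 <= t -> U t \in Lfun lam 1%E.
  by move=> t0; apply/Lfun1_integrable; exact: sU.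
have near_data t (e : R) : 0 <= t -> \int[lam]_x `|U t x - U 0 x| <= e ->
    \int[lam]_x `|U t x - u0 x| <= e.
  move=> t0 d; have s0 := summableB (sU t t0) su0; have s1 := summableB (sU t t0) su.1.
  have -> : \int[lam]_x `|U t x - u0 x| = \int[lam]_x `|U t x - u x|.
    apply: Rint_aeeq; [exact: summable_measurable (summable_norm s0)|
      exact: summable_measurable (summable_norm s1)|].
    by apply: filterS u0u => x ->.
  apply: (le_trans (dist1_triangle (sU t t0) (sU 0 (lexx 0)) su.1)).
  by rewrite (evolution_initial hU) addr0.
exists U; split.
- split.
  + exact: measurable_funTS mU.
  + by exists M; apply: aeW => -[t x] _; exact: UM.
  + move=> psi /test_tame[dpsi [C [T [m tpsi]]]]; split.
    * apply: filterS (ae_snd _ (faithful_ae rhoJ)) => -[t x] /= fx _.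
      exact: (rho_slice_summable hrho hJ tpsi mU UM t fx).
    * exact: (weighted_integrable hrho hJ rhoJ tpsi mU UM).
    * have [sW iW] := evolution_weak hU tpsi.
      exact: (weak_formulation_of_density hrho hJ rhoJ tpsi mU UM sW iW).
  + move=> K cK; have mK : measurable K.
      by apply: closed_measurable_rV; apply: compact_closed => //; exact: norm_hausdorff.
    apply: ereal_cvg0 => e e0.
    have [d d0 Hd] := evolution_continuous hU (lexx 0) e0.
    near=> t; have t0 : 0 <= t by near: t; exact: nbhs_right_ge.
    have td : t < d by near: t; exact: nbhs_right_lt.
    have s0 := summable_norm (summableB (sU t t0) su0).
    apply/andP; split; first by apply: integral_ge0 => x _; rewrite lee_fin.
    apply: (@le_trans _ _ (\int[lam]_x `|U t x - u0 x|%:E)%E).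
      apply: ge0_subset_integral => //.
      by apply/measurable_EFinP; exact: (summable_measurable s0).
    rewrite -EFin_Rint// lee_fin; apply: near_data => //; apply: Hd => //.
    by rewrite subr0 ger0_norm.
- split.
    exists (\int[lam]_x `|u x| + M); apply: aeW => t t0.
    have N1 := norm1_Rint (sU t t0); have Noo := Lnorm_bound (UM t).
    split; first exact: L1U.
      by apply: Lfun_of_norm => //; exact: le_lt_trans Noo (ltry _).
    rewrite EFinD; apply: leeD => //.
    by rewrite N1 lee_fin; exact: U1.
  move=> t t0; split; first exact: L1U.
  apply: ereal_cvg0 => e e0; have [d d0 Hd] := evolution_continuous hU t0 e0.
  rewrite near_withinE; near=> s => /= /[!in_itv]/= /[!andbT] s0.
  have st : `|s - t| < d.
    by near: s; apply/nbhs_ballP; exists d => //= s; rewrite /ball/= distrC.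
  rewrite Lnorm_ge0/= norm1_Rint; last exact: summableB (sU s s0) (sU t t0).
  by rewrite lee_fin; exact: Hd.
- move=> t t0; rewrite (evolution_mass hU t0).
  exact: Rint_aeeq.
- move=> [r| |] // t p1 t0; last first.
    by rewrite MN; exact: Lnorm_bound.
  have r1 : 1 <= r by rewrite -lee_fin.
  have [sr ir] := evolution_power hU r1 t0.
  have su' := pow_abs_summable M0 r1 su.
  have m0 : measurable_fun setT (pow_abs r \o u0).
    by apply: measurableT_comp => //; exact: measurable_pow_abs.
  have ae0 : {ae lam, forall x, pow_abs r (u x) = pow_abs r (u0 x)}.
    by apply: filterS uu0 => x ->.
  have s0 := summable_aeeq (summable_measurable su') m0 ae0 su'.
  rewrite (Lnorm_power sr) (Lnorm_power s0) lee_fin.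
  have -> : \int[lam]_x pow_abs r (u0 x) = \int[lam]_x pow_abs r (u x).
    apply/esym; exact: (Rint_aeeq (summable_measurable su') m0 ae0).
  have I0 (f : 'rV[R]_N -> R) : \int[lam]_x pow_abs r (f x) \in Num.nneg.
    by rewrite nnegrE; apply: Rint_ge0 => x; exact: powR_ge0.
  apply: ge0_ler_powR; [|exact: I0|exact: I0|exact: ir].
  by rewrite invr_ge0; exact: le_trans ler01 r1.
- move=> u0_ge0 t t0; apply: nonneg_of_integral (sU t t0) _.
  apply: (le_trans (U1 t t0)); rewrite (evolution_mass hU t0).
  apply: ler_of_eq; apply: Rint_aeeq => //; first exact: measurableT_comp.
  by apply: filterS2 uu0 u0_ge0 => x -> x0; rewrite ger0_norm.
Unshelve. all: by end_near.
Qed.
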